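(* Let $\gamma<0$ and suppose that assumptions (A.1)–(A.4) of the context hold. Then there exist a unique (up to an additive constant) function $w^\gamma_\delta\in C_\omega(E)$ and a unique constant $\lambda^\gamma_\delta\in\mathbb{R}$ solving the Bellman equation $$w^\gamma_\delta(x)+\lambda^\gamma_\delta=\max\Big\{\mu_x^\gamma\Big(\int_0^\delta f(X_s)\,ds+w^\gamma_\delta(X_\delta)\Big),\ \sup_{\xi\in U}\Big(\mu_\xi^\gamma\Big(\int_0^\delta f(X_s)\,ds+w^\gamma_\delta(X_\delta)\Big)+c(x,\xi)\Big)\Big\},\qquad x\in E.$$
   Context: Setting. $E=\mathbb{R}^d$, $U\subseteq E$ is compact, $\delta>0$ is fixed, and $X=(X_t)_{t\ge0}$ is a continuous-time Feller–Markov process with values in $E$, defined on a filtered probability space satisfying the usual conditions. $\mathbb{P}_x,\mathbb{E}_x$ denote probability and expectation for the (uncontrolled) process started at $x\in E$. The functions $f:E\to\mathbb{R}$ (reward) and $c:E\times U\to\mathbb{R}_-$ (shift cost) are given. Entropic utility: for a random variable $Z$, $\mu_x^\gamma(Z):=\frac1\gamma\ln\mathbb{E}_x[\exp(\gamma Z)]$ for $\gamma\ne0$ and $\mu^0_x(Z):=\mathbb{E}_x[Z]$. Weighted space: $\omega:E\to\mathbb{R}_+$ is a fixed continuous function, and $C_\omega(E)$ is the space of continuous $g:E\to\mathbb{R}$ with $\|g\|_\omega:=\sup_{x\in E}\frac{|g(x)|}{1+\omega(x)}<\infty$. Assumptions: (A.1) $f$ is continuous and $\|f\|_\omega<\infty$.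 (A.2) $c$ is continuous, there exists $c_0<0$ such that $c(x,\xi)\le c_0$ for all $x\in E$, $\xi\in U$, and $\|\hat c\|_\omega<\infty$, where $\hat c(x):=\inf_{\xi\in U}c(x,\xi)$. (A.3) There exist a constant $b_1\in(0,1)$ and finite functions $M_1,M_2:\mathbb{R}\to\mathbb{R}$ such that for all $\gamma\in\mathbb{R}$ and $x\in E$: $\mu_x^\gamma\big(\int_0^\delta\omega(X_s)\,ds\big)\le\omega(x)+M_1(\gamma)$ and $\mu_x^\gamma(\omega(X_\delta))\le b_1\omega(x)+M_2(\gamma)$. (A.4) For every $R>0$ there exist $d>0$ and a probability measure $\nu$ on $E$ with $\nu(U)>0$ such that $\inf_{x\in C_R}\mathbb{P}_x[X_\delta\in A]\ge d\,\nu(A)$ for all Borel $A\subseteq E$, where $C_R=\{x\in E:\omega(x)\le R\}$. *)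

(* Defs.v *)
From HB Require Import structures.
From mathcomp Require Import all_boot all_order all_algebra.
From mathcomp Require Import all_classical all_reals all_analysis.
From mathcomp Require Import measurable_realfun.

Set Implicit Arguments.
Unset Strict Implicit.
Unset Printing Implicit Defensive.

Import Order.TTheory GRing.Theory Num.Theory.
Import numFieldNormedType.Exports.

Local Open Scope classical_set_scope.
Local Open Scope ring_scope.

(* R^d with its Borel sigma-algebra; the type is convertible to 'rV[R]_d. *)
Definition borel_space (R : realType) (d : nat) :
    measurableType (@open 'rV[R]_d).-sigma :=
  g_sigma_algebraType (@open 'rV[R]_d).

Section Process.
Context {R : realType} {d : nat} {disp : measure_display}
  {Omega : measurableType disp}.

Local Notation E := 'rV[R]_d.
Local Notation borel B := (measurable (B : set (borel_space R d))).

(* Only the times t >= 0 are meaningful, both for filtrations and processes. *)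
Record filtration (F : R -> set (set Omega)) : Prop := Filtration {
  filtration_sigma : forall t : R, 0 <= t -> sigma_algebra setT (F t);
  filtration_sub : forall t : R, 0 <= t -> F t `<=` measurable;
  filtration_mono : forall s t : R, 0 <= s -> s <= t -> F s `<=` F t }.

(* The filtration is shared by the whole family (P x)_x, so the null sets that
   it has to contain are those that are null simultaneously for all x. Since
   P x [X 0 = x] = 1, asking for the null sets of each single P x would put
   every subset of Omega in F 0 as soon as R^d has two points. *)
Record usual_conditions (P : E -> probability Omega R)
    (F : R -> set (set Omega)) : Prop := UsualConditions {
  usual_right_continuous : forall t : R, 0 <= t ->
    \bigcap_(s in [set s | t < s]) F s = F t;
  usual_complete : forall N A : set Omega, measurable A ->
    (forall x, P x A = 0%E) -> N `<=` A -> F 0 N }.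

Definition cadlag (u : R -> E) : Prop :=
  (forall t : R, 0 <= t -> u s @[s --> t^'+] --> u t) /\
  (forall t : R, 0 < t -> cvg (u s @[s --> t^'-])).

Definition vanishing_continuous (g : E -> R) : Prop :=
  continuous g /\
  forall e : R, 0 < e ->
    exists2 K : set E, compact K & forall x, ~ K x -> `|g x| < e.

Definition transition_semigroup (P : E -> probability Omega R)
    (X : R -> Omega -> E) (t : R) (g : E -> R) (x : E) : R :=
  \int[P x]_w g (X t w).

Record feller (P : E -> probability Omega R) (X : R -> Omega -> E) : Prop :=
  Feller {
  feller_stable : forall (t : R) g, 0 <= t -> vanishing_continuous g ->
    vanishing_continuous (transition_semigroup P X t g);
  feller_strong : forall g, vanishing_continuous g ->
    forall e : R, 0 < e -> \forall t \near (0 : R)^'+,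
      forall x, `|transition_semigroup P X t g x - g x| <= e }.

(* markov_property is P_x[X_(t+s) \in B | F_t] = P_(X_t)[X_s \in B] a.s., with
   the conditional probability spelled out as its defining integral identity. *)
Record feller_markov (P : E -> probability Omega R)
    (F : R -> set (set Omega)) (X : R -> Omega -> E) : Prop := FellerMarkov {
  markov_adapted : forall (t : R) B, 0 <= t -> borel B -> F t (X t @^-1` B);
  markov_cadlag : forall w, cadlag (fun t => X t w);
  markov_start : forall x, P x [set w | X 0 w = x] = 1%E;
  markov_kernel : forall (t : R) B, 0 <= t -> borel B ->
    measurable_fun [set: borel_space R d]
      (fun x : borel_space R d => P x (X t @^-1` B));
  markov_property : forall x (t s : R) A B, 0 <= t -> 0 <= s -> F t A -> borel B ->
    P x (A `&` X (t + s) @^-1` B) =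
      (\int[P x]_(w in A) P (X t w) (X s @^-1` B))%E;
  markov_feller : feller P X }.

(* Extended-real valued: for gamma <> 0 the expectation of the exponential may
   be +oo. *)
Definition entropic_utility (Q : probability Omega R) (gamma : R)
    (Z : Omega -> R) : \bar R :=
  if gamma == 0 then ('E_Q[Z])%E
  else (gamma^-1%:E * lne 'E_Q[fun w => expR (gamma * Z w)])%E.

Definition time_integral (X : R -> Omega -> E) (delta : R) (g : E -> R)
    (w : Omega) : R :=
  \int[lebesgue_measure]_(s in `[0, delta]) g (X s w).

Definition wnorm (omega g : E -> R) : \bar R :=
  ereal_sup [set (`|g x| / (1 + omega x))%:E | x in [set: E]].

Definition weighted_continuous (omega g : E -> R) : Prop :=
  continuous g /\ (wnorm omega g < +oo)%E.

Definition bellman_equation (P : E -> probability Omega R)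
    (X : R -> Omega -> E) (U : set E) (delta gamma : R) (f : E -> R)
    (c : E -> E -> R) (w : E -> R) (lambda : R) : Prop :=
  let mu x := entropic_utility (P x) gamma
    (fun a => time_integral X delta f a + w (X delta a)) in
  forall x : E, (w x + lambda)%:E =
    maxe (mu x) (ereal_sup [set (mu xi + (c x xi)%:E)%E | xi in U]).

End Process.

(* Main.v *)
Require Import Defs.
From HB Require Import structures.
From mathcomp Require Import all_boot all_order all_algebra.
From mathcomp Require Import all_classical all_reals all_analysis.
From mathcomp Require Import measurable_realfun.
From mathcomp Require Import ring lra zify.

Set Implicit Arguments.
Unset Strict Implicit.
Unset Printing Implicit Defensive.

Import Order.TTheory GRing.Theory Num.Theory.
Import numFieldNormedType.Exports.

Local Open Scope classical_set_scope.
Local Open Scope ring_scope.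

(** The equation says that [w] is a fixed point, up to the constant [lambda], of
    the Bellman operator [Bop] built from [Rop w x], the entropic utility of the
    reward collected over one period plus the continuation value [w] at its end.
    Adding a constant to [w] adds the same constant to [Bop w], so the natural
    statement is that [Bop] is a contraction modulo constants.

    The contraction is a weighted version of Doeblin's argument.  By concavity
    of the utility ([Rop_sub_le], Gibbs' inequality) a difference
    [Rop w' x - Rop w x] is at most the mean of [w' - w] under the tilted law
    with density proportional to [exp (gamma * total w)].  Tilted laws inherit
    two properties from the process, uniformly over all [w] in a ball of the
    weighted space: a drift towards small values of [omega] ([tilted_drift]),
    because exponential moments of every order are available, and a common part
    for starting points in a bounded region ([tilted_overlap]), because the
    minorisation survives a change of density whose logarithm has a bounded
    mean.  Measuring [w' - w] in the span seminorm with weight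
    [1 + beta * omega], [beta] small, both properties together give a factor
    [eta < 1] ([Rop_contract], [Bop_contract]).  The pair [(beta, eta)] depends
    on the ball.  Uniqueness needs nothing more, since two given solutions lie
    in a common ball ([bellman_unique]).

    For existence the iterates of [Bop] have to stay in one ball, up to
    constants ([envelope_invariant]).  From below, the option to shift into [U]
    bounds [Bop w x] by its values on [U] minus the shift cost.  From above, far
    out the drift dominates; in a bounded region the negative risk parameter
    matters: the process reaches [U] with probability bounded below, and a
    risk-averse utility is dominated by the small values that [w] takes there
    ([Rop_local]).  The normalised iterates then converge geometrically and the
    limit is a fixed point modulo constants ([bellman_exists]).

    It remains that [Bop] preserves continuity, which is where the Feller
    property enters.  For reward and continuation value with a limit at
    infinity, dyadic sums approximate the time integral in mean, uniformly in
    the starting point, by strong continuity of the semigroup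
    ([increment_small], [dyadic_sum_uniform]); with a dyadic sum in place of the
    integral the exponential moment is an iterated application of the semigroup
    ([product_regular]).  The general case follows by cutting off outside a
    large ball: the paths stay in it up to a small probability, locally
    uniformly in the starting point ([containment], by Ottaviani's inequality),
    and exponential moments control the remainder ([reward_continuous]). *)

(** * Expectations of real random variables *)

Notation itg Q Z := (Q.-integrable setT (EFin \o Z)).
Notation mean Q Z := (Rintegral Q setT Z).

Section Expectation.
Context {R : realType} {disp : measure_display} {T : measurableType disp}.
Variable Q : probability T R.
Implicit Types (Y Z u v : T -> R) (A : set T).

Lemma itg_measurable Z : itg Q Z -> measurable_fun setT Z.
Proof. by move=> /integrableP[/measurable_EFinP]. Qed.

Lemma itg_cst a : itg Q (fun=> a).
Proof. exact: finite_measure_integrable_cst. Qed.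

Lemma itgD Y Z : itg Q Y -> itg Q Z -> itg Q (fun w => Y w + Z w).
Proof. by move=> iY iZ; exact: (@integrableD _ _ _ _ _ measurableT _ _ iY iZ). Qed.

Lemma itgZ a Z : itg Q Z -> itg Q (fun w => a * Z w).
Proof. by move=> iZ; exact: (@integrableZl _ _ _ _ _ measurableT _ _ iZ). Qed.

Lemma itgB Y Z : itg Q Y -> itg Q Z -> itg Q (fun w => Y w - Z w).
Proof. by move=> iY iZ; exact: (@integrableB _ _ _ _ _ measurableT _ _ iY iZ). Qed.

Lemma itg_le Y Z : measurable_fun setT Z -> (forall w, `|Z w| <= Y w) ->
  itg Q Y -> itg Q Z.
Proof.
move=> mZ ZY; apply: le_integrable => //; first exact/measurable_EFinP.
by move=> w _ /=; rewrite lee_fin (le_trans (ZY w))// ler_norm.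
Qed.

Lemma itg_bounded Z a : measurable_fun setT Z -> (forall w, `|Z w| <= a) -> itg Q Z.
Proof. by move=> mZ Za; apply: (itg_le mZ Za); exact: itg_cst. Qed.

Lemma itg_norm Z : itg Q Z -> itg Q (fun w => `|Z w|).
Proof. by move=> iZ; exact: (@integrable_norm _ _ _ _ _ _ iZ). Qed.

Lemma itgM_bounded Y Z a : measurable_fun setT Y -> (forall w, `|Y w| <= a) ->
  itg Q Z -> itg Q (fun w => Y w * Z w).
Proof.
move=> mY Ya iZ; apply: (@itg_le (fun w => a * `|Z w|)).
- by apply: measurable_funM => //; exact: itg_measurable.
- by move=> w; rewrite normrM ler_wpM2r.
- exact/itgZ/itg_norm.
Qed.

Lemma mean_cst a : mean Q (fun=> a) = a.
Proof. by rewrite Rintegral_cst//= probability_setT mulr1. Qed.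

Lemma meanD Y Z : itg Q Y -> itg Q Z ->
  mean Q (fun w => Y w + Z w) = mean Q Y + mean Q Z.
Proof. exact: RintegralD. Qed.

Lemma meanB Y Z : itg Q Y -> itg Q Z ->
  mean Q (fun w => Y w - Z w) = mean Q Y - mean Q Z.
Proof. exact: RintegralB. Qed.

Lemma meanZ a Z : itg Q Z -> mean Q (fun w => a * Z w) = a * mean Q Z.
Proof. exact: RintegralZl. Qed.

Lemma mean_le Y Z : itg Q Y -> itg Q Z -> (forall w, Y w <= Z w) ->
  mean Q Y <= mean Q Z.
Proof. by move=> iY iZ YZ; apply: le_Rintegral. Qed.

Lemma mean_ge0 Y : (forall w, 0 <= Y w) -> 0 <= mean Q Y.
Proof. by move=> Y0; apply: Rintegral_ge0. Qed.

Lemma mean_norm Z : itg Q Z -> `|mean Q Z| <= mean Q (fun w => `|Z w|).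
Proof. by move=> iZ; apply: le_normr_Rintegral. Qed.

Lemma mean_le_cst Z a : itg Q Z -> (forall w, Z w <= a) -> mean Q Z <= a.
Proof. by move=> iZ Za; rewrite -[leRHS]mean_cst; apply: mean_le => //; exact: itg_cst. Qed.

Lemma mean_norm_le Z a : measurable_fun setT Z -> (forall w, `|Z w| <= a) ->
  `|mean Q Z| <= a.
Proof.
move=> mZ Za; have iZ := itg_bounded mZ Za.
by rewrite (le_trans (mean_norm iZ))//; apply: mean_le_cst => //; exact: itg_norm.
Qed.

Lemma mean_sum n (Y : nat -> T -> R) : (forall i, itg Q (Y i)) ->
  itg Q (fun w => \sum_(i < n) Y i w) /\
  mean Q (fun w => \sum_(i < n) Y i w) = \sum_(i < n) mean Q (Y i).
Proof.
move=> iY; elim: n => [|n [ih1 ih2]].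
  have -> : (fun w => \sum_(i < 0) Y i w) = (fun=> 0).
    by apply/funext => w; rewrite big_ord0.
  by split; [exact: itg_cst|rewrite mean_cst big_ord0].
have -> : (fun w => \sum_(i < n.+1) Y i w) = (fun w => \sum_(i < n) Y i w + Y n w).
  by apply/funext => w; rewrite big_ord_recr.
by split; [exact: itgD|rewrite meanD// ih2 big_ord_recr].
Qed.

Lemma itg_indic A : measurable A -> itg Q (\1_A : T -> R).
Proof. by move=> mA; exact: integrable_indic. Qed.

Lemma mean_indic A : measurable A -> mean Q (\1_A : T -> R) = fine (Q A).
Proof. by move=> mA; rewrite /Rintegral integral_indic// setIT. Qed.

Lemma measurable_expR_comp Z : measurable_fun setT Z -> measurable_fun setT (fun w => expR (Z w)).
Proof. by move=> mZ; exact: measurableT_comp. Qed.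

(** Integrate the tangent inequality of the exponential at the mean. *)
Lemma jensen_expR Z : itg Q Z -> itg Q (fun w => expR (Z w)) ->
  expR (mean Q Z) <= mean Q (fun w => expR (Z w)).
Proof.
move=> iZ ieZ; set m := mean Q Z.
have iL : itg Q (fun w => expR m * (1 - m + Z w)).
  exact: itgZ (itgD (itg_cst _) iZ).
have -> : expR m = mean Q (fun w => expR m * (1 - m + Z w)).
  rewrite meanZ; last exact: itgD (itg_cst _) iZ.
  by rewrite meanD//; [rewrite mean_cst -/m subrK mulr1|exact: itg_cst].
apply: mean_le => // w.
have -> : expR (Z w) = expR m * expR (Z w - m) by rewrite -expRD; congr expR; lra.
rewrite ler_pM2l ?expR_gt0//; apply: le_trans (expR_ge1Dx _); lra.
Qed.

Lemma mean_le_expR Z a : itg Q Z -> itg Q (fun w => expR (Z w)) ->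
  mean Q (fun w => expR (Z w)) <= expR a -> mean Q Z <= a.
Proof. by move=> iZ ieZ /(le_trans (jensen_expR iZ ieZ)); rewrite ler_expR. Qed.

(** Cauchy-Schwarz in exponential form: after normalising both factors it is
    the arithmetic-geometric inequality. *)
Lemma holder_expR u v a b : measurable_fun setT u -> measurable_fun setT v ->
  itg Q (fun w => expR (2 * u w)) -> mean Q (fun w => expR (2 * u w)) <= expR (2 * a) ->
  itg Q (fun w => expR (2 * v w)) -> mean Q (fun w => expR (2 * v w)) <= expR (2 * b) ->
  itg Q (fun w => expR (u w + v w)) /\
  mean Q (fun w => expR (u w + v w)) <= expR (a + b).
Proof.
move=> mu mv iu ua iv vb.
pose g w := expR (b - a) / 2 * expR (2 * u w) + expR (a - b) / 2 * expR (2 * v w).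
have le_g w : expR (u w + v w) <= g w.
  pose x := expR ((b - a) / 2 + u w); pose y := expR ((a - b) / 2 + v w).
  have -> : expR (u w + v w) = x * y by rewrite -expRD; congr expR; lra.
  have -> : g w = (x * x + y * y) / 2.
    rewrite -!expRD /g.
    have -> : (b - a) / 2 + u w + ((b - a) / 2 + u w) = (b - a) + 2 * u w by lra.
    have -> : (a - b) / 2 + v w + ((a - b) / 2 + v w) = (a - b) + 2 * v w by lra.
    by rewrite !expRD; lra.
  have := sqr_ge0 (x - y); rewrite expr2; lra.
have ig : itg Q g by apply: itgD; exact: itgZ.
have iuv : itg Q (fun w => expR (u w + v w)).
  apply: itg_le ig.
    by apply: measurable_expR_comp; exact: measurable_funD.
  by move=> w; rewrite ger0_norm ?expR_ge0// le_g.
split => //.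
apply: (le_trans (mean_le iuv ig le_g)).
rewrite meanD ?meanZ//; [|exact: itgZ|exact: itgZ].
have h1 : expR (b - a) / 2 * mean Q (fun w => expR (2 * u w)) <= expR (a + b) / 2.
  have -> : expR (a + b) = expR (b - a) * expR (2 * a).
    by rewrite -expRD; congr expR; lra.
  by rewrite mulrAC ler_pM2r ?invr_gt0// ler_pM2l// expR_gt0.
have h2 : expR (a - b) / 2 * mean Q (fun w => expR (2 * v w)) <= expR (a + b) / 2.
  have -> : expR (a + b) = expR (a - b) * expR (2 * b).
    by rewrite -expRD; congr expR; lra.
  by rewrite mulrAC ler_pM2r ?invr_gt0// ler_pM2l// expR_gt0.
lra.
Qed.

(** Jensen for the law conditioned on [A]: the minorant of [exp (- Y)] is its
    tangent at [m / p]. *)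
Lemma mean_expR_minor A Y m p : measurable A -> itg Q Y ->
  itg Q (fun w => expR (- Y w)) ->
  (forall w, 0 <= Y w) -> mean Q Y <= m -> 0 < p -> p <= mean Q (\1_A : T -> R) ->
  p * expR (- (m / p)) <= mean Q (fun w => \1_A w * expR (- Y w)).
Proof.
move=> mA iY ieY Y0 Ym p0 pA; set t := m / p.
have m0 : 0 <= m by apply: le_trans Ym; exact: mean_ge0.
have t0 : 0 <= t by rewrite divr_ge0// ltW.
have iA := itg_indic mA.
have mI : measurable_fun setT (\1_A : T -> R) by exact: itg_measurable.
have bI w : `|\1_A w : R| <= 1 by rewrite indicE; case: (_ \in _); rewrite ?normr1 ?normr0.
have iL : itg Q (fun w => expR (- t) * ((1 + t) * \1_A w - Y w)).
  exact: itgZ (itgB (itgZ _ iA) iY).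
apply: (@le_trans _ _ (mean Q (fun w => expR (- t) * ((1 + t) * \1_A w - Y w)))).
  rewrite meanZ; last exact: itgB (itgZ _ iA) iY.
  rewrite meanB//; last exact: itgZ.
  rewrite meanZ// mulrC ler_pM2l ?expR_gt0//.
  have : (1 + t) * p <= (1 + t) * mean Q (\1_A : T -> R) by rewrite ler_wpM2l// addr_ge0.
  have : t * p = m by rewrite /t divfK// gt_eqF.
  lra.
apply: mean_le => //; first exact: itgM_bounded ieY.
move=> w; rewrite indicE; case: (_ \in _); rewrite ?mulr1 ?mul1r ?mulr0 ?mul0r.
  have -> : expR (- Y w) = expR (- t) * expR (t - Y w) by rewrite -expRD; congr expR; lra.
  rewrite ler_pM2l ?expR_gt0//; apply: le_trans (expR_ge1Dx _); lra.
by rewrite sub0r mulrN oppr_le0 mulr_ge0 ?expR_ge0.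
Qed.

End Expectation.

(** * Time integrals along paths as limits of dyadic sums *)

Section DyadicSums.
Context {R : realType}.
Variable delta : R.
Hypothesis delta_gt0 : 0 < delta.

Local Notation mu := (@lebesgue_measure R).

Definition mesh (n : nat) : R := delta / 2 ^+ n.

(** Right endpoints: the paths are only right-continuous. *)
Definition dyadic_sum (n : nat) (v : R -> R) : R :=
  mesh n * \sum_(i < 2 ^ n) v (i.+1%:R * mesh n).

Lemma mesh_gt0 n : 0 < mesh n.
Proof. by rewrite divr_gt0// exprn_gt0. Qed.

Lemma mesh_total n : (2 ^ n)%:R * mesh n = delta.
Proof. by rewrite /mesh natrX mulrCA divff ?mulr1// expf_neq0. Qed.

Lemma mesh_point_le n i : (i <= 2 ^ n)%N -> i%:R * mesh n <= delta.
Proof. by move=> i2; rewrite -(mesh_total n) ler_pM2r ?mesh_gt0// ler_nat. Qed.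

Lemma mesh_point_ge0 n i : 0 <= i%:R * mesh n.
Proof. by rewrite mulr_ge0// ltW// mesh_gt0. Qed.

Lemma mesh_small e : 0 < e -> \forall n \near \oo, mesh n < e.
Proof.
move=> e0; have ed : 0 < e / delta by rewrite divr_gt0.
have := near_infty_natSinv_expn_lt (PosNum ed).
apply: filterS => n /=; rewrite /mesh ltr_pdivlMr// => h.
by rewrite mulrC -div1r.
Qed.

Lemma mesh_bracket n s : 0 < s -> s <= delta ->
  exists i : 'I_(2 ^ n), i%:R * mesh n < s <= i.+1%:R * mesh n.
Proof.
move=> s0 sd.
have exP : exists i, s <= i.+1%:R * mesh n.
  by exists (2 ^ n).-1; rewrite prednK ?expn_gt0// mesh_total.
case: (ex_minnP exP) => i si mini.
have i2 : (i < 2 ^ n)%N.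
  have : (i <= (2 ^ n).-1)%N by apply: mini; rewrite prednK ?expn_gt0// mesh_total.
  by move=> /leq_ltn_trans; apply; rewrite prednK ?expn_gt0.
exists (Ordinal i2) => /=; rewrite si andbT.
case: i mini {si i2} => [_|i mini]; first by rewrite mul0r.
by rewrite ltNge; apply/negP => /mini; rewrite ltnn.
Qed.

Lemma near_right_ex (P : R -> Prop) t : (\forall s \near t^'+, P s) ->
  exists2 r, 0 < r & forall s, t < s -> s < t + r -> P s.
Proof.
move=> /nbhs_ballP[r /= r0 tP]; exists r => // s ts sr.
by apply: tP => //; rewrite /ball/= ltr_distlC; apply/andP; split=> //; lra.
Qed.

Lemma near_left_ex (P : R -> Prop) t : (\forall s \near t^'-, P s) ->
  exists2 r, 0 < r & forall s, s < t -> t - r < s -> P s.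
Proof.
move=> /nbhs_ballP[r /= r0 tP]; exists r => // s ts sr.
by apply: tP => //; rewrite /ball/= ltr_distlC; apply/andP; split=> //; lra.
Qed.

(** The dyadic sum is the integral of a step function that converges pointwise
    by right-continuity; this also yields the measurability of the integrand. *)
Lemma dyadic_sum_cvg (v : R -> R) (M : R) :
  (forall t, 0 <= t -> v s @[s --> t^'+] --> v t) ->
  (forall s, 0 <= s <= delta -> `|v s| <= M) ->
  dyadic_sum n v @[n --> \oo] --> \int[lebesgue_measure]_(s in `[0, delta]) v s.
Proof.
move=> vr vM.
pose I n (i : nat) : set R := `]i%:R * mesh n, i.+1%:R * mesh n]%classic.
pose step n s : R := \sum_(i < 2 ^ n) v (i.+1%:R * mesh n) * \1_(I n i) s.
pose D : set R := `]0, delta]%classic.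
have stepE n s : D s -> exists2 t, step n s = v t & s <= t <= delta /\ t < s + mesh n.
  rewrite /D /= in_itv/= => /andP[s0 sd].
  have [i /andP[si is_]] := mesh_bracket n s0 sd.
  exists (i.+1%:R * mesh n).
    rewrite /step (bigD1 i)//= big1 ?addr0 => [|j ji].
      by rewrite indicE mem_set ?mulr1//= /I/= in_itv/= si.
    rewrite indicE memNset ?mulr0// /I /= in_itv/= => /andP[sj js].
    have m0 := mesh_gt0 n.
    have : j%:R < i.+1%:R :> R by rewrite -(ltr_pM2r m0); lra.
    have : i%:R < j.+1%:R :> R by rewrite -(ltr_pM2r m0); lra.
    rewrite !ltr_nat !ltnS => ij ji'.
    by move: ji; rewrite -val_eqE /= eqn_leq ij ji'.
  rewrite is_ mesh_point_le//; split=> //.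
  by rewrite -natr1 mulrDl mul1r ltrD2r.
have step_cvg s : D s -> step n s @[n --> \oo] --> v s.
  move=> Ds; have s0 : 0 <= s by move: Ds; rewrite /D/= in_itv/= => /andP[/ltW].
  apply/cvgrPdist_le => e e0.
  have /cvgrPdist_le /(_ _ e0) := vr _ s0.
  move=> /near_right_ex[r r0 h].
  near=> n.
  have [t -> [/andP[st _] ts]] := stepE n s Ds.
  move: st; rewrite le_eqVlt => /predU1P[<-|st]; first by rewrite subrr normr0 ltW.
  apply: h => //; apply: (lt_trans ts); rewrite ltrD2l.
  by near: n; exact: mesh_small.
have mI n i : measurable (I n i) by exact: measurable_itv.
have mstep n : measurable_fun D (step n).
  apply: measurable_sum => i; apply: measurable_funM => //.
have mv : measurable_fun D v.
  by apply: (@measurable_fun_cvg _ _ _ D step) => // s; exact: step_cvg.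
have muD : mu D = delta%:E.
  by rewrite /D lebesgue_measure_itv/= lte_fin delta_gt0 -EFinB subr0.
have mD : measurable D by exact: measurable_itv.
have icst (a : R) : mu.-integrable D (EFin \o cst a).
  apply: measurable_bounded_integrable => //.
    by change (mu D < +oo)%E; rewrite muD ltry.
  exists `|a|; rewrite num_real; split=> // y ay z _ /=; exact: ltW.
have h1 n : measurable_fun D (fun s => (step n s)%:E) by exact/measurable_EFinP.
have h2 : measurable_fun D (EFin \o v) by exact/measurable_EFinP.
have h3 : {ae mu, forall s, D s -> (fun n => (step n s)%:E) @ \oo --> (EFin \o v) s}.
  apply: aeW => s Ds; apply: cvg_EFin; first by apply: nearW.
  exact: step_cvg.
have h4 : {ae mu, forall s n, D s -> (`|(step n s)%:E| <= (EFin \o cst M) s)%E}.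
  apply: aeW => s n Ds /=; rewrite lee_fin.
  have [t -> [/andP[st td] _]] := stepE n s Ds.
  apply: vM; rewrite td (le_trans _ st)//.
  by move: Ds; rewrite /D/= in_itv/= => /andP[/ltW].
have [iv _ cv] := @dominated_convergence _ _ R mu D mD _ _ _ h1 h2 h3 (icst M) h4.
have intstep n : (\int[mu]_(s in D) (step n s)%:E = (dyadic_sum n v)%:E)%E.
  have iI i : mu.-integrable D (fun s => (v (i.+1%:R * mesh n))%:E * (\1_(I n i) s)%:E)%E.
    apply: integrableZl => //.
    apply: (integrableS measurableT) => //.
    exact: (integrable_indic_itv _ _ false false).
  under eq_integral do rewrite /step -sumEFin.
  under eq_integral do under eq_bigr do rewrite EFinM.
  rewrite integral_sum//.
  rewrite /dyadic_sum mulr_sumr -sumEFin; apply: eq_bigr => i _.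
  rewrite integralZl//; last first.
    apply: (integrableS measurableT) => //.
    exact: (integrable_indic_itv _ _ false false).
  rewrite integral_indic//; last exact: mI.
  have -> : I n i `&` D = I n i.
    apply/setIidl => s; rewrite /I /D /= !in_itv/= => /andP[is_ si].
    rewrite (le_lt_trans (mesh_point_ge0 n i))//= (le_trans si)//.
    by apply: mesh_point_le.
  transitivity ((v (i.+1%:R * mesh n))%:E * mu (I n i))%E; first by [].
  rewrite /I lebesgue_measure_itv/= lte_fin ltr_pM2r ?mesh_gt0// ltr_nat ltnSn.
  by rewrite -EFinB -EFinM -natr1; congr (_%:E); ring.
have e : \int[mu]_(s in D) v s = \int[mu]_(s in `[0, delta]) v s.
  exact: Rintegral_itv_obnd_cbnd.
suff : dyadic_sum n v @[n --> \oo] --> \int[mu]_(s in D) v s. by rewrite e.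
have ivfin : (\int[mu]_(s in D) (EFin \o v) s)%E \is a fin_num.
  exact: integrable_fin_num.
move: cv; rewrite -(fineK ivfin); under eq_fun do rewrite intstep.
by move=> /fine_cvgP[].
Unshelve. all: by end_near.
Qed.

End DyadicSums.

(** * Paths, measurability and time integrals of the process *)

Section CadlagPaths.
Context {R : realType} {d : nat}.
Local Notation E := 'rV[R]_d.

(** Near each time the path is bounded, by its value and its two one-sided
    limits; compactness of the horizon makes the bound uniform. *)
Lemma cadlag_bounded (u : R -> E) (delta : R) : cadlag u ->
  exists M, forall s, 0 <= s <= delta -> `|u s| <= M.
Proof.
move=> [ur ul].
have /compact_near_coveringP := @segment_compact R 0 delta.
move=> /(_ R (+oo%R : set_system R) (fun M s => 0 <= s <= delta -> `|u s| <= M)).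
move=> h; suff : \forall M \near +oo%R, forall s, 0 <= s <= delta -> `|u s| <= M.
  by move=> /filter_ex[M hM]; exists M.
have {}h := h _ _; apply: filterS (h _ _).
  by move=> M hM s s0d; apply: hM => //; rewrite /= in_itv.
move=> s /=; rewrite in_itv/= => /andP[s0 sd].
have [r r0 hr] : exists2 r, 0 < r & forall t, s < t -> t < s + r -> `|u t| <= `|u s| + 1.
  apply: near_right_ex; apply: (cvgr_norm_le _ (ur _ s0)).
  by rewrite ltrDl.
have [l l0 [B hl]] : exists2 l, 0 < l & exists B, forall t, 0 <= t -> t < s -> s - l < t -> `|u t| <= B.
  move: s0; rewrite le_eqVlt => /predU1P[<-|s0].
    by exists 1 => //; exists 0 => t t0 t0'; lra.
  have hy := ul _ s0; set y := lim _ in hy.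
  have [l l0 h'] : exists2 l, 0 < l & forall t, t < s -> s - l < t -> `|u t| <= `|y| + 1.
    by apply: near_left_ex; apply: (cvgr_norm_le _ hy); rewrite ltrDl.
  by exists l => //; exists (`|y| + 1) => t _; exact: h'.
pose N := Num.max (`|u s| + 1) B.
exists (ball s (Num.min r l), [set M | N <= M]).
  split => /=; first by apply: nbhsx_ballx; rewrite lt_min r0 l0.
  by apply: nbhs_pinfty_ge; rewrite num_real.
move=> [t M] /= [+ NM] /andP[t0 td].
rewrite /ball/= ltr_distlC => /andP[a b].
move: NM; rewrite /N ge_max => /andP[N1 N2].
have {a b} [a1 a2 b1 b2] : [/\ s - r < t, s - l < t, t < s + r & t < s + l].
  have h1 : Num.min r l <= r by rewrite ge_min lexx.
  have h2 : Num.min r l <= l by rewrite ge_min lexx orbT.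
  split; lra.
have [ts|st|->] := ltgtP t s.
- by apply: le_trans N2; exact: hl.
- by apply: le_trans N1; exact: hr.
- by apply: le_trans N1; rewrite lerDl.
Qed.

Lemma closed_ball_compact (M : R) : compact [set x : E | `|x| <= M].
Proof.
apply: bounded_closed_compact.
  exists M; rewrite num_real; split=> // y My x /= xM.
  by rewrite (le_trans xM)// ltW.
by apply: (preimage_closed _ (@closed_le _ M)) => x _; exact: norm_continuous.
Qed.

(** A continuous function of the path is bounded on the horizon because the
    path stays in a closed ball, which is compact.  Hence the
    time integrals are finite path by path. *)
Lemma cadlag_comp_bounded (u : R -> E) (delta : R) (g : E -> R) :
  cadlag u -> continuous g ->
  exists M, forall s, 0 <= s <= delta -> `|g (u s)| <= M.
Proof.
move=> /(@cadlag_bounded _ delta)[M uM] cg.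
pose K := [set x : E | `|x| <= Num.max M 0].
have cK : compact K by exact: closed_ball_compact.
have K0 : K !=set0 by exists 0; rewrite /K/= normr0 le_max lexx orbT.
have cgK : {within K, continuous (fun x => `|g x|)}.
  apply: continuous_subspaceT => x; apply: continuous_comp; first exact: cg.
  exact: norm_continuous.
have [z _ hz] := compact_EVT_max K0 cK cgK.
exists `|g z| => s s0; apply: hz; rewrite inE /K/= le_max uM//.
Qed.
End CadlagPaths.

Section Borel.
Context {R : realType} {d : nat}.
Local Notation E := 'rV[R]_d.

Lemma open_borel (A : set E) : open A -> measurable (A : set (borel_space R d)).
Proof. by move=> oA; exact: sub_sigma_algebra. Qed.

Lemma closed_borel (A : set E) : closed A -> measurable (A : set (borel_space R d)).
Proof.
by move=> cA; rewrite -[A]setCK; apply: measurableC; apply: open_borel; rewrite openC.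
Qed.

Lemma continuous_borel (g : E -> R) : continuous g ->
  measurable_fun setT (g : borel_space R d -> R).
Proof.
move=> cg; apply: (measurability _ (RGenOInfty.measurableE R)).
move=> B [_ [r ->] <-]; rewrite setTI; apply: open_borel.
by move/continuousP: cg; apply; exact: rray_open.
Qed.
End Borel.

Lemma continuous_affine (R : realType) (T : topologicalType) (a b : R) (g : T -> R) :
  continuous g -> continuous (fun x => a + b * g x).
Proof.
move=> cg x; apply: (@continuousD _ R^o _ (fun=> a) (fun x => b * g x)).
  exact: cst_continuous.
by apply: (@continuousM _ _ (fun=> b) g); [exact: cst_continuous|exact: cg].
Qed.

Section ProcessPaths.
Context {R : realType} {d : nat} {disp : measure_display}
  {Omega : measurableType disp}.
Local Notation E := 'rV[R]_d.
Variables (P : E -> probability Omega R) (F : R -> set (set Omega))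
  (X : R -> Omega -> E) (delta : R).
Hypotheses (filtF : filtration F) (markovX : feller_markov P F X)
  (delta_gt0 : 0 < delta).
Implicit Types (g h : E -> R).
Local Notation TI := (time_integral X delta).

Lemma past_adapted s t (B : set (borel_space R d)) : 0 <= s -> s <= t ->
  measurable B -> F t (X s @^-1` B).
Proof.
move=> s0 st mB; apply: (filtration_mono filtF s0 st).
exact: (markov_adapted markovX).
Qed.

Lemma process_measurable t : 0 <= t ->
  measurable_fun setT (X t : Omega -> borel_space R d).
Proof.
move=> t0 _ B mB; rewrite setTI; apply: (filtration_sub filtF t0).
exact: past_adapted.
Qed.

Lemma process_comp_measurable t g : 0 <= t -> continuous g ->
  measurable_fun setT (fun w => g (X t w)).
Proof.
move=> t0 cg; have := process_measurable t0.
exact: (measurableT_comp (continuous_borel cg)).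
Qed.

Lemma dyadic_path_cvg g w : continuous g ->
  dyadic_sum delta n (fun s => g (X s w)) @[n --> \oo] --> TI g w.
Proof.
move=> cg; have cw := markov_cadlag markovX w.
have [M gM] := @cadlag_comp_bounded _ _ _ delta _ cw cg.
apply: (@dyadic_sum_cvg _ _ delta_gt0 (fun s => g (X s w)) M) => // t t0.
by apply: continuous_cvg; [exact: cg|exact: cw.1].
Qed.

Lemma dyadic_sum_measurable n g : continuous g ->
  measurable_fun setT (fun w => dyadic_sum delta n (fun s => g (X s w))).
Proof.
move=> cg; apply: measurable_funM => //; apply: measurable_sum => i.
apply: process_comp_measurable => //.
by apply: mesh_point_ge0.
Qed.

Lemma time_integral_measurable g : continuous g -> measurable_fun setT (TI g).
Proof.
move=> cg; apply: (@measurable_fun_cvg _ _ _ setT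
  (fun n w => dyadic_sum delta n (fun s => g (X s w)))).
  by move=> n; exact: dyadic_sum_measurable.
by move=> w _; exact: dyadic_path_cvg.
Qed.

Lemma dyadic_sum_le n (u v : R -> R) :
  (forall s, 0 <= s <= delta -> u s <= v s) -> dyadic_sum delta n u <= dyadic_sum delta n v.
Proof.
move=> uv; rewrite ler_pM2l ?mesh_gt0//; apply: ler_sum => i _; apply: uv.
by rewrite mesh_point_ge0// mesh_point_le.
Qed.

Lemma time_integral_le g h w : continuous g -> continuous h ->
  (forall s, 0 <= s <= delta -> g (X s w) <= h (X s w)) -> TI g w <= TI h w.
Proof.
move=> cg ch gh; have hg := @dyadic_path_cvg g w cg; have hh := @dyadic_path_cvg h w ch.
by apply: (ler_cvg_to hg hh); apply: nearW => n; exact: dyadic_sum_le.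
Qed.

Lemma dyadic_sum_affine n a b (u : R -> R) :
  dyadic_sum delta n (fun s => a + b * u s) = a * delta + b * dyadic_sum delta n u.
Proof.
rewrite /dyadic_sum big_split/= -mulr_sumr mulrDr; congr (_ + _); last first.
  by rewrite mulrCA.
by rewrite sumr_const card_ord -[a *+ _]mulr_natr mulrCA [_ * (2 ^ n)%:R]mulrC mesh_total.
Qed.

Lemma time_integral_affine a b g w : continuous g ->
  TI (fun x => a + b * g x) w = a * delta + b * TI g w.
Proof.
move=> cg.
have c1 : continuous (fun x => a + b * g x).
  exact: continuous_affine.
have h1 := @dyadic_path_cvg _ w c1.
have h2 : dyadic_sum delta n (fun s => a + b * g (X s w)) @[n --> \oo] -->
    a * delta + b * TI g w.
  under eq_fun do rewrite dyadic_sum_affine.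
  apply: cvgD; first exact: cvg_cst.
  by apply: cvgMl_tmp; exact: dyadic_path_cvg.
by rewrite -(cvg_lim _ h1)// -(cvg_lim _ h2).
Qed.

Lemma time_integral_ge0 g w : continuous g -> (forall x, 0 <= g x) -> 0 <= TI g w.
Proof. by move=> cg g0; apply: Rintegral_ge0 => s _; exact: g0. Qed.

Lemma time_integral_norm_le g h a b w : continuous g -> continuous h ->
  (forall x, `|g x| <= a + b * h x) -> `|TI g w| <= a * delta + b * TI h w.
Proof.
move=> cg ch gh.
have cab : continuous (fun x => a + b * h x).
  exact: continuous_affine.
have cN : continuous (fun x => 0 + -1 * (a + b * h x)).
  exact: continuous_affine.
have le1 : TI g w <= TI (fun x => a + b * h x) w.
  by apply: time_integral_le => // s _; move: (gh (X s w)); rewrite ler_norml => /andP[].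
have le2 : TI (fun x => 0 + -1 * (a + b * h x)) w <= TI g w.
  apply: time_integral_le => // s _; move: (gh (X s w)).
  by rewrite ler_norml => /andP[+ _]; rewrite add0r mulN1r.
rewrite time_integral_affine// in le1.
rewrite time_integral_affine// time_integral_affine// mul0r add0r mulN1r in le2.
by rewrite ler_norml le1 le2.
Qed.

End ProcessPaths.

(** * Observables with a limit at infinity *)

Section AtInfinity.
Context {R : realType} {d : nat}.
Local Notation E := 'rV[R]_d.
Implicit Types (g h : E -> R) (a b : R).

Definition at_infinity : set_system E :=
  [set A | exists2 K : set E, compact K & ~` K `<=` A].

Global Instance at_infinity_filter : Filter at_infinity.
Proof.
constructor => [|A B [K cK KA] [L cL LB]|A B AB [K cK KA]].
- by exists set0; [exact: compact0|].
- exists (K `|` L); first exact: compactU.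
  by move=> x /not_orP[/KA ? /LB].
- by exists K => // x /KA /AB.
Qed.

(** Constants are included because conservativity then makes the class stable
    under products, exponentials and the semigroup. *)
Definition regular g a := continuous g /\ g x @[x --> at_infinity] --> a.

Lemma regular_vanishing g a :
  regular g a <-> vanishing_continuous (fun x => g x - a).
Proof.
split=> [[cg /cvgrPdist_lt ga]|[cg vg]]; split.
- move=> x; rewrite (_ : (fun x => _) = (fun x => - a + 1 * g x)); last first.
    by apply/funext => y; rewrite mul1r addrC.
  exact: continuous_affine.
- by move=> e /ga [K cK Kg]; exists K => // x /Kg; rewrite distrC.
- move=> x; rewrite (_ : g = (fun x => a + 1 * (g x - a))); last first.
    by apply/funext => y; rewrite mul1r addrC subrK.
  exact: continuous_affine.
- apply/cvgrPdist_lt => e /vg [K cK Kg]; exists K => // x /Kg.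
  by rewrite distrC.
Qed.

Lemma regular_comp (phi : R -> R) g a : continuous phi -> regular g a ->
  regular (fun x => phi (g x)) (phi a).
Proof.
move=> cphi [cg ga]; split; last by apply: continuous_cvg => //; exact: cphi.
by move=> x; apply: continuous_comp; [exact: cg|exact: cphi].
Qed.

Lemma regularM g h a b : regular g a -> regular h b ->
  regular (fun x => g x * h x) (a * b).
Proof.
move=> [cg ga] [ch hb]; split; last exact: cvgM.
by move=> x; apply: (@continuousM _ _ g h); [exact: cg|exact: ch].
Qed.

Lemma regular_affine g a b c : regular g a -> regular (fun x => b + c * g x) (b + c * a).
Proof.
move=> rg; apply: (@regular_comp (fun y => b + c * y)) => //.
by apply: (@continuous_affine _ _ b c (fun y : R => y)) => x; exact: cvg_id.
Qed.

Lemma regular_bounded g a : regular g a -> exists2 M, 0 < M & forall x, `|g x| <= M.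
Proof.
move=> [cg /cvgrPdist_lt /(_ _ ltr01)[K cK Kg]].
have [M KM] : exists M, forall x, K x -> `|g x| <= M.
  have [->|/set0P K0] := eqVneq K set0; first by exists 0 => x [].
  have cgK : {within K, continuous (fun x => `|g x|)}.
    apply: continuous_subspaceT => x; apply: continuous_comp; first exact: cg.
    exact: norm_continuous.
  have [z _ hz] := compact_EVT_max K0 cK cgK.
  by exists `|g z| => x Kx; apply: hz; rewrite inE.
exists (Num.max M (`|a| + 1)).
  by rewrite lt_max; apply/orP; right; rewrite ltr_wpDl.
move=> x; rewrite le_max; have [Kx|Kx] := pselect (K x); first by rewrite KM.
apply/orP; right; have := Kg _ Kx => /= /ltW h.
rewrite (_ : g x = a - (a - g x)); last by rewrite opprB addrC subrK.
by apply: (le_trans (ler_normB _ _)); rewrite lerD2l.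
Qed.

End AtInfinity.

(** * Quantisation of bounded functions by level sets *)

Section Quantise.
Context {R : realType} {T : Type}.
Implicit Types (H : T -> R).

Definition level N (k : nat) H : set T := [set w | k%:R / N.+1%:R < H w].

Definition quantise N H (w : T) : R :=
  N.+1%:R^-1 * \sum_(k < N.+1) \1_(level N k H) w.

(** For [0 <= y <= N] the sum counts up to the ceiling of [y]. *)
Lemma count_below (y : R) N : 0 <= y -> y <= N%:R ->
  `|y - \sum_(k < N) (k%:R < y)%R%:R| <= 1.
Proof.
move=> y0; elim: N => [|N ih] yN.
  by rewrite big_ord0 subr0 ger0_norm// (le_trans yN).
rewrite big_ord_recr/=; have [yN'|Ny] := leP y N%:R; first by rewrite addr0 ih.
rewrite (eq_bigr (fun=> 1)) => [|i _].
  rewrite sumr_const card_ord/= natr1 ler_norml; apply/andP; split; last lra.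
  by move: Ny; rewrite -natr1; lra.
by rewrite (lt_trans _ Ny)// ltr_nat.
Qed.

Lemma quantise_close N H w : 0 <= H w <= 1 -> `|H w - quantise N H w| <= N.+1%:R^-1.
Proof.
move=> /andP[H0 H1]; have N0 : 0 < N.+1%:R :> R by rewrite ltr0n.
have := @count_below (N.+1%:R * H w) N.+1.
rewrite mulr_ge0 ?ler0n// -[X in _ <= X -> _]mulr1 ler_pM2l// => /(_ isT H1) h.
have -> : H w - quantise N H w =
    N.+1%:R^-1 * (N.+1%:R * H w - \sum_(k < N.+1) (k%:R < N.+1%:R * H w)%R%:R).
  rewrite mulrBr mulKf ?gt_eqF//; congr (_ - _ * _); apply: eq_bigr => k _.
  have -> : (k%:R < N.+1%:R * H w) = (w \in level N k H).
    by apply/idP/idP; rewrite inE /level/= ltr_pdivrMr// [H w * _]mulrC.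
  by rewrite indicE.
by rewrite normrM gtr0_norm ?invr_gt0// -[leRHS]mulr1 ler_pM2l// invr_gt0.
Qed.

Lemma eq_of_dist_inv (a b c : R) : (forall N, `|a - b| <= c / N.+1%:R) -> a = b.
Proof.
move=> h; apply/eqP; rewrite -subr_eq0 -normr_le0; apply/ler_addgt0Pr => e e0.
rewrite add0r; have [c0|c0] := leP c 0.
  by rewrite (le_trans (h 0%N))// invr1 mulr1 (le_trans c0) ?ltW.
have [n hn] : exists n, c / e < n.+1%:R.
  exists (Num.truncn (c / e)); exact: truncnS_gt.
rewrite (le_trans (h n))// ler_pdivrMr// mulrC -ler_pdivrMr// ltW//.
Qed.

End Quantise.

(** * The Markov property for functions *)

Section QuantisedMean.
Context {R : realType} {disp : measure_display} {T : measurableType disp}.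
Variable Q : probability T R.
Implicit Types (J H : T -> R).

Lemma mean_close (Y Z : T -> R) c : itg Q Y -> itg Q Z ->
  (forall w, `|Y w - Z w| <= c) -> `|mean Q Y - mean Q Z| <= c.
Proof.
move=> iY iZ h; rewrite -meanB//; apply: mean_norm_le => //.
by apply: measurable_funB; [exact: itg_measurable iY|exact: itg_measurable iZ].
Qed.

Lemma level_measurable N k H : measurable_fun setT H -> measurable (level N k H).
Proof.
move=> mH; rewrite /level -[X in measurable X]setTI.
rewrite (_ : [set w | _] = H @^-1` `]k%:R / N.+1%:R, +oo[%classic); last first.
  by apply/seteqP; split => w /=; rewrite in_itv/= andbT.
exact: mH.
Qed.

Lemma quantise_mean N J H B : measurable_fun setT J -> (forall w, `|J w| <= B) ->
  measurable_fun setT H -> (forall w, 0 <= H w <= 1) ->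
  `|mean Q (fun w => J w * H w) -
    N.+1%:R^-1 * \sum_(k < N.+1) mean Q (fun w => J w * \1_(level N k H) w)|
    <= B / N.+1%:R.
Proof.
move=> mJ JB mH H01.
have iJ : itg Q J by exact: itg_bounded JB.
have iL k : itg Q (\1_(level N k H) : T -> R).
  by apply: itg_indic; exact: level_measurable.
have iJL k : itg Q (fun w => J w * \1_(level N k H) w) by exact: itgM_bounded JB (iL k).
have iH : itg Q H.
  apply: (@itg_bounded _ _ _ _ _ 1) => // w.
  by have /andP[h0 h1] := H01 w; rewrite ger0_norm.
have [iS mS] := mean_sum N.+1 iJL.
rewrite -mS -meanZ//; apply: mean_close.
- exact: itgM_bounded JB iH.
- exact: itgZ.
- move=> w; rewrite -mulr_sumr mulrCA -mulrBr normrM; apply: ler_pM => //.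
  exact: quantise_close.
Qed.

End QuantisedMean.

Section MarkovFunctions.
Context {R : realType} {d : nat} {disp : measure_display}
  {Omega : measurableType disp}.
Local Notation E := 'rV[R]_d.
Variables (P : E -> probability Omega R) (F : R -> set (set Omega))
  (X : R -> Omega -> E).
Hypotheses (filtF : filtration F) (markovX : feller_markov P F X).
Implicit Types (g : E -> R).
Local Notation semi := (transition_semigroup P X).
Local Notation meas_X := (process_measurable filtF markovX).
Local Notation meas_gX := (process_comp_measurable filtF markovX).

Lemma semigroupE t g x : semi t g x = mean (P x) (fun w => g (X t w)).
Proof. by []. Qed.

Lemma regular_itg t g a x : 0 <= t -> regular g a -> itg (P x) (fun w => g (X t w)).
Proof.
move=> t0 rg; have [M _ gM] := regular_bounded rg.
by apply: (@itg_bounded _ _ _ _ _ M) => //; apply: meas_gX => //; case: rg.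
Qed.

Lemma semigroup_affine t g a b c x : 0 <= t -> regular g a ->
  semi t (fun x => b + c * g x) x = b + c * semi t g x.
Proof.
move=> t0 rg; have ig := regular_itg x t0 rg.
by rewrite !semigroupE meanD ?mean_cst ?meanZ//; [exact: itg_cst|exact: itgZ].
Qed.

(** Probabilities preserve constants, so only the part vanishing at infinity is
    subject to the Feller property. *)
Lemma semigroup_regular t g a : 0 <= t -> regular g a -> regular (semi t g) a.
Proof.
move=> t0 rg; apply/regular_vanishing.
have -> : (fun x => semi t g x - a) = semi t (fun x => g x - a).
  apply/funext => x; rewrite [RHS](_ : _ = - a + 1 * semi t g x); last first.
    rewrite -(semigroup_affine _ _ _ t0 rg); congr (semi t _ x).
    by apply/funext => y; rewrite mul1r addrC.
  by rewrite mul1r addrC.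
by apply: (feller_stable (markov_feller markovX)) => //; exact/regular_vanishing.
Qed.

Lemma semigroup0 g a x : regular g a -> semi 0 g x = g x.
Proof.
move=> rg; rewrite semigroupE -[RHS](mean_cst (P x)); congr fine.
have m0 : measurable [set w | X 0 w = x].
  rewrite -[X in measurable X]setTI.
  rewrite (_ : [set w | _] = X 0 @^-1` [set x])//.
  by apply: (meas_X (lexx 0)) => //; apply: closed_borel; apply: accessible_closed_set1;
  apply: hausdorff_accessible; exact: norm_hausdorff.
apply: ae_eq_integral => //.
- exact/measurable_EFinP/(itg_measurable (regular_itg x (lexx 0) rg)).
- exists (~` [set w | X 0 w = x]); split.
  + exact: measurableC.
  + by have := probability_setC (P x) m0; rewrite (markov_start markovX) subee.
  + by move=> w /= nh hx; apply: nh => _; rewrite hx.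
Qed.

Lemma semigroup_strong g a : regular g a -> forall e, 0 < e ->
  exists2 r, 0 < r & forall u, 0 <= u -> u < r -> forall x, `|semi u g x - g x| <= e.
Proof.
move=> rg e e0; have /regular_vanishing vg := rg.
have := feller_strong (markov_feller markovX) vg e0.
move=> /near_right_ex[r r0 hr]; exists r => // u u0 ur x.
move: u0; rewrite le_eqVlt => /predU1P[<-|u0].
  by rewrite (semigroup0 _ rg) subrr normr0 ltW.
have := hr u; rewrite add0r => /(_ u0 ur x).
rewrite (_ : semi u (fun x => g x - a) x = - a + 1 * semi u g x); last first.
  rewrite -(semigroup_affine _ _ _ (ltW u0) rg); congr (semi u _ x).
  by apply/funext => y; rewrite mul1r addrC.
by congr (`|_| <= _); lra.
Qed.

Definition hit_prob s (B : set E) (y : E) : R := fine (P y (X s @^-1` B)).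

Lemma hit_prob_measurable s (B : set (borel_space R d)) : 0 <= s -> measurable B ->
  measurable_fun setT (hit_prob s B : borel_space R d -> R).
Proof.
by move=> s0 mB; apply: measurableT_comp => //; exact: (markov_kernel markovX).
Qed.

Lemma preimage_measurable s (B : set (borel_space R d)) : 0 <= s -> measurable B ->
  measurable (X s @^-1` B).
Proof. by move=> s0 mB; rewrite -[X in measurable X]setTI; exact: meas_X. Qed.

Lemma hit_probE s (B : set (borel_space R d)) y : 0 <= s -> measurable B ->
  hit_prob s B y = mean (P y) (\1_(X s @^-1` B) : Omega -> R).
Proof. by move=> s0 mB; rewrite mean_indic//; exact: preimage_measurable. Qed.

Lemma hit_prob_bounds s (B : set (borel_space R d)) y : 0 <= s -> measurable B ->
  0 <= hit_prob s B y <= 1.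
Proof.
move=> s0 mB; rewrite /hit_prob fine_ge0//=.
rewrite -lee_fin fineK ?fin_num_measure//; first exact: probability_le1 (preimage_measurable _ _).
exact: preimage_measurable.
Qed.

Lemma past_measurable_set t A : 0 <= t -> F t A -> measurable A.
Proof. by move=> t0; exact: (filtration_sub filtF). Qed.

Lemma markov_indic x t s A (B : set (borel_space R d)) :
  0 <= t -> 0 <= s -> F t A -> measurable B ->
  mean (P x) (fun w => \1_A w * \1_(X (t + s) @^-1` B) w) =
  mean (P x) (fun w => \1_A w * hit_prob s B (X t w)).
Proof.
move=> t0 s0 FA mB; have mA := past_measurable_set t0 FA.
have ts0 : 0 <= t + s by rewrite addr_ge0.
transitivity (fine (P x (A `&` X (t + s) @^-1` B))).
  rewrite -mean_indic; last by apply: measurableI => //; exact: preimage_measurable.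
  by congr fine; apply: eq_integral => w _; rewrite indicI.
rewrite (markov_property markovX)// integral_mkcond; congr fine.
apply: eq_integral => w _; rewrite patchE indicE; case: ifP => wA.
  rewrite mul1r /hit_prob fineK// fin_num_measure//; exact: preimage_measurable.
by rewrite mul0r.
Qed.

End MarkovFunctions.

Section MarkovPast.
Context {R : realType} {d : nat} {disp : measure_display}
  {Omega : measurableType disp}.
Local Notation E := 'rV[R]_d.
Variables (P : E -> probability Omega R) (F : R -> set (set Omega))
  (X : R -> Omega -> E).
Hypotheses (filtF : filtration F) (markovX : feller_markov P F X).
Implicit Types (g : E -> R).
Local Notation semi := (transition_semigroup P X).
Local Notation meas_X := (process_measurable filtF markovX).
Local Notation meas_gX := (process_comp_measurable filtF markovX).

Lemma indic_norm_le1 (T : Type) (A : set T) (w : T) : `|\1_A w : R| <= 1.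
Proof. by rewrite indicE; case: (_ \in _); rewrite ?normr1 ?normr0. Qed.

(** Both sides are within [1 / N.+1] of the same average of the Markov identity
    over the level sets of [g]. *)
Lemma markov_unit x t s A g a : 0 <= t -> 0 <= s -> F t A -> regular g a ->
  (forall y, 0 <= g y <= 1) ->
  mean (P x) (fun w => \1_A w * g (X (t + s) w)) =
  mean (P x) (fun w => \1_A w * semi s g (X t w)).
Proof.
move=> t0 s0 FA rg g01; have mA := past_measurable_set filtF t0 FA.
have ts0 : 0 <= t + s by rewrite addr_ge0.
have cg : continuous g by case: rg.
have mgX u : 0 <= u -> measurable_fun setT (fun w => g (X u w)).
  by move=> u0; exact: meas_gX.
pose B N k : set (borel_space R d) := level N k g.
have mB N k : measurable (B N k) by apply: level_measurable; exact: continuous_borel.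
have m1 : measurable_fun setT (\1_A : Omega -> R) by exact: measurable_indic.
apply: (@eq_of_dist_inv _ _ _ 2) => N.
pose S := N.+1%:R^-1 * \sum_(k < N.+1)
  mean (P x) (fun w => \1_A w * hit_prob P X s (B N k) (X t w)).
have h1 : `|mean (P x) (fun w => \1_A w * g (X (t + s) w)) - S| <= 1 / N.+1%:R.
  rewrite /S; under eq_bigr do rewrite -(markov_indic filtF markovX)//.
  apply: (@quantise_mean _ _ _ (P x) N (\1_A) (fun w => g (X (t + s) w))) => //.
  - by move=> w; exact: indic_norm_le1.
  - exact: mgX.
have ihit k : itg (P x) (fun w => hit_prob P X s (B N k) (X t w)).
  apply: (@itg_bounded _ _ _ _ _ 1).
    exact: (measurableT_comp (hit_prob_measurable markovX s0 (mB N k)) (meas_X t0)).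
  move=> w; have /andP[p0 p1] := hit_prob_bounds filtF markovX (X t w) s0 (mB N k).
  by rewrite ger0_norm.
have iAhit k : itg (P x) (fun w => \1_A w * hit_prob P X s (B N k) (X t w)).
  by apply: (@itgM_bounded _ _ _ _ _ _ 1) => //; move=> w; exact: indic_norm_le1.
have h2 : `|mean (P x) (fun w => \1_A w * semi s g (X t w)) - S| <= 1 / N.+1%:R.
  have [iS mS] := mean_sum N.+1 iAhit.
  rewrite /S -mS -meanZ//; apply: mean_close.
  - apply: (@itgM_bounded _ _ _ _ _ _ 1) => //; first by move=> w; exact: indic_norm_le1.
    exact: (regular_itg filtF markovX _ t0 (semigroup_regular filtF markovX s0 rg)).
  - exact: itgZ.
  move=> w; rewrite -mulr_sumr mulrCA -mulrBr normrM -[1 / _]mul1r.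
  apply: ler_pM => //; first exact: indic_norm_le1.
  have := @quantise_mean _ _ _ (P (X t w)) N (fun=> 1) (fun v => g (X s v)) 1.
  have one_mul (Z : Omega -> R) : (fun v => 1 * Z v) = Z.
    by apply/funext => v; rewrite mul1r.
  rewrite one_mul (eq_bigr (fun k : 'I_N.+1 => hit_prob P X s (B N k) (X t w))); last first.
    by move=> k _; rewrite (hit_probE filtF markovX)// one_mul.
  by apply => //; [move=> v; rewrite normr1|exact: mgX].
apply: (le_trans (ler_distD S _ _)); rewrite [`|S - _|]distrC.
by rewrite (_ : 2 = 1 + 1)// mulrDl; exact: lerD.
Qed.

(** Rescale to values in the unit interval. *)
Lemma markov_event x t s A g a : 0 <= t -> 0 <= s -> F t A -> regular g a ->
  mean (P x) (fun w => \1_A w * g (X (t + s) w)) =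
  mean (P x) (fun w => \1_A w * semi s g (X t w)).
Proof.
move=> t0 s0 FA rg; have [M M0 gM] := regular_bounded rg.
have mA := past_measurable_set filtF t0 FA.
have ts0 : 0 <= t + s by rewrite addr_ge0.
pose g' y := 2^-1 + (2 * M)^-1 * g y.
have rg' : regular g' (2^-1 + (2 * M)^-1 * a) by exact: regular_affine.
have g'01 y : 0 <= g' y <= 1.
  have := gM y; rewrite ler_norml /g' => /andP[h1 h2].
  have e : (2 * M)^-1 * M = 2^-1 by field; rewrite gt_eqF.
  have i0 : 0 <= (2 * M)^-1 by rewrite invr_ge0 mulr_ge0// ltW.
  have := ler_wpM2l i0 h1; have := ler_wpM2l i0 h2; rewrite mulrN e.
  by move=> *; apply/andP; split; lra.
have gE y : g y = - M + 2 * M * g' y by rewrite /g'; field; rewrite gt_eqF.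
have iA : itg (P x) (\1_A : Omega -> R) by exact: itg_indic.
have m1 : measurable_fun setT (\1_A : Omega -> R) by exact: measurable_indic.
have bA w := @indic_norm_le1 _ A w.
have key (h : E -> R) u b : 0 <= u -> regular h b ->
    mean (P x) (fun w => \1_A w * (- M + 2 * M * h (X u w))) =
    - M * mean (P x) (\1_A : Omega -> R) + 2 * M * mean (P x) (fun w => \1_A w * h (X u w)).
  move=> u0 rh; have iAh : itg (P x) (fun w => \1_A w * h (X u w)).
    by apply: (itgM_bounded m1 bA); exact: (regular_itg filtF markovX _ u0 rh).
  rewrite -meanZ// -meanZ// -meanD; [|exact: itgZ|exact: itgZ].
  by congr fine; apply: eq_integral => w _; congr (_%:E); ring.
have -> : (fun w => \1_A w * g (X (t + s) w)) =
    (fun w => \1_A w * (- M + 2 * M * g' (X (t + s) w))).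
  by apply/funext => w; rewrite -gE.
have -> : (fun w => \1_A w * semi s g (X t w)) =
    (fun w => \1_A w * (- M + 2 * M * semi s g' (X t w))).
  apply/funext => w; congr (_ * _).
  rewrite -(semigroup_affine filtF markovX _ _ _ s0 rg'); congr (semi s _ _).
  by apply/funext => y; rewrite -gE.
rewrite (key _ _ _ ts0 rg') (key _ _ _ t0 (semigroup_regular filtF markovX s0 rg')).
by rewrite (markov_unit x t0 s0 FA rg').
Qed.

(** Measurability with respect to the past, through the type that carries the
    sigma-algebra generated by [F t]. *)
Definition past_measurable t (H : Omega -> R) : Prop :=
  measurable_fun setT (H : g_sigma_algebraType (F t) -> R).

Lemma past_measurable_event t (H : Omega -> R) (r : R) : 0 <= t ->
  past_measurable t H -> F t [set w | r < H w].
Proof.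
move=> t0 mH; have sF := filtration_sigma filtF t0.
have <- : <<s F t >> = F t by apply: sigma_algebra_id.
have := mH measurableT `]r, +oo[%classic (measurable_itv _).
rewrite setTI (_ : H @^-1` _ = [set w | r < H w])//.
by apply/seteqP; split => w /=; rewrite in_itv/= andbT.
Qed.

Lemma past_measurable_measurable t H : 0 <= t -> past_measurable t H -> measurable_fun setT H.
Proof.
move=> t0 mH _ B mB; have sF := filtration_sigma filtF t0.
have := mH measurableT B mB; rewrite !setTI => h.
apply: (filtration_sub filtF t0); have <- : <<s F t >> = F t by apply: sigma_algebra_id.
exact: h.
Qed.

Lemma past_measurable_process s t g : 0 <= s -> s <= t -> continuous g ->
  past_measurable t (fun w => g (X s w)).
Proof.
move=> s0 st cg _ B mB; rewrite setTI; apply: sub_sigma_algebra.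
rewrite (_ : _ @^-1` B = X s @^-1` (g @^-1` B))//.
apply: (past_adapted filtF markovX) => //.
by rewrite -[X in measurable X]setTI; exact: (continuous_borel cg).
Qed.

(** From events of the past to weights, by the level sets of the weight. *)
Lemma markov_past x t s (H : Omega -> R) (B : R) g a : 0 <= t -> 0 <= s ->
  past_measurable t H -> 0 < B -> (forall w, `|H w| <= B) -> regular g a ->
  mean (P x) (fun w => H w * g (X (t + s) w)) =
  mean (P x) (fun w => H w * semi s g (X t w)).
Proof.
move=> t0 s0 pH B0 HB rg.
have ts0 : 0 <= t + s by rewrite addr_ge0.
have mH := past_measurable_measurable t0 pH.
have rsg := semigroup_regular filtF markovX s0 rg.
have ig := regular_itg filtF markovX x ts0 rg.
have isg := regular_itg filtF markovX x t0 rsg.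
have event1 : mean (P x) (fun w => g (X (t + s) w)) = mean (P x) (fun w => semi s g (X t w)).
  have FT : F t setT.
    have [F0 FC _] := filtration_sigma filtF t0.
    by have := FC _ F0; rewrite setD0.
  have := markov_event x t0 s0 FT rg.
  by under eq_fun do rewrite indicT mul1r; under [X in _ = mean _ X -> _]eq_fun do rewrite indicT mul1r.
pose H' w := 2^-1 + (2 * B)^-1 * H w.
have pH' : past_measurable t H'.
  by apply: measurable_funD => //; apply: measurable_funM.
have mH' := past_measurable_measurable t0 pH'.
have H'01 w : 0 <= H' w <= 1.
  have := HB w; rewrite ler_norml /H' => /andP[h1 h2].
  have e : (2 * B)^-1 * B = 2^-1 by field; rewrite gt_eqF.
  have i0 : 0 <= (2 * B)^-1 by rewrite invr_ge0 mulr_ge0// ltW.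
  have := ler_wpM2l i0 h1; have := ler_wpM2l i0 h2; rewrite mulrN e.
  by move=> *; apply/andP; split; lra.
have bH' w : `|H' w| <= 1 by have /andP[? ?] := H'01 w; rewrite ger0_norm.
have unit : mean (P x) (fun w => g (X (t + s) w) * H' w) =
    mean (P x) (fun w => semi s g (X t w) * H' w).
  have [M M0 gM] := regular_bounded rg.
  have [M' M'0 gM'] := regular_bounded rsg.
  apply: (@eq_of_dist_inv _ _ _ (M + M')) => N.
  have h1 := @quantise_mean _ _ _ (P x) N (fun w => g (X (t + s) w)) H' M
    (itg_measurable ig) (fun w => gM _) mH' H'01.
  have h2 := @quantise_mean _ _ _ (P x) N (fun w => semi s g (X t w)) H' M'
    (itg_measurable isg) (fun w => gM' _) mH' H'01.
  move: h1; rewrite (eq_bigr (fun k : 'I_N.+1 =>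
      mean (P x) (fun w => semi s g (X t w) * \1_(level N k H') w))); last first.
    move=> k _; have FL : F t (level N k H') by exact: past_measurable_event.
    have := markov_event x t0 s0 FL rg.
    by under eq_fun do rewrite mulrC; under [X in _ = mean _ X -> _]eq_fun do rewrite mulrC.
  move: h2; set S := _ * \sum_(_ < _) _; move=> h2 h1.
  apply: (le_trans (ler_distD S _ _)); rewrite [`|S - _|]distrC.
  by rewrite mulrDl; exact: lerD.
have key (h : E -> R) u b : 0 <= u -> regular h b ->
    mean (P x) (fun w => H w * h (X u w)) =
    - B * mean (P x) (fun w => h (X u w)) + 2 * B * mean (P x) (fun w => h (X u w) * H' w).
  move=> u0 rh; have ih := regular_itg filtF markovX x u0 rh.
  have ihH : itg (P x) (fun w => h (X u w) * H' w).
    by under eq_fun do rewrite mulrC; exact: (itgM_bounded mH' bH').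
  rewrite -meanZ// -meanZ// -meanD; [|exact: itgZ|exact: itgZ].
  congr fine; apply: eq_integral => w _; congr (_%:E).
  by rewrite /H'; field; rewrite gt_eqF.
by rewrite (key _ _ _ ts0 rg) (key _ _ _ t0 rsg) unit event1.
Qed.

End MarkovPast.

(** * Dyadic sums approximate time integrals uniformly in the starting point *)

Section MeanLimit.
Context {R : realType} {disp : measure_display} {T : measurableType disp}.
Variable Q : probability T R.

Lemma mean_cvg_bounded (Y : nat -> T -> R) (Z : T -> R) B :
  (forall k, measurable_fun setT (Y k)) -> (forall k w, `|Y k w| <= B) ->
  (forall w, Y k w @[k --> \oo] --> Z w) ->
  mean Q (Y k) @[k --> \oo] --> mean Q Z.
Proof.
move=> mY bY YZ.
have h1 k : measurable_fun setT (EFin \o Y k) by exact/measurable_EFinP.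
have mZ : measurable_fun setT Z by apply: (@measurable_fun_cvg _ _ _ setT Y).
have h2 : measurable_fun setT (EFin \o Z) by exact/measurable_EFinP.
have h3 : {ae Q, forall w, setT w -> (EFin \o Y k) w @[k --> \oo] --> (EFin \o Z) w}.
  by apply: aeW => w _; apply: cvg_EFin; [exact: nearW|exact: YZ].
have h4 : {ae Q, forall w k, setT w -> (`|(EFin \o Y k) w| <= (EFin \o cst B) w)%E}.
  by apply: aeW => w k _ /=; rewrite lee_fin.
have iB : Q.-integrable setT (EFin \o cst B) by exact: itg_cst.
have [iZ _] := @dominated_convergence _ _ R Q setT measurableT _ _ _ h1 h2 h3 iB h4.
have Zfin : (\int[Q]_(w in setT) (EFin \o Z) w)%E \is a fin_num by exact: integrable_fin_num.
by rewrite -(fineK Zfin) => /fine_cvgP[].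
Qed.

End MeanLimit.

Section DyadicRefine.
Context {R : realType}.
Variable delta : R.

Lemma mesh_refine n k : mesh delta n = (2 ^ k)%:R * mesh delta (n + k).
Proof.
rewrite /mesh natrX exprD invfM mulrCA [(2 ^+ n)^-1 * _]mulrC.
by rewrite [2 ^+ k * _]mulrA divff ?mul1r// expf_neq0.
Qed.

Lemma sum_blocks (u : nat -> R) n K : (0 < K)%N ->
  \sum_(j < n * K) u (j %/ K)%N = K%:R * \sum_(i < n) u i.
Proof.
move=> K0; rewrite -(big_mkord xpredT (fun j => u (j %/ K)%N)) big_nat_mul.
rewrite -(big_mkord xpredT u) mulr_sumr; apply: eq_bigr => i _.
rewrite (eq_big_nat _ _ (F2 := fun=> u i)) => [|j /andP[ij ji]].
  by rewrite sumr_const_nat mulSn addnK mulr_natl.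
by congr u; apply/eqP; rewrite eqn_leq -ltnS ltn_divLR// ji leq_divRL.
Qed.

Lemma dyadic_refine n k v :
  dyadic_sum delta (n + k) v - dyadic_sum delta n v =
  mesh delta (n + k) * \sum_(j < 2 ^ (n + k))
    (v (j.+1%:R * mesh delta (n + k)) - v ((j %/ 2 ^ k).+1%:R * mesh delta n)).
Proof.
rewrite sumrB mulrBr; congr (_ - _).
rewrite /dyadic_sum [X in X * _](mesh_refine n k) expnD.
rewrite (sum_blocks (fun i => v (i.+1%:R * mesh delta n)) _ (expn_gt0 2 k)).
by rewrite [RHS]mulrCA mulrA.
Qed.

Lemma dyadic_block_time n k j : (j < 2 ^ (n + k))%N -> 0 < delta ->
  exists2 h, 0 <= h < mesh delta n &
    j.+1%:R * mesh delta (n + k) + h = (j %/ 2 ^ k).+1%:R * mesh delta n.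
Proof.
move=> jn d0; have m0 := mesh_gt0 d0 (n + k).
have K0 : (0 < 2 ^ k)%N by rewrite expn_gt0.
set i := (j %/ 2 ^ k)%N.
have ij : (i * 2 ^ k <= j)%N by exact: leq_divM.
have ji : (j < i.+1 * 2 ^ k)%N by exact: ltn_ceil.
exists ((i.+1 * 2 ^ k - j.+1)%N%:R * mesh delta (n + k)).
  rewrite mulr_ge0 ?ler0n ?(ltW m0)//= (mesh_refine n k) ltr_pM2r// ltr_nat.
  by rewrite mulSn ltn_subLR; lia.
rewrite (mesh_refine n k) natrB// mulrBl addrC subrK natrM mulrA//.
Qed.

End DyadicRefine.

Section UniformApproximation.
Context {R : realType} {d : nat} {disp : measure_display}
  {Omega : measurableType disp}.
Local Notation E := 'rV[R]_d.
Variables (P : E -> probability Omega R) (F : R -> set (set Omega))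
  (X : R -> Omega -> E) (delta : R).
Hypotheses (filtF : filtration F) (markovX : feller_markov P F X)
  (delta_gt0 : 0 < delta).
Local Notation semi := (transition_semigroup P X).
Local Notation meas_gX := (process_comp_measurable filtF markovX).

Lemma semigroup_law t s g a x : 0 <= t -> 0 <= s -> regular g a ->
  semi (t + s) g x = semi t (semi s g) x.
Proof.
move=> t0 s0 rg.
have := @markov_past _ _ _ _ _ _ _ filtF markovX x t s (fun=> 1) 1 g a t0 s0.
rewrite (_ : (fun w => 1 * g _) = fun w => g (X (t + s) w)); last first.
  by apply/funext => w; rewrite mul1r.
rewrite (_ : (fun w => 1 * semi s g _) = fun w => semi s g (X t w)); last first.
  by apply/funext => w; rewrite mul1r.
apply => //; last by move=> w; rewrite normr1.
exact: measurable_cst.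
Qed.

(** The second moment of an increment is an expectation of
    [T_h f^2 - 2 f T_h f + f^2], which strong continuity makes uniformly small. *)
Lemma increment_small f a e : regular f a -> 0 < e ->
  exists2 r, 0 < r & forall s h x, 0 <= s -> 0 <= h -> h < r ->
    mean (P x) (fun w => `|f (X s w) - f (X (s + h) w)|) <= e.
Proof.
move=> rf e0; have [M M0 fM] := regular_bounded rf.
have rf2 := regularM rf rf.
(* Tolerances for which the second moment below is at most [e ^ 2]. *)
have e1 : 0 < e * e / 2 by rewrite divr_gt0// mulr_gt0.
have e2 : 0 < e * e / (4 * M) by rewrite divr_gt0// mulr_gt0.
have [r1 r10 h1] := semigroup_strong filtF markovX rf2 e1.
have [r2 r20 h2] := semigroup_strong filtF markovX rf e2.
exists (Num.min r1 r2); first by rewrite lt_min r10.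
move=> s h x s0 h0; rewrite lt_min => /andP[hr1 hr2].
have sh0 : 0 <= s + h by rewrite addr_ge0.
have cf : continuous f by case: rf.
pose A w := f (X s w); pose B w := f (X (s + h) w).
have iA : itg (P x) A by exact: (regular_itg filtF markovX x s0 rf).
have iB : itg (P x) B by exact: (regular_itg filtF markovX x sh0 rf).
have mA := itg_measurable iA; have mB := itg_measurable iB.
have bA w : `|A w| <= M by exact: fM.
have iAA := itgM_bounded mA bA iA.
have iAB := itgM_bounded mA bA iB.
have bB w : `|B w| <= M by exact: fM.
have iBB := itgM_bounded mB bB iB.
have pA : past_measurable F s A by exact: (past_measurable_process filtF markovX).
have mAB : mean (P x) (fun w => A w * B w) = mean (P x) (fun w => A w * semi h f (X s w)).
  exact: (markov_past filtF markovX x s0 h0 pA M0 bA rf).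
have mBB : mean (P x) (fun w => B w * B w) =
    mean (P x) (fun w => semi h (fun y => f y * f y) (X s w)).
  exact: (semigroup_law x s0 h0 rf2).
have ir1 := regular_itg filtF markovX x s0 (semigroup_regular filtF markovX h0 rf2).
have ir2 : itg (P x) (fun w => A w * semi h f (X s w)).
  apply: (itgM_bounded mA bA).
  exact: (regular_itg filtF markovX x s0 (semigroup_regular filtF markovX h0 rf)).
have sq : mean (P x) (fun w => (A w - B w) ^+ 2) <= e * e.
  have -> : (fun w => (A w - B w) ^+ 2) =
      (fun w => (A w * A w - 2 * (A w * B w)) + B w * B w).
    by apply/funext => w; ring.
  rewrite meanD//; last exact: itgB iAA (itgZ _ iAB).
  rewrite meanB//; last exact: itgZ.
  rewrite meanZ// mAB mBB -meanZ// -meanB//; last exact: itgZ.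
  rewrite -meanD//; last exact: itgB iAA (itgZ _ ir2).
  apply: mean_le_cst; first exact: itgD (itgB iAA (itgZ _ ir2)) ir1.
  move=> w; rewrite -/(A w).
  have := h1 h h0 hr1 (X s w); rewrite -/(A w) => /ler_normlP[_ k1].
  have k2 := h2 h h0 hr2 (X s w).
  have k3 : `|A w * (semi h f (X s w) - A w)| <= M * (e * e / (4 * M)).
    by rewrite normrM ler_pM//; exact: bA.
  have k4 : M * (e * e / (4 * M)) = e * e / 4 by field; rewrite gt_eqF.
  move: k3; rewrite k4 => /ler_normlP[k3 _].
  move: k1 k3; set p := semi h _ _; set q := semi h f _; nra.
have iabs : itg (P x) (fun w => `|A w - B w|) by exact/itg_norm/itgB.
have isq : itg (P x) (fun w => (A w - B w) ^+ 2).
  apply: (@itg_bounded _ _ _ _ _ ((2 * M) ^+ 2)).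
    by apply: measurable_funX; exact: measurable_funB.
  move=> w; rewrite normrX lerXn2r ?nnegrE ?mulr_ge0 ?(ltW M0)//.
  by rewrite (le_trans (ler_normB _ _))// mulr_natl mulr2n lerD.
(* From the second to the first moment, [y <= y ^ 2 / (2 e) + e / 2]. *)
apply: (@le_trans _ _ (mean (P x) (fun w => (2 * e)^-1 * (A w - B w) ^+ 2 + e / 2))).
  apply: mean_le => //; first exact: itgD (itgZ _ isq) (itg_cst _ _).
  move=> w; rewrite -/(A w) -/(B w) -[X in _ * X + _](real_normK (num_real _)); set y := `|_|.
  have -> : (2 * e)^-1 * y ^+ 2 + e / 2 = y + (2 * e)^-1 * (y - e) ^+ 2.
    by field; rewrite gt_eqF.
  by rewrite lerDl mulr_ge0 ?sqr_ge0// invr_ge0 mulr_ge0// ltW.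
rewrite meanD ?mean_cst ?meanZ//; [|exact: itgZ|exact: itg_cst].
have : (2 * e)^-1 * mean (P x) (fun w => (A w - B w) ^+ 2) <= (2 * e)^-1 * (e * e).
  by rewrite ler_wpM2l// invr_ge0 mulr_ge0// ltW.
have -> : (2 * e)^-1 * (e * e) = e / 2 by field; rewrite gt_eqF.
move=> h3; rewrite [leRHS](_ : _ = e / 2 + e / 2); last by field.
by rewrite lerD2r.
Qed.

Lemma dyadic_sum_bounded n (v : R -> R) M : (forall s, `|v s| <= M) ->
  `|dyadic_sum delta n v| <= delta * M.
Proof.
move=> vM; rewrite /dyadic_sum normrM gtr0_norm ?mesh_gt0//.
rewrite [leRHS](_ : _ = mesh delta n * ((2 ^ n)%:R * M)); last first.
  by rewrite mulrCA mulrA mesh_total.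
rewrite ler_pM2l ?mesh_gt0//.
rewrite (le_trans (ler_norm_sum _ _ _))//.
rewrite (le_trans (ler_sum _ (fun (i : 'I_(2 ^ n)) _ => vM (i.+1%:R * mesh delta n))))//.
by rewrite sumr_const card_ord mulr_natl.
Qed.

(** The bound is first proved between two dyadic sums, where only finitely many
    expectations are exchanged with a sum, and passes to the limit of the finer
    one. *)
Lemma dyadic_sum_uniform f a e : regular f a -> 0 < e ->
  exists n, forall x, mean (P x) (fun w =>
    `|time_integral X delta f w - dyadic_sum delta n (fun s => f (X s w))|) <= e.
Proof.
move=> rf e0; have [M M0 fM] := regular_bounded rf.
have cf : continuous f by case: rf.
have e1 : 0 < e / delta by rewrite divr_gt0.
have [r r0 hr] := increment_small rf e1.
have [n hn] : exists n, mesh delta n < r.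
  by have /filter_ex[n ?] := mesh_small delta_gt0 r0; exists n.
exists n => x; pose S m w := dyadic_sum delta m (fun s => f (X s w)).
have mS m : measurable_fun setT (S m) by exact: (dyadic_sum_measurable filtF markovX).
have bS m w : `|S m w| <= delta * M by exact: dyadic_sum_bounded.
have bSS k w : `| (`|S (n + k)%N w - S n w|) | <= delta * M + delta * M.
  by rewrite normr_id (le_trans (ler_normB _ _))// lerD.
have mSS k : measurable_fun setT (fun w => `|S (n + k)%N w - S n w|).
  by apply: measurableT_comp => //; exact: measurable_funB.
have cvgS w : `|S (n + k)%N w - S n w| @[k --> \oo] -->
    `|time_integral X delta f w - S n w|.
  apply: cvg_norm; apply: cvgB; last exact: cvg_cst.
  have := @dyadic_path_cvg _ _ _ _ _ _ _ _ markovX delta_gt0 f w cf.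
  by move=> h; apply: cvg_comp h; exact: cvg_addnl.
have hlim := @mean_cvg_bounded _ _ _ (P x) _ _ _ mSS bSS cvgS.
apply: (ler_cvg_to hlim (cvg_cst e)); apply: nearW => k /=.
pose V j w := `|f (X (j.+1%:R * mesh delta (n + k)) w) -
                f (X ((j %/ 2 ^ k).+1%:R * mesh delta n) w)|.
have iV j : itg (P x) (V j).
  apply: itg_norm; apply: itgB.
    by apply: (regular_itg filtF markovX x _ rf); exact: mesh_point_ge0.
  by apply: (regular_itg filtF markovX x _ rf); exact: mesh_point_ge0.
have [iSV mSV] := mean_sum (2 ^ (n + k)) iV.
apply: (@le_trans _ _ (mean (P x) (fun w =>
    mesh delta (n + k) * \sum_(j < 2 ^ (n + k)) V j w))).
  apply: mean_le; [exact: itg_bounded (bSS k)|exact: itgZ|].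
  move=> w; rewrite /S dyadic_refine normrM gtr0_norm ?mesh_gt0//.
  by rewrite ler_pM2l ?mesh_gt0//; exact: ler_norm_sum.
rewrite meanZ// mSV.
have hV (j : 'I_(2 ^ (n + k))) : mean (P x) (V j) <= e / delta.
  have [h /andP[h0 hlt] eh] := dyadic_block_time (ltn_ord j) delta_gt0.
  rewrite /V -eh.
  by apply: hr => //; [exact: mesh_point_ge0|exact: lt_trans hn].
rewrite (le_trans (ler_wpM2l (ltW (mesh_gt0 delta_gt0 _))
  (ler_sum _ (fun (j : 'I_(2 ^ (n + k))) _ => hV j))))//.
rewrite sumr_const card_ord -[_ *+ _]mulr_natl mulrA [mesh _ _ * _]mulrC mesh_total.
by rewrite mulrC divfK// gt_eqF.
Qed.

End UniformApproximation.

(** * Continuity in the starting point for bounded rewards *)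

Section UniformLimit.
Context {R : realType} {T : topologicalType}.

Lemma continuous_approx (g : T -> R) x : (forall e, 0 < e ->
    exists2 h, {for x, continuous h} & \forall y \near x, `|g y - h y| <= e) ->
  {for x, continuous g}.
Proof.
move=> gh; apply/cvgrPdist_le => e e0; have e3 : 0 < e / 3 by rewrite divr_gt0.
have [h ch near_h] := gh _ e3.
have /cvgrPdist_le/(_ _ e3) hx := ch.
near=> y.
have h1 : `|g x - h x| <= e / 3 by exact: (nbhs_singleton near_h).
have h2 : `|h x - h y| <= e / 3 by near: y.
have h3 : `|g y - h y| <= e / 3 by near: y.
rewrite (_ : g x - g y = (g x - h x) + ((h x - h y) - (g y - h y))); last by ring.
apply: (le_trans (ler_normD _ _)).
have := ler_normB (h x - h y) (g y - h y); lra.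
Unshelve. all: by end_near.
Qed.

Lemma continuous_uniform_approx (g : T -> R) x : (forall e, 0 < e ->
    exists2 h, {for x, continuous h} & forall y, `|g y - h y| <= e) ->
  {for x, continuous g}.
Proof.
move=> gh; apply: continuous_approx => e /gh[h ch hy]; exists h => //.
exact: nearW.
Qed.

Lemma expR_lipschitz (a b B : R) : a <= B -> b <= B ->
  `|expR a - expR b| <= expR B * `|a - b|.
Proof.
wlog ab : a b / b <= a => [hw aB bB|aB _].
  have /orP[ab|ab] := le_total b a; first exact: hw.
  by rewrite distrC [`|a - b|]distrC; apply: hw.
rewrite !ger0_norm ?subr_ge0 ?ler_expR//.
have -> : expR a - expR b = expR a * (1 - expR (b - a)).
  by rewrite mulrBr mulr1 -expRD addrCA subrr addr0.
have := expR_ge1Dx (b - a) => h.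
apply: (@le_trans _ _ (expR a * (a - b))).
  by rewrite ler_wpM2l ?expR_ge0//; lra.
by rewrite ler_wpM2r ?ler_expR// subr_ge0.
Qed.

End UniformLimit.

Section BoundedContinuity.
Context {R : realType} {d : nat} {disp : measure_display}
  {Omega : measurableType disp}.
Local Notation E := 'rV[R]_d.
Variables (P : E -> probability Omega R) (F : R -> set (set Omega))
  (X : R -> Omega -> E) (delta : R).
Hypotheses (filtF : filtration F) (markovX : feller_markov P F X)
  (delta_gt0 : 0 < delta).
Local Notation semi := (transition_semigroup P X).
Local Notation meas_gX := (process_comp_measurable filtF markovX).
Local Notation TI := (time_integral X delta).

(** Condition on the last grid time but one: the last factor is replaced by its
    image under the semigroup. *)
Lemma product_regular g a theta N : 0 <= theta -> regular g a ->
  forall h b, regular h b -> exists l, regular (fun x => mean (P x) (fun w =>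
    (\prod_(i < N) g (X (i.+1%:R * theta) w)) * h (X (N%:R * theta) w))) l.
Proof.
move=> t0 rg; have [M M0 gM] := regular_bounded rg.
elim: N => [|N ih] h b rh.
  exists b; rewrite (_ : (fun x => _) = h)//; apply/funext => x.
  rewrite -[RHS](semigroup0 filtF markovX x rh) mul0r; congr fine.
  by apply: eq_integral => w _; rewrite big_ord0 mul1r.
have rgh := regularM rg rh.
have [l hl] := ih _ _ (semigroup_regular filtF markovX t0 rgh).
exists l; move: hl; congr (regular _ _); apply/funext => x.
have N0 : 0 <= N%:R * theta by rewrite mulr_ge0.
have pH : past_measurable F (N%:R * theta)
    (fun w => \prod_(i < N) g (X (i.+1%:R * theta) w)).
  apply: measurable_prod => i _; apply: (past_measurable_process filtF markovX).
  - by rewrite mulr_ge0.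
  - by rewrite ler_wpM2r// ler_nat.
  - by case: rg.
have bH w : `|\prod_(i < N) g (X (i.+1%:R * theta) w)| <= M ^+ N.
  rewrite normr_prod -[leRHS](_ : \prod_(i < N) M = _); last first.
    by rewrite prodr_const card_ord.
  by apply: ler_prod => i _; rewrite normr_ge0 gM.
rewrite -(markov_past filtF markovX x N0 t0 pH (exprn_gt0 _ M0) bH rgh).
congr fine; apply: eq_integral => w _; congr (_%:E).
by rewrite big_ord_recr/= -mulrA -[N.+1%:R]natr1 mulrDl mul1r.
Qed.

Lemma time_integral_bounded f (M : R) w : continuous f -> (forall x, `|f x| <= M) ->
  `|TI f w| <= M * delta.
Proof.
move=> cf fM; have := @time_integral_norm_le _ _ _ _ _ _ _ _ markovX delta_gt0 f f M 0 w cf cf.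
by rewrite mul0r addr0; apply => x; rewrite mul0r addr0.
Qed.

Lemma bounded_reward_continuous f g a b : regular f a -> regular g b ->
  continuous (fun x => mean (P x) (fun w => expR (TI f w + g (X delta w)))).
Proof.
move=> rf rg x0; apply: continuous_uniform_approx => e e0.
have [M M0 fM] := regular_bounded rf; have [N N0 gN] := regular_bounded rg.
have cf : continuous f by case: rf.
have cg : continuous g by case: rg.
set B := M * delta + N.
have e1 : 0 < e / expR B by rewrite divr_gt0// expR_gt0.
have [n hn] := dyadic_sum_uniform filtF markovX delta_gt0 rf e1.
pose S w := dyadic_sum delta n (fun s => f (X s w)).
have mg : measurable_fun setT (fun w => g (X delta w)) by apply: meas_gX => //; exact: ltW.
have mT := time_integral_measurable filtF markovX delta_gt0 cf.
have mS : measurable_fun setT S by exact: (dyadic_sum_measurable filtF markovX).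
have TB w : TI f w + g (X delta w) <= B.
  by apply: lerD; apply: (le_trans (ler_norm _)); [exact: time_integral_bounded|exact: gN].
have SB w : S w + g (X delta w) <= B.
  apply: lerD; apply: (le_trans (ler_norm _)); last exact: gN.
  by rewrite mulrC; apply: dyadic_sum_bounded.
have iexp x (Z : Omega -> R) : measurable_fun setT Z -> (forall w, Z w <= B) ->
    itg (P x) (fun w => expR (Z w)).
  move=> mZ ZB; apply: (@itg_bounded _ _ _ _ _ (expR B)); first exact: measurable_expR_comp.
  by move=> w; rewrite ger0_norm ?expR_ge0// ler_expR.
have iT x : itg (P x) (fun w => expR (TI f w + g (X delta w))).
  by apply: iexp => //; exact: measurable_funD.
have iS x : itg (P x) (fun w => expR (S w + g (X delta w))).
  by apply: iexp => //; exact: measurable_funD.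
exists (fun x => mean (P x) (fun w => expR (S w + g (X delta w)))).
  have rF : regular (fun x => expR (mesh delta n * f x)) (expR (mesh delta n * a)).
    apply: (@regular_comp _ _ (fun y => expR (mesh delta n * y))) => // y.
    apply: (@continuous_comp _ _ _ (fun y => mesh delta n * y) expR).
      exact: mulrl_continuous.
    exact: continuous_expR.
  have rG : regular (fun x => expR (g x)) (expR b).
    by apply: regular_comp => //; exact: continuous_expR.
  have [l] := product_regular (2 ^ n) (ltW (mesh_gt0 delta_gt0 n)) rF rG.
  set G := (X in regular X _) => -[cG _].
  rewrite (_ : (fun x => _) = G); first exact: cG.
  apply/funext => x; rewrite /G.
  congr fine; apply: eq_integral => w _; congr (_%:E).
  by rewrite mesh_total expRD /S /dyadic_sum mulr_sumr expR_sum.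
move=> x; rewrite -meanB//.
have iD : itg (P x) (fun w => `|TI f w - S w|).
  apply: (@itg_bounded _ _ _ _ _ (M * delta + delta * M)).
    by apply: measurableT_comp => //; exact: measurable_funB.
  move=> w; rewrite normr_id (le_trans (ler_normB _ _))// lerD//.
    exact: time_integral_bounded.
  exact: dyadic_sum_bounded.
apply: (le_trans (mean_norm (itgB (iT x) (iS x)))).
apply: (@le_trans _ _ (mean (P x) (fun w => expR B * `|TI f w - S w|))).
  apply: mean_le; [exact/itg_norm/itgB|exact: itgZ|].
  move=> w; apply: (le_trans (expR_lipschitz (TB w) (SB w))).
  by rewrite opprD addrACA subrr addr0.
by rewrite meanZ// mulrC -ler_pdivlMr ?expR_gt0.
Qed.

End BoundedContinuity.

(** * Compact containment and continuity for unbounded rewards *)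

Section Cutoff.
Context {R : realType} {d : nat}.
Local Notation E := 'rV[R]_d.

Definition cutoff (m : R) (x : E) : R := Num.max 0 (Num.min 1 (m + 1 - `|x|)).

Lemma cutoff_bounds m x : 0 <= cutoff m x <= 1.
Proof. by rewrite /cutoff le_max lexx/= ge_max ler01 ge_min lexx. Qed.

Lemma cutoff_one m x : `|x| <= m -> cutoff m x = 1.
Proof.
move=> xm; rewrite /cutoff; have -> : Num.min 1 (m + 1 - `|x|) = 1.
  by apply/min_idPl; lra.
by apply/max_idPr.
Qed.

Lemma cutoff_zero m x : m + 1 < `|x| -> cutoff m x = 0.
Proof.
move=> xm; apply/max_idPl; rewrite ge_min; apply/orP; right; lra.
Qed.

Lemma cutoff_continuous m : continuous (cutoff m).
Proof.
move=> x.
have cn : continuous (fun x : E => (m + 1) + -1 * `|x|).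
  by apply: continuous_affine => y; exact: norm_continuous.
have -> : cutoff m = ((fun=> 0) \max ((fun=> 1) \min (fun x => (m + 1) + -1 * `|x|)))%R.
  by apply/funext => y; rewrite /cutoff/= mulN1r.
apply: continuous_max; first exact: cst_continuous.
by apply: continuous_min; [exact: cst_continuous|exact: cn].
Qed.

Lemma cutoff_regular m (f : E -> R) : continuous f -> regular (fun x => f x * cutoff m x) 0.
Proof.
move=> cf; split.
  move=> x; apply: (@continuousM _ _ f (cutoff m)); first exact: cf.
  exact: cutoff_continuous.
apply/cvgrPdist_lt => e e0; exists [set x : E | `|x| <= m + 1].
  exact: closed_ball_compact.
move=> x /= /negP; rewrite -ltNge => /cutoff_zero ->.
by rewrite mulr0 subrr normr0.
Qed.

End Cutoff.

Lemma near_gt (R : realType) (T : topologicalType) (h : T -> R) x a :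
  {for x, continuous h} -> a < h x -> \forall y \near x, a < h y.
Proof. by move=> ch; exact: (cvgr_gt _ ch). Qed.

Section Containment.
Context {R : realType} {d : nat} {disp : measure_display}
  {Omega : measurableType disp}.
Local Notation E := 'rV[R]_d.
Variables (P : E -> probability Omega R) (F : R -> set (set Omega))
  (X : R -> Omega -> E) (delta : R).
Hypotheses (filtF : filtration F) (markovX : feller_markov P F X)
  (delta_gt0 : 0 < delta).
Local Notation semi := (transition_semigroup P X).
Local Notation meas_gX := (process_comp_measurable filtF markovX).
Local Notation TI := (time_integral X delta).

(** By strong continuity finitely many times suffice. *)
Lemma tail_uniform g e : regular g 0 -> 0 < e ->
  \forall y \near at_infinity, forall h, 0 <= h <= delta -> semi h g y <= e.
Proof.
move=> rg e0; have e2 : 0 < e / 2 by rewrite divr_gt0.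
have [r r0 hr] := semigroup_strong filtF markovX rg e2.
pose q := r / 2; have q0 : 0 < q by rewrite divr_gt0.
have near_grid N : \forall y \near at_infinity,
    forall k, (k < N)%N -> semi (k%:R * q) g y <= e / 2.
  elim: N => [|N ih]; first by apply: nearW.
  have Nq : 0 <= N%:R * q by rewrite mulr_ge0// ltW.
  have [_ /cvgrPdist_le/(_ _ e2) lN] := semigroup_regular filtF markovX Nq rg.
  apply: filterS2 ih lN => y hy; rewrite sub0r normrN => lN k.
  rewrite ltnS leq_eqVlt => /predU1P[->|]; last exact: hy.
  by rewrite (le_trans (ler_norm _)).
apply: filterS (near_grid (Num.truncn (delta / q)).+1) => y hy h /andP[h0 hd].
pose k := Num.truncn (h / q).
have hq0 : 0 <= h / q by rewrite divr_ge0// ltW.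
have /andP[kh hk] := truncn_itv hq0.
have kq0 : 0 <= k%:R * q by rewrite mulr_ge0// ltW.
have u0 : 0 <= h - k%:R * q by rewrite subr_ge0 -ler_pdivlMr.
have ur : h - k%:R * q < r.
  move: hk; rewrite ltr_pdivrMr// -natr1 mulrDl mul1r -/k => hk.
  by have : q < r; [rewrite /q; lra|lra].
have hE : h = k%:R * q + (h - k%:R * q) by rewrite addrC subrK.
rewrite hE (semigroup_law filtF markovX y kq0 u0 rg).
have kN : (k < (Num.truncn (delta / q)).+1)%N.
  by rewrite ltnS le_truncn// ler_pM2r ?invr_gt0.
have := hy k kN; have rsg := semigroup_regular filtF markovX u0 rg.
have close : `|semi (k%:R * q) (semi (h - k%:R * q) g) y - semi (k%:R * q) g y| <= e / 2.
  apply: mean_close; [exact: (regular_itg filtF markovX y kq0 rsg)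
    |exact: (regular_itg filtF markovX y kq0 rg)|].
  by move=> w; exact: hr.
move/ler_normlP: close => [_]; lra.
Qed.

Definition escape_before (M : R) n N : set Omega :=
  [set w | exists2 i, (i < N)%N & M < `|X (i%:R * mesh delta n) w|].

Definition escape (M : R) : set Omega := \bigcup_n escape_before M n (2 ^ n).+1.

Lemma escape_beforeS M n N : escape_before M n N.+1 =
  escape_before M n N `|` [set w | M < `|X (N%:R * mesh delta n) w|].
Proof.
apply/seteqP; split => [w [i]|w [[i iN h]|h]].
- rewrite ltnS leq_eqVlt => /predU1P[->|iN] h; [by right|by left; exists i].
- by exists i => //; rewrite ltnS ltnW.
- by exists N.
Qed.

Lemma past_setE t (A : set Omega) : 0 <= t ->
  F t A <-> measurable (A : set (g_sigma_algebraType (F t))).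
Proof.
move=> t0; have sF := filtration_sigma filtF t0.
by have -> : F t A = <<s F t >> A by rewrite sigma_algebra_id.
Qed.

Lemma exit_past M s t : 0 <= s -> s <= t -> F t [set w | M < `|X s w|].
Proof.
move=> s0 st; rewrite (_ : [set w | _] = X s @^-1` [set y | M < `|y|])//.
apply: (past_adapted filtF markovX) => //; apply: open_borel.
by apply: (open_comp _ (@open_gt _ M)) => y _; exact: norm_continuous.
Qed.

Lemma escape_before_past M n N t : 0 <= t -> (forall i, (i < N)%N -> i%:R * mesh delta n <= t) ->
  F t (escape_before M n N).
Proof.
move=> t0; elim: N => [|N ih] hN.
  rewrite (_ : escape_before _ _ _ = set0); first by have [] := filtration_sigma filtF t0.
  by apply/seteqP; split => // w [].
rewrite escape_beforeS; apply/past_setE => //; apply: measurableU.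
  by apply/past_setE => //; apply: ih => i iN; apply: hN; rewrite ltnS ltnW.
apply/past_setE => //; apply: exit_past; [exact: mesh_point_ge0|exact: hN].
Qed.

Lemma escape_before_measurable M n N : measurable (escape_before M n N).
Proof.
have t0 : 0 <= N%:R * mesh delta n by exact: mesh_point_ge0.
apply: (filtration_sub filtF t0); apply: escape_before_past => // i iN.
by rewrite ler_wpM2r ?(ltW (mesh_gt0 _ _))// ler_nat ltnW.
Qed.

(** Ottaviani's inequality: after a first exit beyond [M] the process is, with
    conditional probability at least one half, outside the bulk of [chi] at the
    terminal time. *)
Lemma ottaviani chi l (M : R) n N x : regular chi l -> (forall y, 0 <= chi y <= 1) ->
  (forall h y, 0 <= h <= delta -> M < `|y| -> semi h chi y <= 2^-1) ->
  (N <= (2 ^ n).+1)%N ->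
  mean (P x) (\1_(escape_before M n N) : Omega -> R) <=
  2 * mean (P x) (fun w => \1_(escape_before M n N) w * (1 - chi (X delta w))).
Proof.
move=> rc c01 hM; have d0 := ltW delta_gt0.
have ic := regular_itg filtF markovX x d0 rc.
have ipsi : itg (P x) (fun w => 1 - chi (X delta w)) by apply: itgB => //; exact: itg_cst.
have iI A : measurable A -> itg (P x) (fun w => \1_A w * (1 - chi (X delta w))).
  move=> mA; apply: (itgM_bounded (a := 1)); last exact: ipsi.
    exact: measurable_indic.
  by move=> w; exact: indic_norm_le1.
elim: N => [|N ih] hN.
  rewrite (_ : escape_before _ _ _ = set0); last by apply/seteqP; split => // w [].
  rewrite (_ : \1_set0 = fun=> 0); last by apply/funext => w; rewrite indicE in_set0.
  rewrite mean_cst (_ : (fun w => _) = fun=> 0) ?mean_cst ?mulr0//.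
  by apply/funext => w; rewrite mul0r.
set t := N%:R * mesh delta n.
have t0 : 0 <= t by exact: mesh_point_ge0.
have td : t <= delta by exact: mesh_point_le.
pose D := escape_before M n N; pose B := [set w | M < `|X t w|].
have FD : F t D.
  apply: escape_before_past => // i iN.
  by rewrite ler_wpM2r ?(ltW (mesh_gt0 _ _))// ler_nat ltnW.
have FB : F t B by exact: exit_past.
have FA : F t (B `\` D).
  by apply/past_setE => //; apply: measurableD; apply/past_setE.
have mA := past_measurable_set filtF t0 FA.
have mD := past_measurable_set filtF t0 FD.
have split1 w : \1_(escape_before M n N.+1) w = \1_D w + \1_(B `\` D) w :> R.
  rewrite escape_beforeS -/D -/B !indicE in_setU in_setD.
  by case: (w \in D); case: (w \in B); rewrite ?addr0 ?add0r.
have -> : (\1_(escape_before M n N.+1) : Omega -> R) = fun w => \1_D w + \1_(B `\` D) w.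
  by apply/funext => w; exact: split1.
rewrite meanD; [|exact: itg_indic|exact: itg_indic].
have -> : (fun w => (\1_D w + \1_(B `\` D) w) * (1 - chi (X delta w))) =
    (fun w => \1_D w * (1 - chi (X delta w)) + \1_(B `\` D) w * (1 - chi (X delta w))).
  by apply/funext => w; rewrite mulrDl.
rewrite [X in _ <= 2 * X]meanD; [|exact: iI|exact: iI].
rewrite mulrDr lerD//; first by apply: ih; exact: ltnW.
set A := B `\` D.
have iA : itg (P x) (\1_A : Omega -> R) by exact: itg_indic.
have m1 : measurable_fun setT (\1_A : Omega -> R) by exact: measurable_indic.
have b1 w := @indic_norm_le1 R _ A w.
have dt : t + (delta - t) = delta by rewrite addrC subrK.
have dt0 : 0 <= delta - t by rewrite subr_ge0.
have mk := markov_event filtF markovX x t0 dt0 FA rc; rewrite dt in mk.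
have rsc := semigroup_regular filtF markovX dt0 rc.
have iAs : itg (P x) (fun w => \1_A w * semi (delta - t) chi (X t w)).
  by apply: (itgM_bounded m1 b1); exact: (regular_itg filtF markovX x t0 rsc).
have -> : (fun w => \1_A w * (1 - chi (X delta w))) =
    (fun w => \1_A w - \1_A w * chi (X delta w)).
  by apply/funext => w; rewrite mulrBr mulr1.
rewrite meanB//; last exact: itgM_bounded b1 ic.
have : mean (P x) (fun w => \1_A w * chi (X delta w)) <=
    2^-1 * mean (P x) (\1_A : Omega -> R).
  rewrite mk -meanZ//; apply: mean_le => //; first exact: itgZ.
  move=> w; rewrite mulrC indicE; have [wA|wA] := boolP (w \in A); last by rewrite !mulr0.
  rewrite !mulr1; apply: hM; first by rewrite dt0/= gerBl.
  by move: wA; rewrite inE => -[].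
by set a := mean _ _; set b := mean _ _; lra.
Qed.

Lemma escape_measurable M : measurable (escape M).
Proof. by apply: bigcup_measurable => n _; exact: escape_before_measurable. Qed.

(** The dyadic grids are nested, so the escape events increase to their union. *)
Lemma escape_le M x e : (forall n, mean (P x)
    (\1_(escape_before M n (2 ^ n).+1) : Omega -> R) <= e) ->
  mean (P x) (\1_(escape M) : Omega -> R) <= e.
Proof.
move=> he.
have mono n k : escape_before M n (2 ^ n).+1 `<=` escape_before M (n + k) (2 ^ (n + k)).+1.
  move=> w [i iN h]; exists (i * 2 ^ k)%N.
    by rewrite ltnS expnD leq_pmul2r ?expn_gt0.
  by rewrite natrM -mulrA -mesh_refine.
have := @mean_cvg_bounded _ _ _ (P x) (fun n => \1_(escape_before M n (2 ^ n).+1))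
  (\1_(escape M)) 1.
move=> /(_ (fun n => measurable_indic (escape_before_measurable _ _ _)))
  /(_ (fun n w => indic_norm_le1 _ w)) hc.
apply: (ler_cvg_to (hc _) (cvg_cst e)); last by apply: nearW => n; exact: he.
move=> w; have [[n _ wn]|wn] := pselect (escape M w).
  rewrite [X in _ --> X](_ : _ = 1); last by rewrite indicE mem_set//; exists n.
  apply: cvg_near_cst; exists n => // m /= nm.
  by rewrite indicE mem_set// -(subnKC nm); exact: mono.
rewrite [X in _ --> X](_ : _ = 0); last by rewrite indicE memNset.
apply: cvg_near_cst; apply: nearW => m.
by rewrite indicE memNset// => wm; apply: wn; exists m.
Qed.

(** Leaving a closed ball is an open condition, hence by right-continuity it is
    seen at some dyadic time. *)
Lemma not_escape M w s : ~ escape M w -> 0 <= s <= delta -> `|X s w| <= M.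
Proof.
move=> nw /andP[s0 sd]; rewrite leNgt; apply/negP => Ms.
move: s0; rewrite le_eqVlt => /predU1P[s0|s0].
  by apply: nw; exists 0%N => //; exists 0%N => //; rewrite mul0r s0.
have [cr _] := markov_cadlag markovX w.
have := cr s (ltW s0) => /cvg_norm /cvgr_gt /(_ _ Ms) /near_right_ex[r r0 hr].
have [n hn] : exists n, mesh delta n < r.
  by have /filter_ex[n ?] := mesh_small delta_gt0 r0; exists n.
have [i /andP[h1 h2]] := mesh_bracket n s0 sd.
apply: nw; exists n => //; exists i.+1; first by rewrite ltnS.
move: h2; rewrite le_eqVlt => /predU1P[<-//|h2]; apply: hr => //.
by move: h1; rewrite -natr1 mulrDl mul1r; lra.
Qed.

(** Combine Ottaviani's inequality with a cutoff whose expectation at the terminal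
    time is close to one at [x0], hence nearby; the event does not depend on the
    starting point. *)
Lemma containment (x0 : E) (e : R) : 0 < e -> exists M, \forall x \near x0,
  mean (P x) (\1_(escape M) : Omega -> R) <= e.
Proof.
move=> e0; have d0 := ltW delta_gt0.
have c1 : continuous (fun _ : E => 1 : R) by move=> x; exact: cst_continuous.
have reg (m : nat) : regular (cutoff m%:R : E -> R) 0.
  have := @cutoff_regular _ d m%:R (fun=> 1) c1.
  by under eq_fun do rewrite mul1r.
have chi1 (y : E) : cutoff m%:R y @[m --> \oo] --> (1 : R).
  apply: cvg_near_cst; exists (Num.truncn `|y|).+1 => // m /= ym.
  by apply: cutoff_one; rewrite (le_trans (ltW (truncnS_gt _)))// ler_nat.
(* A cutoff that the terminal value sees, from [x0], with probability close to
   one; by the Feller property this persists near [x0]. *)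
have [m hm] : exists m : nat, 1 - e / 4 < semi delta (cutoff m%:R) x0.
  have mc (m : nat) : measurable_fun setT (fun w => cutoff m%:R (X delta w)).
    by apply: meas_gX => //; exact: cutoff_continuous.
  have bc (m : nat) w : `|cutoff m%:R (X delta w)| <= 1.
    by have /andP[h0 h1] := cutoff_bounds m%:R (X delta w); rewrite ger0_norm.
  have := @mean_cvg_bounded _ _ _ (P x0) _ (fun=> 1) 1 mc bc (fun w => chi1 _).
  rewrite mean_cst => /cvgr_gt /(_ (1 - e / 4)) H.
  have /filter_ex[m hm] : \forall m \near \oo, 1 - e / 4 <
    mean (P x0) (fun w => cutoff m%:R (X delta w)) by apply: H; lra.
  by exists m.
have [cs _] := semigroup_regular filtF markovX d0 (reg m).
have half0 : 0 < 2^-1 :> R by rewrite invr_gt0.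
have [K cK hK] := tail_uniform (reg m) half0.
have [M KM] : exists M, forall y, M < `|y| -> ~ K y.
  have [M [_ hM]] := compact_bounded cK.
  exists (M + 1) => y My Ky; have h1 : `|y| <= M + 1 by apply: hM => //; rewrite ltrDl.
  by move: My; rewrite ltNge h1.
exists M.
have near_x : \forall x \near x0, 1 - e / 4 < semi delta (cutoff m%:R) x.
  exact: (near_gt (cs x0) hm).
apply: filterS near_x => x hx; apply: escape_le => n.
have h2 h y : 0 <= h <= delta -> M < `|y| -> semi h (cutoff m%:R) y <= 2^-1.
  by move=> hd My; exact: (hK y (KM y My)).
apply: (le_trans (ottaviani x (reg m) (cutoff_bounds m%:R) h2 (leqnn _))).
have ic := regular_itg filtF markovX x d0 (reg m).
have ipsi : itg (P x) (fun w => 1 - cutoff m%:R (X delta w)).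
  by apply: itgB => //; exact: itg_cst.
have psi0 w : 0 <= 1 - cutoff m%:R (X delta w).
  by have /andP[_ h1] := cutoff_bounds m%:R (X delta w); rewrite subr_ge0.
apply: (@le_trans _ _ (2 * mean (P x) (fun w => 1 - cutoff m%:R (X delta w)))).
  rewrite ler_pM2l//; apply: mean_le => //.
    apply: (itgM_bounded (a := 1)); last exact: ipsi.
      by apply: measurable_indic; exact: escape_before_measurable.
    by move=> w; exact: indic_norm_le1.
  move=> w; rewrite indicE; case: (_ \in _); rewrite ?mul1r// mul0r//.
rewrite meanB ?mean_cst//; last exact: itg_cst.
by move: hx; rewrite semigroupE; set a := mean _ _; lra.
Qed.

End Containment.

Section RewardContinuity.
Context {R : realType} {d : nat} {disp : measure_display}
  {Omega : measurableType disp}.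
Local Notation E := 'rV[R]_d.
Variables (P : E -> probability Omega R) (F : R -> set (set Omega))
  (X : R -> Omega -> E) (delta : R).
Hypotheses (filtF : filtration F) (markovX : feller_markov P F X)
  (delta_gt0 : 0 < delta).
Local Notation meas_gX := (process_comp_measurable filtF markovX).
Local Notation TI := (time_integral X delta).

Lemma reward_norm_le (omega f g : E -> R) a b a' b' w : continuous omega ->
  continuous f -> (forall x, `|f x| <= a + b * omega x) ->
  (forall x, `|g x| <= a' + b' * omega x) ->
  `|TI f w + g (X delta w)| <=
    (a * delta + b * TI omega w) + (a' + b' * omega (X delta w)).
Proof.
move=> co cf fa ga; apply: (le_trans (ler_normD _ _)); apply: lerD; last exact: ga.
exact: (time_integral_norm_le markovX delta_gt0).
Qed.

(** Cut the integrands off outside a large ball: the two exponentials differ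
    only when the path escapes, and there the exponential moments bound them. *)
Lemma reward_continuous (omega f g : E -> R) a b a' b' (x0 : E) (C : R) :
  continuous omega -> continuous f -> continuous g ->
  (forall x, `|f x| <= a + b * omega x) ->
  (forall x, `|g x| <= a' + b' * omega x) -> 0 < C ->
  (\forall x \near x0, itg (P x) (fun w => expR (2 *
     ((a * delta + b * TI omega w) + (a' + b' * omega (X delta w))))) /\
    mean (P x) (fun w => expR (2 *
     ((a * delta + b * TI omega w) + (a' + b' * omega (X delta w))))) <= C) ->
  {for x0, continuous (fun x => mean (P x) (fun w => expR (TI f w + g (X delta w))))}.
Proof.
move=> co cf cg fa ga C0 near_mom; have d0 := ltW delta_gt0.
apply: continuous_approx => e e0.
set V := fun w => (a * delta + b * TI omega w) + (a' + b' * omega (X delta w)).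
(* [t] balances the two terms of [exp V <= t / 2 * exp (2 V) + 1 / (2 t)]. *)
pose t := e / C; have t0 : 0 < t by rewrite divr_gt0.
have et0 : 0 < e * t by rewrite mulr_gt0.
have [M near_esc] := containment filtF markovX delta_gt0 x0 et0.
pose fM x := f x * cutoff M x; pose gM x := g x * cutoff M x.
have rf := cutoff_regular M cf; have rg := cutoff_regular M cg.
exists (fun x => mean (P x) (fun w => expR (TI fM w + gM (X delta w)))).
  exact: (bounded_reward_continuous filtF markovX delta_gt0 rf rg).
have cutM (h : E -> R) c c' x : `|h x| <= c + c' * omega x ->
    `|h x * cutoff M x| <= c + c' * omega x.
  move=> hx; rewrite normrM; have /andP[k0 k1] := cutoff_bounds M x.
  by rewrite (ger0_norm k0) (le_trans _ hx)// ler_piMr.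
have cfM : continuous fM by case: rf.
have cgM : continuous gM by case: rg.
have YV w : `|TI f w + g (X delta w)| <= V w by exact: reward_norm_le.
have YMV w : `|TI fM w + gM (X delta w)| <= V w.
  by apply: reward_norm_le => // x; exact: cutM.
have mT (h : E -> R) : continuous h -> measurable_fun setT (TI h).
  exact: (time_integral_measurable filtF markovX delta_gt0).
have mX (h : E -> R) : continuous h -> measurable_fun setT (fun w => h (X delta w)).
  by move=> ch; exact: meas_gX.
have mV : measurable_fun setT V.
  apply: measurable_funD; apply: measurable_funD => //; apply: measurable_funM => //.
    exact: mT.
  exact: mX.
have iexp x (Y : Omega -> R) : measurable_fun setT Y -> (forall w, `|Y w| <= V w) ->
    itg (P x) (fun w => expR (2 * V w)) -> itg (P x) (fun w => expR (Y w)).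
  move=> mY YV' iV; apply: itg_le iV; first exact: measurable_expR_comp.
  move=> w; rewrite ger0_norm ?expR_ge0// ler_expR.
  have := YV' w; have := ler_norm (Y w); have := normr_ge0 (Y w); lra.
near=> x.
have [iV mVC] : itg (P x) (fun w => expR (2 * V w)) /\
  mean (P x) (fun w => expR (2 * V w)) <= C by near: x.
have pesc : mean (P x) (\1_(escape X delta M) : Omega -> R) <= e * t by near: x.
have i1 : itg (P x) (fun w => expR (TI f w + g (X delta w))).
  by apply: iexp => //; apply: measurable_funD; [exact: mT|exact: mX].
have i2 : itg (P x) (fun w => expR (TI fM w + gM (X delta w))).
  by apply: iexp => //; apply: measurable_funD; [exact: mT|exact: mX].
have iI : itg (P x) (\1_(escape X delta M) : Omega -> R).
  by apply: itg_indic; exact: (escape_measurable filtF markovX delta_gt0).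
rewrite -meanB//; apply: (le_trans (mean_norm (itgB i1 i2))).
apply: (@le_trans _ _ (mean (P x) (fun w => t / 2 * expR (2 * V w) +
    (2 * t)^-1 * \1_(escape X delta M) w))).
  apply: mean_le; [exact/itg_norm/itgB|by apply: itgD; exact: itgZ|].
  move=> w; have [we|we] := pselect (escape X delta M w); last first.
    have inM s : 0 <= s <= delta -> cutoff M (X s w) = 1.
      by move=> sd; apply: cutoff_one; exact: (not_escape markovX delta_gt0 we).
    have -> : TI fM w = TI f w.
      apply/eqP; rewrite eq_le; apply/andP; split;
        by apply: (time_integral_le markovX delta_gt0) => // s sd; rewrite /fM inM// mulr1.
    have -> : gM (X delta w) = g (X delta w) by rewrite /gM inM ?mulr1// d0 lexx.
    rewrite subrr normr0 addr_ge0//.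
      by rewrite mulr_ge0 ?expR_ge0// divr_ge0// ltW.
    have i0 : 0 <= \1_(escape X delta M) w :> R by rewrite indicE ler0n.
    by rewrite mulr_ge0// invr_ge0 mulr_ge0// ltW.
  rewrite indicE mem_set//= mulr1.
  apply: (@le_trans _ _ (expR (V w))).
    have h1 : expR (TI f w + g (X delta w)) <= expR (V w).
      by rewrite ler_expR (le_trans (ler_norm _)).
    have h2 : expR (TI fM w + gM (X delta w)) <= expR (V w).
      by rewrite ler_expR (le_trans (ler_norm _)).
    have h3 := expR_gt0 (TI f w + g (X delta w)).
    have h4 := expR_gt0 (TI fM w + gM (X delta w)).
    by rewrite ler_norml; apply/andP; split; lra.
  set v := expR (V w).
  have -> : expR (2 * V w) = v * v by rewrite -expRD; congr expR; ring.
  have -> : t / 2 * (v * v) + (2 * t)^-1 = v + (2 * t)^-1 * (t * v - 1) ^+ 2.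
    by field; rewrite gt_eqF.
  by rewrite lerDl mulr_ge0 ?sqr_ge0// invr_ge0 mulr_ge0// ltW.
rewrite meanD ?meanZ//; [|exact: itgZ|exact: itgZ].
have h1 : t / 2 * mean (P x) (fun w => expR (2 * V w)) <= t / 2 * C.
  by rewrite ler_pM2l// divr_gt0.
have h2 : (2 * t)^-1 * mean (P x) (\1_(escape X delta M) : Omega -> R) <= (2 * t)^-1 * (e * t).
  by rewrite ler_pM2l// invr_gt0 mulr_gt0.
have h3 : t / 2 * C = e / 2 by rewrite /t; field; rewrite gt_eqF.
have h4 : (2 * t)^-1 * (e * t) = e / 2 by field; rewrite gt_eqF.
rewrite [leRHS](_ : _ = t / 2 * C + (2 * t)^-1 * (e * t)); last by rewrite h3 h4; field.
exact: lerD.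
Unshelve. all: by end_near.
Qed.

End RewardContinuity.

(** * Entropic utilities as exponential moments *)

Section EntropicUtility.
Context {R : realType} {disp : measure_display} {Omega : measurableType disp}.
Variable Q : probability Omega R.

(** An upper bound on the utility, for [g > 0], rules out an infinite exponential
    moment. *)
Lemma entropic_upper (g a : R) (Z : Omega -> R) : 0 < g -> measurable_fun setT Z ->
  (entropic_utility Q g Z <= a%:E)%E ->
  itg Q (fun w => expR (g * Z w)) /\ mean Q (fun w => expR (g * Z w)) <= expR (g * a).
Proof.
move=> g0 mZ; rewrite /entropic_utility gt_eqF// unlock => h.
have mE : measurable_fun setT (fun w => expR (g * Z w)).
  by apply: measurable_expR_comp; exact: measurable_funM.
have e0 : (0 <= \int[Q]_w (expR (g * Z w))%:E)%E.
  by apply: integral_ge0 => w _; rewrite lee_fin expR_ge0.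
have key : (\int[Q]_w (expR (g * Z w))%:E <= (expR (g * a))%:E)%E.
  move: e0 h; case: (\int[Q]_w _)%E => [r r0| |] //=.
    rewrite !lee_fin in r0 *; case: ifPn => [r0' _|].
      by rewrite (le_trans r0')// expR_ge0.
    rewrite -ltNge => r0'; rewrite -EFinM lee_fin ler_pdivrMl// => h.
    by rewrite -[leLHS]lnK ?posrE// ler_expR.
  by rewrite gt0_muley ?lte_fin ?invr_gt0.
have iE : itg Q (fun w => expR (g * Z w)).
  apply/integrableP; split; first exact/measurable_EFinP.
  under eq_integral do rewrite /= ger0_norm ?expR_ge0//.
  by rewrite (le_lt_trans key) ?ltry.
split=> //; rewrite -lee_fin /Rintegral fineK//.
exact: integrable_fin_num.
Qed.

Lemma entropic_fin (g : R) (Z : Omega -> R) : g != 0 ->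
  itg Q (fun w => expR (g * Z w)) -> 0 < mean Q (fun w => expR (g * Z w)) ->
  entropic_utility Q g Z = (g^-1 * ln (mean Q (fun w => expR (g * Z w))))%:E.
Proof.
move=> g0 iE m0; rewrite /entropic_utility (negbTE g0) unlock.
have efin : (\int[Q]_w (expR (g * Z w))%:E)%E \is a fin_num by exact: integrable_fin_num.
by rewrite -(fineK efin) lne_EFin.
Qed.

End EntropicUtility.

(** * The risk-sensitive one-step operator *)

Section OneStep.
Context {R : realType} {d : nat} {disp : measure_display}
  {Omega : measurableType disp}.
Local Notation E := 'rV[R]_d.
Variables (P : E -> probability Omega R) (F : R -> set (set Omega))
  (X : R -> Omega -> E) (delta : R) (omega f : E -> R) (gamma b1 C : R)
  (M1 M2 : R -> R).
Hypotheses (filtF : filtration F) (markovX : feller_markov P F X)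
  (delta_gt0 : 0 < delta) (omega_cont : continuous omega)
  (omega_ge0 : forall x, 0 <= omega x)
  (f_cont : continuous f) (C_gt0 : 0 < C)
  (f_growth : forall x, `|f x| <= C * (1 + omega x))
  (gamma_lt0 : gamma < 0) (b1_gt0 : 0 < b1).
Hypothesis moment_integral : forall (g : R) x,
  (entropic_utility (P x) g (time_integral X delta omega) <= (omega x + M1 g)%:E)%E.
Hypothesis moment_terminal : forall (g : R) x,
  (entropic_utility (P x) g (fun a => omega (X delta a)) <= (b1 * omega x + M2 g)%:E)%E.

Local Notation TI := (time_integral X delta).
Local Notation J := (time_integral X delta omega).
Local Notation W := (fun a : Omega => omega (X delta a)).
Let delta_ge0 : 0 <= delta := ltW delta_gt0.

Lemma measurable_terminal (w : E -> R) : continuous w ->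
  measurable_fun setT (fun a => w (X delta a)).
Proof. by move=> cw; exact: (process_comp_measurable filtF markovX). Qed.

Lemma measurable_reward (w : E -> R) : continuous w -> measurable_fun setT (TI w).
Proof. exact: (time_integral_measurable filtF markovX delta_gt0). Qed.

Lemma J_ge0 a : 0 <= J a.
Proof. exact: time_integral_ge0. Qed.

(** The slopes in [omega] are exact; all the loss goes into the constant. *)
Lemma exp_moments p q : 0 < p -> 0 < q -> exists2 M, 0 <= M &
  forall c (Z : Omega -> R) x, measurable_fun setT Z ->
    (forall a, Z a <= c + p * J a + q * W a) ->
    itg (P x) (fun a => expR (Z a)) /\
    mean (P x) (fun a => expR (Z a)) <= expR (c + (p + q * b1) * omega x + M).
Proof.
move=> p0 q0; exists (`|p * M1 (2 * p)| + `|q * M2 (2 * q)|); first exact: addr_ge0.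
move=> c Z x mZ Zle.
have mJ := measurable_reward omega_cont; have mW := measurable_terminal omega_cont.
have p20 : 0 < 2 * p by rewrite mulr_gt0.
have q20 : 0 < 2 * q by rewrite mulr_gt0.
have [iJ hJ] := entropic_upper p20 mJ (moment_integral (2 * p) x).
have [iW hW] := entropic_upper q20 mW (moment_terminal (2 * q) x).
have dbl (r : R) (Y : Omega -> R) :
    (fun a => expR (2 * (r * Y a))) = (fun a => expR (2 * r * Y a)).
  by apply/funext => a; rewrite mulrA.
have mpJ : measurable_fun setT (fun a => p * J a) by exact: measurable_funM.
have mqW : measurable_fun setT (fun a => q * W a) by exact: measurable_funM.
have [iJW hJW] : itg (P x) (fun a => expR (p * J a + q * W a)) /\
    mean (P x) (fun a => expR (p * J a + q * W a)) <=
      expR (p * (omega x + M1 (2 * p)) + q * (b1 * omega x + M2 (2 * q))).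
  by apply: holder_expR => //; rewrite dbl// mulrA.
have iE := itgZ (expR c) iJW.
have ZE a : expR (Z a) <= expR c * expR (p * J a + q * W a).
  by rewrite -expRD ler_expR addrA.
have iZ : itg (P x) (fun a => expR (Z a)).
  apply: itg_le iE; first exact: measurable_expR_comp.
  by move=> a; rewrite ger0_norm ?expR_ge0.
split=> //; apply: (le_trans (mean_le iZ iE ZE)); rewrite meanZ//.
apply: (@le_trans _ _ (expR c *
    expR (p * (omega x + M1 (2 * p)) + q * (b1 * omega x + M2 (2 * q))))).
  by rewrite ler_pM2l ?expR_gt0.
rewrite -expRD ler_expR.
have := ler_norm (p * M1 (2 * p)); have := ler_norm (q * M2 (2 * q)); lra.
Qed.

Lemma first_moments : exists2 M, 0 <= M & forall x,
  [/\ itg (P x) J, itg (P x) W, mean (P x) J <= omega x + M &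
      mean (P x) W <= b1 * omega x + M].
Proof.
exists (`|M1 1| + `|M2 1|); first exact: addr_ge0.
move=> x.
have mJ := measurable_reward omega_cont; have mW := measurable_terminal omega_cont.
have [iJ hJ] := entropic_upper ltr01 mJ (moment_integral 1 x).
have [iW hW] := entropic_upper ltr01 mW (moment_terminal 1 x).
have one (Y : Omega -> R) : (fun a => expR (1 * Y a)) = (fun a => expR (Y a)).
  by apply/funext => a; rewrite mul1r.
rewrite one in iJ; rewrite one in hJ; rewrite one in iW; rewrite one in hW.
rewrite mul1r in hJ; rewrite mul1r in hW.
have le_exp (Y : Omega -> R) : (forall a, 0 <= Y a) -> forall a, `|Y a| <= expR (Y a).
  by move=> Y0 a; rewrite ger0_norm//; apply: le_trans (expR_ge1Dx _); rewrite lerDr.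
have itJ : itg (P x) J by apply: itg_le iJ => //; exact: le_exp J_ge0.
have itW : itg (P x) W by apply: itg_le iW => //; exact: (@le_exp W).
split=> //.
  by apply: (le_trans (mean_le_expR itJ iJ hJ)); rewrite lerD2l (le_trans (ler_norm _))// lerDl.
by apply: (le_trans (mean_le_expR itW iW hW)); rewrite lerD2l (le_trans (ler_norm _))// lerDr.
Qed.

Definition growth (K : R) (w : E -> R) : Prop :=
  continuous w /\ forall x, `|w x| <= K * (1 + omega x).

Definition total (w : E -> R) (a : Omega) : R := TI f a + w (X delta a).

Definition gen (w : E -> R) (x : E) : R :=
  mean (P x) (fun a => expR (gamma * total w a)).

Definition Rop (w : E -> R) (x : E) : R := gamma^-1 * ln (gen w x).

Lemma total_measurable w : continuous w -> measurable_fun setT (total w).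
Proof.
by move=> cw; apply: measurable_funD; [exact: measurable_reward|exact: measurable_terminal].
Qed.

Lemma reward_bound a : `|TI f a| <= C * delta + C * J a.
Proof.
apply: (time_integral_norm_le markovX delta_gt0) => // x.
by rewrite -[X in _ <= X + _]mulr1 -mulrDr.
Qed.

Lemma total_bound K w a : growth K w ->
  `|total w a| <= (C * delta + K) + C * J a + K * W a.
Proof.
move=> [_ wK]; apply: (le_trans (ler_normD _ _)).
have := reward_bound a; have := wK (X delta a); lra.
Qed.

Lemma gamma_total_bound K w a : growth K w ->
  `|gamma * total w a| <= (- gamma * (C * delta + K)) + (- gamma * C) * J a + (- gamma * K) * W a.
Proof.
move=> gw; rewrite normrM ltr0_norm//.
have h : - gamma * `|total w a| <= - gamma * ((C * delta + K) + C * J a + K * W a).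
  by rewrite ler_pM2l ?oppr_gt0//; exact: total_bound.
by apply: (le_trans h); rewrite le_eqVlt; apply/orP; left; apply/eqP; ring.
Qed.

Lemma mulNgamma_gt0 c : 0 < c -> 0 < - gamma * c.
Proof. by move=> c0; rewrite mulr_gt0// oppr_gt0. Qed.

Lemma gamma_total_measurable w : continuous w ->
  measurable_fun setT (fun a => gamma * total w a).
Proof. by move=> cw; apply: measurable_funM => //; exact: total_measurable. Qed.

Lemma gen_itg K w x : 0 < K -> growth K w ->
  itg (P x) (fun a => expR (gamma * total w a)).
Proof.
move=> K0 gw; have [M _ hM] := exp_moments (mulNgamma_gt0 C_gt0) (mulNgamma_gt0 K0).
have mY : measurable_fun setT (fun a => gamma * total w a).
  by apply: gamma_total_measurable; case: gw.
by have [] := hM _ _ x mY (fun a => le_trans (ler_norm _) (gamma_total_bound a gw)).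
Qed.

Lemma total_itg K w x : growth K w -> itg (P x) (total w).
Proof.
move=> gw; have [M _ /(_ x)[iJ iW _ _]] := first_moments.
apply: (@itg_le _ _ _ _ (fun a => (C * delta + K) + C * J a + K * W a)).
- by apply: total_measurable; case: gw.
- by move=> a; exact: total_bound.
- by apply: itgD; [apply: itgD; [exact: itg_cst|exact: itgZ]|exact: itgZ].
Qed.

Lemma gamma_total_itg K w x : growth K w -> itg (P x) (fun a => gamma * total w a).
Proof. by move=> gw; apply: itgZ; exact: total_itg gw. Qed.

Lemma jensen_gen K w x : 0 < K -> growth K w ->
  expR (gamma * mean (P x) (total w)) <= gen w x.
Proof.
move=> K0 gw; rewrite -meanZ; last exact: total_itg gw.
by apply: jensen_expR; [exact: gamma_total_itg gw|exact: gen_itg gw].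
Qed.

Lemma gen_gt0 K w x : 0 < K -> growth K w -> 0 < gen w x.
Proof. by move=> K0 gw; exact: lt_le_trans (expR_gt0 _) (jensen_gen x K0 gw). Qed.

Lemma genE K w x : 0 < K -> growth K w -> gen w x = expR (gamma * Rop w x).
Proof.
move=> K0 gw; rewrite /Rop mulrA divff ?lt_eqF// mul1r lnK// posrE.
exact: gen_gt0 gw.
Qed.

Lemma le_Rop K w x c : 0 < K -> growth K w -> gen w x <= expR (gamma * c) -> c <= Rop w x.
Proof. by move=> K0 gw; rewrite (genE x K0 gw) ler_expR ler_nM2l. Qed.

Lemma Rop_le K w x c : 0 < K -> growth K w -> expR (gamma * c) <= gen w x -> Rop w x <= c.
Proof. by move=> K0 gw; rewrite (genE x K0 gw) ler_expR ler_nM2l. Qed.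

Lemma Rop_le_mean K w x : 0 < K -> growth K w -> Rop w x <= mean (P x) (total w).
Proof. by move=> K0 gw; apply: (Rop_le K0 gw); exact: jensen_gen gw. Qed.

Lemma Rop_entropic K w x : 0 < K -> growth K w ->
  entropic_utility (P x) gamma (fun a => TI f a + w (X delta a)) = (Rop w x)%:E.
Proof.
move=> K0 gw; apply: entropic_fin; first by rewrite lt_eqF.
  exact: gen_itg gw.
exact: gen_gt0 gw.
Qed.

Lemma Rop_addc K K' w x k : 0 < K -> growth K w -> 0 < K' -> growth K' (fun y => w y + k) ->
  Rop (fun y => w y + k) x = Rop w x + k.
Proof.
move=> K0 gw K'0 gwk.
have e : gen (fun y => w y + k) x = expR (gamma * (Rop w x + k)).
  rewrite mulrDr expRD -(genE x K0 gw) mulrC -meanZ; last exact: gen_itg gw.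
  by congr fine; apply: eq_integral => a _; rewrite -expRD /total; congr (expR _)%:E; ring.
apply/eqP; rewrite eq_le; apply/andP; split.
  by apply: (Rop_le K'0 gwk); rewrite e.
by apply: (le_Rop K'0 gwk); rewrite e.
Qed.

Lemma Rop_upper L : 0 < L -> exists2 m, 0 <= m & forall K w k x, 0 < K -> growth K w ->
  (forall y, w y <= L * omega y + k) -> Rop w x <= (C + L * b1) * omega x + k + m.
Proof.
move=> L0; have [M M0 hM] := first_moments.
exists (C * delta + C * M + L * M).
  by rewrite !addr_ge0 ?mulr_ge0// ltW.
move=> K w k x K0 gw wL; apply: (le_trans (Rop_le_mean x K0 gw)).
have [iJ iW hJ hW] := hM x.
have iB : itg (P x) (fun a => (C * delta + k) + C * J a + L * W a).
  by apply: itgD; [apply: itgD; [exact: itg_cst|exact: itgZ]|exact: itgZ].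
apply: (@le_trans _ _ (mean (P x) (fun a => (C * delta + k) + C * J a + L * W a))).
  apply: mean_le => //; first exact: total_itg gw.
  move=> a; have := wL (X delta a); have := ler_norm (TI f a); have := reward_bound a.
  by rewrite /total; lra.
rewrite meanD; [|apply: itgD; [exact: itg_cst|exact: itgZ]|exact: itgZ].
rewrite meanD; [|exact: itg_cst|exact: itgZ].
rewrite mean_cst !meanZ//.
have h1 := ler_wpM2l (ltW C_gt0) hJ.
have h2 := ler_wpM2l (ltW L0) hW.
apply: (le_trans (lerD (lerD (lexx _) h1) h2)).
by rewrite le_eqVlt; apply/orP; left; apply/eqP; ring.
Qed.

(** No Jensen inequality goes this way: the bound needs exponential moments. *)
Lemma Rop_lower L : 0 < L -> exists2 m, 0 <= m & forall K w k x, 0 < K -> growth K w ->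
  (forall y, - (L * omega y + k) <= w y) -> - ((C + L * b1) * omega x + k + m) <= Rop w x.
Proof.
move=> L0; have [M M0 hM] := exp_moments (mulNgamma_gt0 C_gt0) (mulNgamma_gt0 L0).
have g0 : 0 < - gamma by rewrite oppr_gt0.
exists (C * delta + M / - gamma).
  by rewrite addr_ge0// ?divr_ge0 ?mulr_ge0// ltW.
move=> K w k x K0 gw wL; apply: (le_Rop K0 gw).
have [||_ h] := hM (- gamma * (C * delta + k)) (fun a => gamma * total w a) x.
- by apply: gamma_total_measurable; case: gw.
- move=> a; have h1 := wL (X delta a); have h2 := reward_bound a.
  have h3 : - total w a <= (C * delta + k) + C * J a + L * W a.
    by move: h2; rewrite ler_norml /total => /andP[]; lra.
  have := ler_wpM2l (ltW g0) h3; rewrite mulrNN => /le_trans; apply.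
  by rewrite le_eqVlt; apply/orP; left; apply/eqP; ring.
apply: (le_trans h); rewrite ler_expR le_eqVlt; apply/orP; left; apply/eqP.
by field; rewrite lt_eqF.
Qed.

(** The risk parameter is absorbed into the reward and the continuation value. *)
Lemma gen_continuous K w : 0 < K -> growth K w -> continuous (gen w).
Proof.
move=> K0 gw x0; have cw : continuous w by case: gw.
have -> : gen w = fun x => mean (P x) (fun a =>
    expR (TI (fun y => 0 + gamma * f y) a + (0 + gamma * w (X delta a)))).
  apply/funext => x; congr fine; apply: eq_integral => a _.
  by rewrite (time_integral_affine markovX delta_gt0)// /total; congr (expR _)%:E; ring.
have fb x : `|0 + gamma * f x| <= (- gamma * C) + (- gamma * C) * omega x.
  rewrite add0r normrM ltr0_norm//.
  have := f_growth x; rewrite -(ler_pM2l (_ : 0 < - gamma)) ?oppr_gt0//.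
  by move=> /le_trans; apply; rewrite le_eqVlt; apply/orP; left; apply/eqP; ring.
have wb x : `|0 + gamma * w x| <= (- gamma * K) + (- gamma * K) * omega x.
  rewrite add0r normrM ltr0_norm//.
  have := gw.2 x; rewrite -(ler_pM2l (_ : 0 < - gamma)) ?oppr_gt0//.
  by move=> /le_trans; apply; rewrite le_eqVlt; apply/orP; left; apply/eqP; ring.
have p0 : 0 < 2 * (- gamma * C) by rewrite mulr_gt0// mulNgamma_gt0.
have q0 : 0 < 2 * (- gamma * K) by rewrite mulr_gt0// mulNgamma_gt0.
have [M M0 hM] := exp_moments p0 q0.
pose c := 2 * (- gamma * C * delta + - gamma * K).
pose S := expR (c + (2 * (- gamma * C) + 2 * (- gamma * K) * b1) * (omega x0 + 1) + M).
have near_om : \forall x \near x0, omega x <= omega x0 + 1.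
  have ch : {for x0, continuous (fun x => (omega x0 + 1) + -1 * omega x)}.
    by apply: continuous_affine.
  have h0 : 0 < omega x0 + 1 + -1 * omega x0 by lra.
  by apply: filterS (near_gt ch h0) => x; lra.
apply: (@reward_continuous _ _ _ _ P F X delta filtF markovX delta_gt0 omega
  (fun y => 0 + gamma * f y) (fun y => 0 + gamma * w y) _ _ _ _ x0 S omega_cont _ _ fb wb).
- exact: continuous_affine.
- exact: continuous_affine.
- exact: expR_gt0.
apply: filterS near_om => x hx.
have [||i h] := hM c (fun a => 2 * ((- gamma * C * delta + - gamma * C * J a) +
  (- gamma * K + - gamma * K * W a))) x.
- apply: measurable_funM => //; apply: measurable_funD; apply: measurable_funD => //.
    by apply: measurable_funM => //; exact: measurable_reward.
  by apply: measurable_funM => //; exact: measurable_terminal.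
- by move=> a; rewrite /c le_eqVlt; apply/orP; left; apply/eqP; ring.
split=> //; apply: (le_trans h); rewrite ler_expR lerD2r lerD2l ler_wpM2l//.
by rewrite addr_ge0 ?mulr_ge0 ?oppr_ge0// ltW.
Qed.

Lemma Rop_continuous K w : 0 < K -> growth K w -> continuous (Rop w).
Proof.
move=> K0 gw x; rewrite /Rop.
have cl : {for x, continuous (fun x => ln (gen w x))}.
  apply: continuous_comp; first exact: (gen_continuous K0 gw).
  by apply: continuous_ln; exact: gen_gt0 gw.
apply: (@continuousM _ _ (fun=> gamma^-1) (fun x => ln (gen w x))) => //.
exact: cst_continuous.
Qed.

Variable U : set E.
Hypotheses (b1_lt1 : b1 < 1) (U_borel : measurable (U : set (borel_space R d))).
Hypothesis minorised : forall r : R, 0 < r -> exists2 a : R, 0 < a &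
  exists2 nu : probability (borel_space R d) R, (0 < nu U)%E &
  forall B : set (borel_space R d), measurable B -> forall x, omega x <= r ->
    a * fine (nu B) <= mean (P x) (\1_(X delta @^-1` B) : Omega -> R).

Lemma terminal_event (B : set (borel_space R d)) :
  measurable B -> measurable (X delta @^-1` B).
Proof. by move=> mB; exact: (preimage_measurable filtF markovX). Qed.

(** Since [gamma < 0], small values of the payoff dominate the utility: from a
    bounded region the process reaches [U], where [w] is small, with a
    probability bounded below. *)
Lemma Rop_local r : exists kappa, forall K w x, 0 < K -> growth K w ->
  (forall xi, U xi -> w xi <= 0) -> omega x <= r -> Rop w x <= kappa.
Proof.
have r10 : 0 < `|r| + 1 by rewrite ltr_wpDl.
have [a a0 [nu nuU hnu]] := minorised r10.
have [M M0 hM] := first_moments.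
have g0 : 0 < - gamma by rewrite oppr_gt0.
pose p := a * fine (nu U).
have p0 : 0 < p.
  by rewrite mulr_gt0// fine_gt0// nuU/= (le_lt_trans (probability_le1 _ _)) ?ltry.
pose m := - gamma * (C * delta + C * (`|r| + 1 + M)).
exists (gamma^-1 * (ln p - m / p)) => K w x K0 gw wU xr.
have xr1 : omega x <= `|r| + 1.
  by rewrite (le_trans xr)// (le_trans (ler_norm _))// lerDl.
apply: (Rop_le K0 gw); rewrite mulrA divff ?lt_eqF// mul1r expRD lnK ?posrE//.
pose Yv a0 := - gamma * (C * delta + C * J a0).
have [iJ _ hJ _] := hM x.
have iY : itg (P x) Yv by apply: itgZ; apply: itgD; [exact: itg_cst|exact: itgZ].
have Y0 a' : 0 <= Yv a'.
  by rewrite mulr_ge0 ?(ltW g0)// addr_ge0// mulr_ge0 ?(ltW C_gt0)//; exact: J_ge0.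
have mA := terminal_event U_borel.
have ieY : itg (P x) (fun a' => expR (- Yv a')).
  apply: (@itg_bounded _ _ _ _ _ 1).
    by apply: measurable_expR_comp; apply: measurableT_comp => //; exact: itg_measurable iY.
  by move=> a'; rewrite ger0_norm ?expR_ge0// -expR0 ler_expR oppr_le0.
have Ym : mean (P x) Yv <= m.
  rewrite meanZ; last by apply: itgD; [exact: itg_cst|exact: itgZ].
  rewrite meanD ?mean_cst ?meanZ//; [|exact: itg_cst|exact: itgZ].
  by rewrite /m ler_pM2l// lerD2l ler_pM2l// (le_trans hJ)// lerD2r.
apply: (le_trans (mean_expR_minor mA iY ieY Y0 Ym p0 (hnu U U_borel x xr1))).
apply: mean_le; [|exact: gen_itg gw|].
  apply: (itgM_bounded (a := 1)); last exact: ieY.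
      exact: measurable_indic.
    by move=> a'; exact: indic_norm_le1.
move=> a'; rewrite indicE; have [wA|_] := boolP (_ \in _); last by rewrite mul0r expR_ge0.
rewrite mul1r ler_expR; move: wA; rewrite inE => /wU wX.
have := reward_bound a'; rewrite ler_norml => /andP[_ h].
have : - gamma * total w a' <= - gamma * (C * delta + C * J a').
  by rewrite ler_pM2l// /total; lra.
rewrite -/(Yv a'); lra.
Qed.

(** Expectation of [phi] at the terminal time under the law whose density is
    proportional to [exp (gamma * total w)]. *)
Definition tilted (w : E -> R) (x : E) (phi : E -> R) : R :=
  mean (P x) (fun a => expR (gamma * total w a) * phi (X delta a)) / gen w x.

Definition observable (K : R) (phi : E -> R) : Prop :=
  measurable_fun setT (phi : borel_space R d -> R) /\
  forall y, `|phi y| <= K * (1 + omega y).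

Lemma observable_indic (B : set (borel_space R d)) :
  measurable B -> observable 1 \1_B.
Proof.
move=> mB; split; first exact: measurable_indic.
by move=> y; rewrite mul1r (le_trans (indic_norm_le1 _ _))// lerDl.
Qed.

Lemma observable_omega : observable 1 omega.
Proof.
split; first exact: continuous_borel.
by move=> y; rewrite mul1r ger0_norm// lerDr.
Qed.

Lemma observable_measurable K phi : observable K phi ->
  measurable_fun setT (fun a => phi (X delta a)).
Proof.
move=> [mphi _].
exact: (measurableT_comp mphi (process_measurable filtF markovX delta_ge0)).
Qed.

Lemma tilted_itg K w K' phi x : 0 < K -> growth K w -> observable K' phi ->
  itg (P x) (fun a => expR (gamma * total w a) * phi (X delta a)).
Proof.
move=> K0 gw ophi; have [_ phiK] := ophi.
have cw : continuous w by case: gw.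
have mY := gamma_total_measurable cw.
have K'0 : 0 <= K'.
  have o1 : 0 < 1 + omega 0 by rewrite ltr_wpDr.
  by rewrite -(pmulr_lge0 _ o1) (le_trans _ (phiK 0)).
have q0 : 0 < - gamma * K + 1 by rewrite addr_gt0// mulNgamma_gt0.
have [M _ hM] := exp_moments (mulNgamma_gt0 C_gt0) q0.
have mW := measurable_terminal omega_cont.
have [iE _] : itg (P x) (fun a => expR (gamma * total w a + W a)) /\
    mean (P x) (fun a => expR (gamma * total w a + W a)) <=
    expR (- gamma * (C * delta + K) + (- gamma * C + (- gamma * K + 1) * b1) * omega x + M).
  apply: hM; first exact: measurable_funD.
  by move=> a; have := gamma_total_bound a gw => /(le_trans (ler_norm _)); lra.
apply: (@itg_le _ _ _ _ (fun a => K' * expR (gamma * total w a + W a))); last exact: itgZ.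
  apply: measurable_funM; first exact: measurable_expR_comp.
  exact: observable_measurable ophi.
move=> a; rewrite normrM ger0_norm ?expR_ge0// expRD mulrCA.
rewrite ler_pM2l ?expR_gt0//; apply: (le_trans (phiK _)).
by rewrite ler_wpM2l// expR_ge1Dx.
Qed.

(** All estimates of tilted means below compare the observable with a
    combination of a constant, an indicator and [omega]. *)
Lemma tilted_le_comb K w x K' phi (B : set (borel_space R d)) c0 c1 c2 :
  0 < K -> growth K w -> observable K' phi -> measurable B ->
  (forall y, phi y <= c0 + c1 * \1_B y + c2 * omega y) ->
  tilted w x phi <= c0 + c1 * tilted w x \1_B + c2 * tilted w x omega.
Proof.
move=> K0 gw ophi mB phile; have G0 := gen_gt0 x K0 gw.
have oB := observable_indic mB.
have oW := observable_omega.
have iphi := tilted_itg x K0 gw ophi.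
have iB := tilted_itg x K0 gw oB.
have iW := tilted_itg x K0 gw oW.
have iG := gen_itg x K0 gw.
rewrite /tilted ler_pdivrMr// !mulrDl -!mulrA !mulVf ?gt_eqF// !mulr1.
rewrite -!meanZ// -meanD//; [|exact: itgZ|exact: itgZ].
rewrite -meanD//; [|by apply: itgD; exact: itgZ|exact: itgZ].
apply: mean_le => //.
  by apply: itgD; [apply: itgD; exact: itgZ|exact: itgZ].
move=> a; have := phile (X delta a).
rewrite -(ler_pM2l (expR_gt0 (gamma * total w a))) => /le_trans; apply.
by rewrite le_eqVlt; apply/orP; left; apply/eqP; ring.
Qed.

Lemma tilted_indic_setC K w x (B : set (borel_space R d)) : 0 < K -> growth K w ->
  measurable B -> tilted w x \1_B <= 1 - tilted w x \1_(~` B).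
Proof.
move=> K0 gw mB; have oB := observable_indic mB.
have := @tilted_le_comb K w x 1 \1_B (~` B) 1 (-1) 0 K0 gw oB (measurableC mB).
rewrite mulN1r mul0r addr0; apply => y.
by rewrite mulN1r mul0r addr0 !indicE in_setC; case: (_ \in _) => /=; lra.
Qed.

Lemma tilted_indic_ge0 K w x (B : set (borel_space R d)) : 0 < K -> growth K w ->
  0 <= tilted w x \1_B.
Proof.
move=> K0 gw; rewrite /tilted divr_ge0 ?(ltW (gen_gt0 x K0 gw))//.
by apply: mean_ge0 => a; rewrite mulr_ge0 ?expR_ge0// indicE ler0n.
Qed.

(** Gibbs' inequality: the derivative of the utility is the tilted mean, and
    the utility is concave. *)
Lemma Rop_sub_le K w w' x : 0 < K -> growth K w -> growth K w' ->
  Rop w' x - Rop w x <= tilted w x (fun y => w' y - w y).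
Proof.
move=> K0 gw gw'; have G0 := gen_gt0 x K0 gw.
have ophi : observable (K + K) (fun y => w' y - w y).
  split.
    by apply: measurable_funB; apply: continuous_borel; [case: gw'|case: gw].
  by move=> y; rewrite mulrDl (le_trans (ler_normB _ _))// lerD//; [case: gw'|case: gw].
have iphi := tilted_itg x K0 gw ophi.
set m := tilted _ _ _; suff h : expR (gamma * (Rop w x + m)) <= gen w' x.
  by have := Rop_le K0 gw' h; lra.
rewrite mulrDr expRD -(genE x K0 gw) mulrC.
have iG := gen_itg x K0 gw.
have mE : m * gen w x = mean (P x) (fun a => expR (gamma * total w a) * (w' (X delta a) - w (X delta a))).
  by rewrite /m /tilted divfK// gt_eqF.
have -> : expR (gamma * m) * gen w x = mean (P x) (fun a => expR (gamma * m) *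
    ((1 - gamma * m) * expR (gamma * total w a) +
     gamma * (expR (gamma * total w a) * (w' (X delta a) - w (X delta a))))).
  rewrite meanZ; last by apply: itgD; exact: itgZ.
  rewrite meanD; [|exact: itgZ|exact: itgZ].
  by rewrite !meanZ// -mE -/(gen w x); ring.
apply: mean_le; [by apply: itgZ; apply: itgD; exact: itgZ|exact: gen_itg gw'|].
move=> a; set phi := w' _ - w _.
have -> : gamma * total w' a = gamma * m + (gamma * total w a + gamma * (phi - m)).
  by rewrite /phi /total; ring.
rewrite !expRD ler_pM2l ?expR_gt0//.
have -> : (1 - gamma * m) * expR (gamma * total w a) +
   gamma * (expR (gamma * total w a) * phi) = expR (gamma * total w a) * (1 + gamma * (phi - m)).
  by ring.
by rewrite ler_pM2l ?expR_gt0// expR_ge1Dx.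
Qed.

(** The entropy bound [p * E_Q omega <= ln (E e^{p omega + Z} / E e^Z)] loses
    only [O(1/p)] in the slope, and [p] may be taken large. *)
Lemma tilted_drift K : 0 < K -> exists b M, [/\ 0 < b < 1, 0 <= M &
  forall w x, growth K w -> tilted w x omega <= b * omega x + M].
Proof.
move=> K0; have g0 : 0 < - gamma by rewrite oppr_gt0.
have [M M0 hM] := first_moments.
have b1' : 0 < 1 - b1 by rewrite subr_gt0.
pose s := 2 * (- gamma) * (C + K * b1).
have s0 : 0 < s by rewrite mulr_gt0 ?mulr_gt0// addr_gt0// mulr_gt0.
(* [s / p] is the loss in the slope; it leaves the midpoint of [b1] and [1]. *)
have [p p0 pE] : exists2 p, 0 < p & b1 * p + s = (1 + b1) / 2 * p.
  exists (2 * s / (1 - b1)); first by rewrite divr_gt0// mulr_gt0.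
  by field; rewrite gt_eqF.
have q0 : 0 < - gamma * K + p by rewrite addr_gt0// mulNgamma_gt0.
have [N N0 hN] := exp_moments (mulNgamma_gt0 C_gt0) q0.
pose c := - gamma * (C * delta + K) + N + - gamma * (C * delta + K + C * M + K * M).
exists ((1 + b1) / 2), (c / p).
have c0 : 0 <= c.
  rewrite /c; apply: addr_ge0; [apply: addr_ge0 => //|];
    by rewrite mulr_ge0 ?(ltW g0)// !addr_ge0// ?mulr_ge0// ltW.
suff main_bound w x : growth K w -> tilted w x omega <= (1 + b1) / 2 * omega x + c / p.
  split; last exact: main_bound.
    rewrite divr_gt0 ?addr_gt0//= ltr_pdivrMr// mul1r.
    by rewrite (_ : 2 = 1 + 1)// ltrD2l.
  by rewrite divr_ge0// ltW.
move=> gw; have G0 := gen_gt0 x K0 gw.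
have cw : continuous w by case: gw.
have [iJ iW hJ hW] := hM x.
have oW := observable_omega.
have iT := tilted_itg x K0 gw oW.
have iG := gen_itg x K0 gw.
have mY : measurable_fun setT (fun a => gamma * total w a + p * W a).
  apply: measurable_funD; first exact: gamma_total_measurable.
  by apply: measurable_funM => //; exact: measurable_terminal.
have [iE hE] : itg (P x) (fun a => expR (gamma * total w a + p * W a)) /\
    mean (P x) (fun a => expR (gamma * total w a + p * W a)) <=
    expR (- gamma * (C * delta + K) + (- gamma * C + (- gamma * K + p) * b1) * omega x + N).
  apply: hN => // a; have /(le_trans (ler_norm _)) h := gamma_total_bound a gw.
  by apply: (le_trans (lerD h (lexx _))); rewrite le_eqVlt; apply/orP; left; apply/eqP => /=; ring.
set A := _ + N in hE.
pose B := - gamma * (C * delta + K + C * M + K * M + (C + K * b1) * omega x).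
have hG : expR (- B) <= gen w x.
  apply: (le_trans _ (jensen_gen x K0 gw)); rewrite ler_expR.
  have hm : mean (P x) (total w) <= C * delta + K + C * M + K * M + (C + K * b1) * omega x.
    have iB : itg (P x) (fun a => (C * delta + K) + C * J a + K * W a).
      by apply: itgD; [apply: itgD; [exact: itg_cst|exact: itgZ]|exact: itgZ].
    apply: (@le_trans _ _ (mean (P x) (fun a => (C * delta + K) + C * J a + K * W a))).
      apply: mean_le => //; first exact: total_itg gw.
      by move=> a; apply: (le_trans (ler_norm _)); exact: total_bound.
    rewrite meanD; [|apply: itgD; [exact: itg_cst|exact: itgZ]|exact: itgZ].
    rewrite meanD; [|exact: itg_cst|exact: itgZ].
    rewrite mean_cst !meanZ//.
    have h1 := ler_wpM2l (ltW C_gt0) hJ; have h2 := ler_wpM2l (ltW K0) hW.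
    apply: (le_trans (lerD (lerD (lexx _) h1) h2)).
    by rewrite le_eqVlt; apply/orP; left; apply/eqP; ring.
  by have := ler_wpM2l (ltW g0) hm; rewrite -/B; lra.
have key : p * tilted w x omega <= A + B.
  rewrite /tilted mulrA ler_pdivrMr// -meanZ//.
  apply: (@le_trans _ _ (mean (P x) (fun a => expR (- (A + B)) * expR (gamma * total w a + p * W a) +
      (A + B - 1) * expR (gamma * total w a)))).
    apply: mean_le; [exact: itgZ|by apply: itgD; exact: itgZ|].
    move=> a; rewrite expRD mulrCA.
    have -> : expR (- (A + B)) * (expR (gamma * total w a) * expR (p * W a)) +
      (A + B - 1) * expR (gamma * total w a) = expR (gamma * total w a) *
      (expR (p * W a - (A + B)) + (A + B - 1)) by rewrite expRD; ring.
    rewrite ler_pM2l ?expR_gt0//.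
    by have := expR_ge1Dx (p * W a - (A + B)); lra.
  rewrite meanD ?meanZ//; [|exact: itgZ|exact: itgZ]; rewrite -/(gen w x).
  have h1 : expR (- (A + B)) * mean (P x) (fun a => expR (gamma * total w a + p * W a)) <= gen w x.
    apply: le_trans hG; have -> : expR (- B) = expR (- (A + B)) * expR A.
      by rewrite -expRD; congr expR; ring.
    by rewrite ler_pM2l ?expR_gt0.
  lra.
have -> : (1 + b1) / 2 * omega x + c / p = (A + B) / p.
  rewrite -[X in X + _ = _](mulfK (lt0r_neq0 p0)) -mulrDl; congr (_ / _).
  have -> : (1 + b1) / 2 * omega x * p = (b1 * p + s) * omega x.
    by rewrite pE mulrAC.
  by rewrite /A /B /c /s; ring.
by rewrite ler_pdivlMr// mulrC.
Qed.

(** From a bounded region the logarithm of the density has a bounded mean, so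
    Jensen's inequality conditioned on the terminal event keeps a positive
    fraction of the minorised mass, with the same [nu] for all [w]. *)
Lemma tilted_overlap K r : 0 < K -> 0 < r -> exists2 kappa, 0 < kappa &
  exists nu : probability (borel_space R d) R, forall w x (B : set (borel_space R d)),
    growth K w -> omega x <= r -> measurable B -> 2^-1 <= fine (nu B) ->
    kappa <= tilted w x \1_B.
Proof.
move=> K0 r0; have [a a0 [nu _ hnu]] := minorised r0.
have g0 : 0 < - gamma by rewrite oppr_gt0.
have [M M0 hM] := first_moments.
have [N N0 hN] := exp_moments (mulNgamma_gt0 C_gt0) (mulNgamma_gt0 K0).
pose p := a / 2; have p0 : 0 < p by rewrite divr_gt0.
pose m := - gamma * (C * delta + K + C * (r + M) + K * (b1 * r + M)).
pose D := expR (- gamma * (C * delta + K) + (- gamma * C + - gamma * K * b1) * r + N).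
exists (p * expR (- (m / p)) / D); first by rewrite divr_gt0 ?mulr_gt0 ?expR_gt0.
exists nu => w x B gw xr mB nuB.
have G0 := gen_gt0 x K0 gw.
have cw : continuous w by case: gw.
have oB := observable_indic mB.
have GD : gen w x <= D.
  have [_ h] := hN _ _ x (gamma_total_measurable cw)
    (fun a => le_trans (ler_norm _) (gamma_total_bound a gw)).
  apply: (le_trans h); rewrite ler_expR lerD2r lerD2l ler_wpM2l//.
  by rewrite addr_ge0 ?mulr_ge0// ltW.
have [iJ iW hJ hW] := hM x.
pose Yv a0 := - gamma * (C * delta + K + C * J a0 + K * W a0).
have iS : itg (P x) (fun a0 => C * delta + K + C * J a0 + K * W a0).
  by apply: itgD; [apply: itgD; [exact: itg_cst|exact: itgZ]|exact: itgZ].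
have iY : itg (P x) Yv by exact: itgZ.
have Y0 a' : 0 <= Yv a'.
  rewrite mulr_ge0 ?(ltW g0)// !addr_ge0// ?mulr_ge0 ?(ltW C_gt0) ?(ltW K0)//.
  exact: J_ge0.
have ieY : itg (P x) (fun a' => expR (- Yv a')).
  apply: (@itg_bounded _ _ _ _ _ 1).
    by apply: measurable_expR_comp; apply: measurableT_comp => //; exact: itg_measurable iY.
  by move=> a'; rewrite ger0_norm ?expR_ge0// -expR0 ler_expR oppr_le0.
have Ym : mean (P x) Yv <= m.
  rewrite meanZ// /m ler_pM2l//.
  rewrite meanD; [|apply: itgD; [exact: itg_cst|exact: itgZ]|exact: itgZ].
  rewrite meanD; [|exact: itg_cst|exact: itgZ].
  rewrite mean_cst !meanZ//; apply: lerD; first rewrite lerD2l.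
    by rewrite ler_pM2l// (le_trans hJ)// lerD2r.
  by rewrite ler_pM2l// (le_trans hW)// lerD2r ler_pM2l.
have mA := terminal_event mB.
have pA : p <= mean (P x) (\1_(X delta @^-1` B) : Omega -> R).
  by apply: (le_trans _ (hnu B mB x xr)); rewrite ler_pM2l.
have low := mean_expR_minor mA iY ieY Y0 Ym p0 pA.
rewrite /tilted; apply: ler_pM.
- by rewrite mulr_ge0 ?expR_ge0// ltW.
- by rewrite invr_ge0 expR_ge0.
- apply: (le_trans low); apply: mean_le; [|exact: (tilted_itg x K0 gw oB)|].
    apply: (itgM_bounded (a := 1)); last exact: ieY.
      exact: measurable_indic.
    by move=> a'; exact: indic_norm_le1.
  move=> a'; rewrite mulrC; apply: ler_wpM2r; first by rewrite indicE ler0n.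
  rewrite ler_expR; have := gamma_total_bound a' gw.
  by rewrite ler_norml => /andP[+ _]; rewrite /Yv; lra.
- by rewrite lef_pV2 ?posrE ?expR_gt0.
Qed.

End OneStep.

(** * Local contraction in a weighted span seminorm *)

Section Contraction.
Context {R : realType} {d : nat}.
Local Notation E := 'rV[R]_d.
(** The argument uses the one-step operator and the tilted laws only through the
    following properties. *)
Variables (omega : E -> R) (Rop : (E -> R) -> E -> R)
  (tilted : (E -> R) -> E -> (E -> R) -> R).
Local Notation growth := (growth omega).
Local Notation observable := (observable omega).
Hypothesis omega_ge0 : forall x, 0 <= omega x.
Hypothesis Rop_sub_le : forall K w w' x, 0 < K -> growth K w -> growth K w' ->
  Rop w' x - Rop w x <= tilted w x (fun y => w' y - w y).
Hypothesis tilted_le_comb : forall K w x K' phi (B : set (borel_space R d)) c0 c1 c2,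
  0 < K -> growth K w -> observable K' phi -> measurable B ->
  (forall y, phi y <= c0 + c1 * \1_B y + c2 * omega y) ->
  tilted w x phi <= c0 + c1 * tilted w x \1_B + c2 * tilted w x omega.
Hypothesis tilted_indic_setC : forall K w x (B : set (borel_space R d)),
  0 < K -> growth K w -> measurable B -> tilted w x \1_B <= 1 - tilted w x \1_(~` B).
Hypothesis tilted_indic_ge0 : forall K w x (B : set (borel_space R d)),
  0 < K -> growth K w -> 0 <= tilted w x \1_B.
Hypothesis tilted_drift : forall K, 0 < K -> exists b M, [/\ 0 < b < 1, 0 <= M &
  forall w x, growth K w -> tilted w x omega <= b * omega x + M].
Hypothesis tilted_overlap : forall K r, 0 < K -> 0 < r -> exists2 kappa, 0 < kappa &
  exists nu : probability (borel_space R d) R, forall w x (B : set (borel_space R d)),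
    growth K w -> omega x <= r -> measurable B -> 2^-1 <= fine (nu B) ->
    kappa <= tilted w x \1_B.

Definition span_le (beta s : R) (phi : E -> R) : Prop :=
  forall x y, phi x - phi y <= s * (2 + beta * omega x + beta * omega y).

(** The weighted span seminorm is the distance to the constants in the weighted
    supremum norm. *)
Lemma span_center beta s phi : span_le beta s phi ->
  exists a, forall x, `|phi x - a| <= s * (1 + beta * omega x).
Proof.
move=> hs; pose S := [set phi x - s * (1 + beta * omega x) | x in [set: E]].
have ub y : ubound S (phi y + s * (1 + beta * omega y)).
  by move=> _ [x _ <-]; have := hs x y; lra.
have S0 : S !=set0 by exists (phi 0 - s * (1 + beta * omega 0)); exists 0.
exists (sup S) => x; rewrite ler_norml; apply/andP; split.
  by have := ge_sup S0 (ub x); lra.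
have hS : has_sup S by split => //; exists (phi 0 + s * (1 + beta * omega 0)); exact: ub.
have h : S (phi x - s * (1 + beta * omega x)) by exists x.
have := ub_le_sup hS.2 h; lra.
Qed.

(** Where [t], the sum of the two weights, is large the drift wins, elsewhere the
    overlap [kappa]; [beta] is so small that the additive constant of the drift
    does not spoil the gain [kappa]. *)
Lemma contraction_rate (b M kappa : R) : 0 < b < 1 -> 0 <= M -> 0 < kappa ->
  exists beta eta, [/\ 0 < beta, 0 < eta < 1,
    (forall t, 2 * (2 * M + 1) / (1 - b) <= t ->
      2 + beta * (b * t + 2 * M) <= eta * (2 + beta * t)) &
    (forall t, 0 <= t -> 2 - kappa + beta * (b * t + 2 * M) <= eta * (2 + beta * t))].
Proof.
move=> /andP[b0 b1] M0 k0; have M1 : 0 < M + 1 by rewrite ltr_wpDl.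
have b1' : 0 < 1 - b by rewrite subr_gt0.
pose beta := kappa / (4 * (M + 1)).
have beta0 : 0 < beta by rewrite divr_gt0// mulr_gt0.
have betaE : beta * (M + 1) = kappa / 4 by rewrite /beta; field; rewrite gt_eqF.
clearbody beta.
pose eta := Num.max ((1 + b) / 2) (Num.max (1 - kappa / 4) (1 - beta / 2)).
have e1 : (1 + b) / 2 <= eta by rewrite /eta le_max lexx.
have e2 : 1 - kappa / 4 <= eta by rewrite /eta !le_max lexx orbT.
have e3 : 1 - beta / 2 <= eta by rewrite /eta !le_max lexx !orbT.
have eta1 : eta < 1 by rewrite /eta !gt_max; apply/and3P; split; lra.
clearbody eta; exists beta, eta; split=> //.
- by apply/andP; split => //; lra.
- move=> t; rewrite ler_pdivrMr// => ht.
  have t0 : 0 <= t by rewrite -(pmulr_lge0 _ b1'); apply: le_trans ht; lra.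
  have bt0 : 0 <= beta * t by rewrite mulr_ge0// ltW.
  have h1 : (1 + b) / 2 * (beta * t) <= eta * (beta * t) by rewrite ler_wpM2r.
  have h2 : beta * (2 * (2 * M + 1)) <= beta * (t * (1 - b)) by rewrite ler_pM2l.
  nra.
- move=> t t0; have bt0 : 0 <= beta * t by rewrite mulr_ge0// ltW.
  have h1 : (1 + b) / 2 * (beta * t) <= eta * (beta * t) by rewrite ler_wpM2r.
  have h2 : 0 <= (1 - b) * (beta * t) by rewrite mulr_ge0// ltW.
  nra.
Qed.

(** Two starting points are compared through two tilted laws. If one of the
    points is far out the drift contracts; otherwise the set where the centred
    difference is nonnegative, or its complement, has mass at least one half
    under the minorising measure, and the overlap contracts. *)
Lemma Rop_contract K rho : 0 < K -> 0 <= rho -> exists beta eta,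
  [/\ 0 < beta, 0 < eta < 1 & forall w w' s, growth K w -> growth K w' -> 0 <= s ->
    span_le beta s (fun y => w' y - w y) ->
    forall x y r r', 0 <= r -> 0 <= r' -> omega x <= r + rho -> omega y <= r' + rho ->
    (Rop w' x - Rop w x) - (Rop w' y - Rop w y) <=
      eta * s * (2 + beta * r + beta * r')].
Proof.
move=> K0 rho0; have [b [M [b01 M0 hM]]] := tilted_drift K0.
have /andP[b0 b1] := b01.
pose M' := M + rho; have M'0 : 0 <= M' by exact: addr_ge0.
have b1' : 0 < 1 - b by rewrite subr_gt0.
pose R0 := 2 * (2 * M' + 1) / (1 - b).
have R00 : 0 < R0 by rewrite divr_gt0// mulr_gt0// ltr_wpDl// mulr_ge0.
have r0 : 0 < R0 + rho by rewrite ltr_wpDr.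
have [kappa k0 [nu hnu]] := tilted_overlap K0 r0.
have [beta [eta [beta0 eta01 far near]]] := contraction_rate b01 M'0 k0.
exists beta, eta; split=> // w w' s gw gw' s0 hs x y r r' r_ge0 r'_ge0 xr yr.
pose phi z := w' z - w z.
have [a ha] := span_center hs.
have cw : continuous w by case: gw.
have cw' : continuous w' by case: gw'.
have ophi : observable (K + K) phi.
  split; first by apply: measurable_funB; exact: continuous_borel.
  by move=> z; rewrite mulrDl (le_trans (ler_normB _ _))// lerD//; [case: gw'|case: gw].
have oNphi : observable (K + K) (fun z => w z - w' z).
  split; first by apply: measurable_funB; exact: continuous_borel.
  by move=> z; rewrite mulrDl (le_trans (ler_normB _ _))// lerD//; [case: gw|case: gw'].
have le1 : Rop w' x - Rop w x <= tilted w x phi by exact: Rop_sub_le gw gw'.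
have le2 : Rop w y - Rop w' y <= tilted w' y (fun z => w z - w' z).
  exact: Rop_sub_le gw' gw.
set D1 := tilted w x omega; set D2 := tilted w' y omega.
have hD1 : D1 <= b * r + M'.
  apply: (le_trans (hM _ _ gw)).
  have h1 : b * omega x <= b * (r + rho) by rewrite ler_pM2l.
  have h2 : b * rho <= rho by rewrite ler_piMl// ltW.
  by rewrite /M'; lra.
have hD2 : D2 <= b * r' + M'.
  apply: (le_trans (hM _ _ gw')).
  have h1 : b * omega y <= b * (r' + rho) by rewrite ler_pM2l.
  have h2 : b * rho <= rho by rewrite ler_piMl// ltW.
  by rewrite /M'; lra.
have sb0 : 0 <= s * beta by rewrite mulr_ge0// ltW.
have DD : s * beta * (D1 + D2) <= s * beta * (b * (r + r') + 2 * M').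
  by rewrite ler_wpM2l//; lra.
have -> : eta * s * (2 + beta * r + beta * r') = s * (eta * (2 + beta * (r + r'))) by ring.
have [tR|tR] := leP R0 (r + r').
  have h1 := @tilted_le_comb K w x _ phi set0 (a + s) 0 (s * beta) K0 gw ophi measurable0 _.
  have h2 := @tilted_le_comb K w' y _ _ set0 (- a + s) 0 (s * beta) K0 gw' oNphi measurable0 _.
  have {}h1 : tilted w x phi <= a + s + s * beta * D1.
    have := h1 _; rewrite mul0r addr0; apply => z.
    by have := ha z; rewrite ler_norml mul0r addr0 /phi => /andP[_]; lra.
  have {}h2 : tilted w' y (fun z => w z - w' z) <= - a + s + s * beta * D2.
    have := h2 _; rewrite mul0r addr0; apply => z.
    by have := ha z; rewrite ler_norml mul0r addr0 => /andP[+ _]; lra.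
  have h3 : s * (2 + beta * (b * (r + r') + 2 * M')) <= s * (eta * (2 + beta * (r + r'))).
    by rewrite ler_wpM2l//; exact: far.
  apply: le_trans h3; lra.
have xR : omega x <= R0 + rho by lra.
have yR : omega y <= R0 + rho by lra.
pose B : set (borel_space R d) := [set z | a <= phi z].
have mB : measurable B.
  rewrite -[B]setTI (_ : B = phi @^-1` `[a, +oo[%classic).
    by apply: (ophi.1).
  by apply/seteqP; split => z /=; rewrite in_itv/= andbT.
have h1 : tilted w x phi <= a + s * tilted w x \1_B + s * beta * D1.
  apply: tilted_le_comb gw ophi mB _ => // z.
  have := ha z; rewrite ler_norml -/(phi z) indicE => /andP[hz1 hz2].
  have oz : 0 <= s * beta * omega z by rewrite mulr_ge0.
  have [zB|zB] /= := boolP (z \in B); first by rewrite mulr1; lra.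
  have : ~ B z by move=> Bz; move/negP: zB; apply; rewrite inE.
  by rewrite /B/= => /negP; rewrite -ltNge mulr0; lra.
have h2 : tilted w' y (fun z => w z - w' z) <=
    (- a + s) + - s * tilted w' y \1_B + s * beta * D2.
  apply: tilted_le_comb gw' oNphi mB _ => // z.
  have := ha z; rewrite ler_norml -/(phi z) indicE => /andP[hz1 hz2].
  have -> : w z - w' z = - phi z by rewrite opprB.
  have oz : 0 <= s * beta * omega z by rewrite mulr_ge0.
  have [zB|zB] /= := boolP (z \in B); last by rewrite mulr0; lra.
  by move: zB; rewrite inE /B/= mulr1; lra.
have nuB : fine (nu B) + fine (nu (~` B)) = 1.
  have nf : nu B \is a fin_num by exact: fin_num_measure.
  by rewrite (probability_setC nu mB) -(fineK nf) -EFinB/= addrC subrK.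
have mix : tilted w x \1_B - tilted w' y \1_B <= 1 - kappa.
  have p1 := tilted_indic_ge0 x (~` B) K0 gw.
  have p2 := tilted_indic_ge0 y B K0 gw'.
  have p3 := tilted_indic_setC x K0 gw mB.
  have [hB|hB] := leP 2^-1 (fine (nu B)).
    by have := hnu _ _ _ gw' yR mB hB; lra.
  have hC : 2^-1 <= fine (nu (~` B)) by lra.
  by have := hnu _ _ _ gw xR (measurableC mB) hC; lra.
have h3 : s * (2 - kappa + beta * (b * (r + r') + 2 * M')) <= s * (eta * (2 + beta * (r + r'))).
  by rewrite ler_wpM2l//; apply: near; exact: addr_ge0.
apply: le_trans h3.
have h4 : s * (tilted w x \1_B - tilted w' y \1_B) <= s * (1 - kappa) by rewrite ler_wpM2l.
lra.
Qed.

End Contraction.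

(** * The Bellman operator and its fixed point modulo constants *)

Section GeometricLimit.
Context {R : realType}.

Lemma pow_small (eta e : R) : 0 < eta < 1 -> 0 < e -> exists n, eta ^+ n < e.
Proof.
move=> /andP[eta0 eta1] e0.
have h : `|eta| < 1 by rewrite gtr0_norm.
have := cvg_expr h => /cvgrPdist_lt /(_ _ e0) near0.
have /filter_ex[n hn] := near0; exists n; move: hn.
by rewrite sub0r normrN ger0_norm// exprn_ge0// ltW.
Qed.

Lemma le_pow (eta a b A : R) : 0 < eta < 1 -> 0 <= A ->
  (forall n, a <= b + eta ^+ n * A) -> a <= b.
Proof.
move=> eta01 A0 h; apply/ler_addgt0Pr => e e0.
have A1 : 0 < A + 1 by rewrite ltr_wpDl.
have [n hn] := pow_small eta01 (divr_gt0 e0 A1).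
apply: (le_trans (h n)); rewrite lerD2l.
have p0 : 0 <= eta ^+ n by rewrite exprn_ge0//; case/andP: eta01 => /ltW.
apply: (@le_trans _ _ (eta ^+ n * (A + 1))); first by rewrite ler_wpM2l// lerDl.
by rewrite -ler_pdivlMr// ltW.
Qed.

(** Adding and subtracting the geometric remainders sandwiches the sequence
    between two monotone ones. *)
Lemma geometric_limit (u : nat -> R) (A eta : R) : 0 < eta < 1 -> 0 <= A ->
  (forall n, `|u n.+1 - u n| <= A * eta ^+ n) ->
  exists l, forall n, `|u n - l| <= A * eta ^+ n / (1 - eta).
Proof.
move=> /andP[eta0 eta1] A0 hu; have e1 : 0 < 1 - eta by rewrite subr_gt0.
pose g n := A * eta ^+ n / (1 - eta).
have gS n : g n - g n.+1 = A * eta ^+ n.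
  by rewrite /g exprS; field; rewrite gt_eqF.
have g0 n : 0 <= g n by rewrite /g divr_ge0 ?mulr_ge0 ?exprn_ge0 ?(ltW eta0)// ltW.
pose p n := u n - g n; pose q n := u n + g n.
have pinc n k : p n <= p (n + k)%N.
  elim: k => [|k ih]; first by rewrite addn0.
  apply: (le_trans ih); rewrite addnS /p.
  by have := hu (n + k)%N; have := gS (n + k)%N; rewrite ler_norml => ? /andP[? _]; lra.
have qdec n k : q (n + k)%N <= q n.
  elim: k => [|k ih]; first by rewrite addn0.
  apply: (le_trans _ ih); rewrite addnS /q.
  by have := hu (n + k)%N; have := gS (n + k)%N; rewrite ler_norml => ? /andP[_ ?]; lra.
have pq n m : p n <= q m.
  apply: (le_trans (pinc n m)); rewrite addnC; apply: (le_trans _ (qdec m n)).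
  by rewrite /p /q; have := g0 (m + n)%N; lra.
pose S := [set p n | n in [set: nat]].
have S0 : S !=set0 by exists (p 0%N); exists 0%N.
have hS : has_sup S.
  by split => //; exists (q 0%N) => _ [n _ <-]; exact: pq.
exists (sup S) => n; rewrite -/(g n) ler_norml; apply/andP; split.
  have : sup S <= q n by apply: ge_sup => // _ [m _ <-]; exact: pq.
  by rewrite /q; lra.
have : p n <= sup S by apply: ub_le_sup; [exact: hS.2|exists n].
by rewrite /p; lra.
Qed.

End GeometricLimit.

Section Bellman.
Context {R : realType} {d : nat}.
Local Notation E := 'rV[R]_d.
Variables (omega : E -> R) (U : set E) (c : E -> E -> R) (Chat C b1 : R)
  (Rop : (E -> R) -> E -> R).
Local Notation growth := (growth omega).
Local Notation span_le := (span_le omega).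
Hypotheses (omega_cont : continuous omega) (omega_ge0 : forall x, 0 <= omega x)
  (U_compact : compact U) (U_nonempty : U !=set0)
  (c_cont : {within [set p : E * E | U p.2], continuous (fun p : E * E => c p.1 p.2)})
  (c_le0 : forall x xi, U xi -> c x xi <= 0)
  (Chat_gt0 : 0 < Chat)
  (c_lower : forall x xi, U xi -> - (Chat * (1 + omega x)) <= c x xi)
  (C_gt0 : 0 < C) (b1_gt0 : 0 < b1) (b1_lt1 : b1 < 1).
Hypothesis Rop_continuous : forall K w, 0 < K -> growth K w -> continuous (Rop w).
Hypothesis Rop_addc : forall K K' w x k, 0 < K -> growth K w ->
  0 < K' -> growth K' (fun y => w y + k) -> Rop (fun y => w y + k) x = Rop w x + k.
Hypothesis Rop_upper : forall L, 0 < L -> exists2 m, 0 <= m &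
  forall K w k x, 0 < K -> growth K w ->
  (forall y, w y <= L * omega y + k) -> Rop w x <= (C + L * b1) * omega x + k + m.
Hypothesis Rop_lower : forall L, 0 < L -> exists2 m, 0 <= m &
  forall K w k x, 0 < K -> growth K w ->
  (forall y, - (L * omega y + k) <= w y) -> - ((C + L * b1) * omega x + k + m) <= Rop w x.
Hypothesis Rop_local : forall r, exists kappa, forall K w x, 0 < K -> growth K w ->
  (forall xi, U xi -> w xi <= 0) -> omega x <= r -> Rop w x <= kappa.
Hypothesis Rop_contract : forall K rho, 0 < K -> 0 <= rho -> exists beta eta,
  [/\ 0 < beta, 0 < eta < 1 & forall w w' s, growth K w -> growth K w' -> 0 <= s ->
    span_le beta s (fun y => w' y - w y) ->
    forall x y r r', 0 <= r -> 0 <= r' -> omega x <= r + rho -> omega y <= r' + rho ->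
    (Rop w' x - Rop w x) - (Rop w' y - Rop w y) <=
      eta * s * (2 + beta * r + beta * r')].

Definition Bop (w : E -> R) (x : E) : R :=
  Num.max (Rop w x) (sup [set Rop w xi + c x xi | xi in U]).

Lemma compact_upper_bound (h : E -> R) : continuous h ->
  exists B, forall xi, U xi -> h xi <= B.
Proof.
move=> ch; have [z _ hz] := compact_EVT_max U_nonempty U_compact (continuous_subspaceT ch).
by exists (h z) => xi Uxi; apply: hz; rewrite inE.
Qed.

Lemma shift_has_sup K w x : 0 < K -> growth K w ->
  has_sup [set Rop w xi + c x xi | xi in U].
Proof.
move=> K0 gw; have [B hB] := compact_upper_bound (Rop_continuous K0 gw).
have [z Uz] := U_nonempty; split; first by exists (Rop w z + c x z); exists z.
by exists B => _ [xi Uxi <-]; have := hB _ Uxi; have := c_le0 x Uxi; lra.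
Qed.

Lemma Rop_le_Bop w x : Rop w x <= Bop w x.
Proof. by rewrite /Bop le_max lexx. Qed.

Lemma shift_le_Bop K w x xi : 0 < K -> growth K w -> U xi -> Rop w xi + c x xi <= Bop w x.
Proof.
move=> K0 gw Uxi; rewrite /Bop le_max; apply/orP; right.
by apply: ub_le_sup; [exact: (shift_has_sup x K0 gw).2|exists xi].
Qed.

Lemma Bop_le w x B : Rop w x <= B -> (forall xi, U xi -> Rop w xi + c x xi <= B) ->
  Bop w x <= B.
Proof.
move=> h1 h2; rewrite /Bop ge_max h1/=; apply: ge_sup.
  by have [z Uz] := U_nonempty; exists (Rop w z + c x z); exists z.
by move=> _ [xi Uxi <-]; exact: h2.
Qed.

(** Compactness of [U] turns joint continuity into continuity uniform in the
    target of the shift. *)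
Lemma cost_equicontinuous x0 e : 0 < e ->
  \forall x \near x0, forall xi, U xi -> `|c x xi - c x0 xi| <= e.
Proof.
move=> e0; have e2 : 0 < e / 2 by rewrite divr_gt0.
have /compact_near_coveringP := U_compact.
move=> /(_ E (nbhs x0) (fun x xi => U xi -> `|c x xi - c x0 xi| <= e) _) h.
apply: filterS (h _) => [x hx xi Uxi|xi Uxi]; first exact: hx.
have /subspace_continuousP /(_ (x0, xi) Uxi) /cvgrPdist_le /(_ _ e2) := c_cont.
move=> [[A B] /= [nA nB] hAB]; exists (B, A) => //= -[xi' x'] /= [Bx Ax] Ux'.
have h1 := hAB (x', xi') (conj Ax Bx) Ux'.
have h2 := hAB (x0, xi') (conj (nbhs_singleton nA) Bx) Ux'.
rewrite (_ : _ - _ = (c x0 xi - c x0 xi') - (c x0 xi - c x' xi')); last by ring.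
by apply: (le_trans (ler_normB _ _)); move: h1 h2 => /=; lra.
Qed.

Lemma Bop_continuous K w : 0 < K -> growth K w -> continuous (Bop w).
Proof.
move=> K0 gw x0.
have cs : {for x0, continuous (fun x => sup [set Rop w xi + c x xi | xi in U])}.
  apply: continuous_approx => e e0.
  exists (fun=> sup [set Rop w xi + c x0 xi | xi in U]); first exact: cst_continuous.
  apply: filterS (cost_equicontinuous x0 e0) => x hx.
  have [z Uz] := U_nonempty.
  have le_sup a b : (forall xi, U xi -> `|c a xi - c b xi| <= e) ->
      sup [set Rop w xi + c a xi | xi in U] <= sup [set Rop w xi + c b xi | xi in U] + e.
    move=> hab; apply: ge_sup; first by exists (Rop w z + c a z); exists z.
    move=> _ [xi Uxi <-]; have /ler_normlP[_ h] := hab _ Uxi.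
    have : Rop w xi + c b xi <= sup [set Rop w xi + c b xi | xi in U].
      by apply: ub_le_sup; [exact: (shift_has_sup b K0 gw).2|exists xi].
    lra.
  have h1 := le_sup x x0 hx.
  have h2 := le_sup x0 x (fun xi Uxi => ltac:(rewrite distrC; exact: hx)).
  by rewrite ler_norml; apply/andP; split; lra.
have -> : Bop w = (Rop w \max (fun x => sup [set Rop w xi + c x xi | xi in U]))%R.
  by apply/funext.
by apply: continuous_max; [exact: (Rop_continuous K0 gw)|exact: cs].
Qed.

Lemma Bop_growth K w : 0 < K -> growth K w -> exists2 K', 0 < K' & growth K' (Bop w).
Proof.
move=> K0 gw; have [m m0 hm] := Rop_upper K0; have [l l0 hl] := Rop_lower K0.
have up y : w y <= K * omega y + K.
  by have := gw.2 y; rewrite ler_norml mulrDr mulr1 => /andP[_]; lra.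
have lo y : - (K * omega y + K) <= w y.
  by have := gw.2 y; rewrite ler_norml mulrDr mulr1 => /andP[+ _]; lra.
have [B hB] := compact_upper_bound (Rop_continuous K0 gw).
have A0 : 0 < C + K * b1 by rewrite addr_gt0// mulr_gt0.
exists ((C + K * b1) + K + m + l + `|B|).
  by have := normr_ge0 B; lra.
split; first exact: Bop_continuous gw.
move=> x; have o0 := omega_ge0 x; have nB := normr_ge0 B.
have KK : 0 <= (K + m + l + `|B|) * omega x by rewrite mulr_ge0// !addr_ge0// ltW.
have Ao : 0 <= (C + K * b1) * omega x by rewrite mulr_ge0// ltW.
rewrite ler_norml; apply/andP; split.
  by apply: le_trans (Rop_le_Bop w x); apply: le_trans (hl K w K x K0 gw lo); lra.
apply: Bop_le; first by apply: (le_trans (hm K w K x K0 gw up)); lra.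
move=> xi Uxi; have := hB _ Uxi; have := c_le0 x Uxi; have := ler_norm B; lra.
Qed.

Lemma growth_addc K w k : growth K w -> growth (K + `|k|) (fun y => w y + k).
Proof.
move=> [cw wK]; split.
  have -> : (fun y => w y + k) = (fun y => k + 1 * w y).
    by apply/funext => y; rewrite mul1r addrC.
  exact: continuous_affine.
move=> x; apply: (le_trans (ler_normD _ _)); rewrite mulrDl lerD//.
by rewrite ler_peMr// lerDl.
Qed.

Lemma Bop_addc K w k x : 0 < K -> growth K w -> Bop (fun y => w y + k) x = Bop w x + k.
Proof.
move=> K0 gw; have gk := growth_addc k gw.
have K'0 : 0 < K + `|k| by rewrite ltr_wpDr.
have RE y := Rop_addc y K0 gw K'0 gk.
apply/eqP; rewrite eq_le; apply/andP; split.
  apply: Bop_le; first by rewrite RE lerD2r Rop_le_Bop.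
  by move=> xi Uxi; rewrite RE addrAC lerD2r (shift_le_Bop x K0 gw).
rewrite -lerBrDr; apply: Bop_le.
  by rewrite lerBrDr -RE Rop_le_Bop.
by move=> xi Uxi; rewrite lerBrDr addrAC -RE (shift_le_Bop x K'0 gk).
Qed.

(** The maximum is over the current state and the states in [U], with the same
    costs for both functions, so the estimate for the one-step operator passes
    to it; the radius [rho] makes room for the states in [U]. *)
Lemma Bop_contract K : 0 < K -> exists beta eta,
  [/\ 0 < beta, 0 < eta < 1 & forall w w' s, growth K w -> growth K w' -> 0 <= s ->
    span_le beta s (fun y => w' y - w y) ->
    span_le beta (eta * s) (fun y => Bop w' y - Bop w y)].
Proof.
move=> K0; have [B hB] := compact_upper_bound omega_cont.
have rho0 : 0 <= `|B| by [].
have [beta [eta [beta0 eta01 hc]]] := Rop_contract K0 rho0.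
exists beta, eta; split=> // w w' s gw gw' s0 hs x y.
set D := eta * s * _.
have bnd z : omega z <= omega z + `|B| by rewrite lerDl.
have bndU z xi : U xi -> omega xi <= omega z + `|B|.
  by move=> /hB /le_trans; apply; rewrite (le_trans (ler_norm B))// lerDr.
have key x' y' : omega x' <= omega x + `|B| -> omega y' <= omega y + `|B| ->
    (Rop w' x' - Rop w x') - (Rop w' y' - Rop w y') <= D.
  by move=> hx' hy'; exact: (hc w w' s gw gw' s0 hs x' y' _ _ (omega_ge0 x) (omega_ge0 y)).
suff h : Bop w' x <= D + Bop w x + Bop w' y - Bop w y by lra.
have inner x' o : omega x' <= omega x + `|B| -> Rop w x' + o <= Bop w x ->
    Rop w' x' + o <= D + Bop w x + Bop w' y - Bop w y.
  move=> hx' ho; suff : Bop w y <= D + Bop w x + Bop w' y - (Rop w' x' + o) by lra.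
  apply: Bop_le.
    by have := key x' y hx' (bnd y); have := Rop_le_Bop w' y; lra.
  move=> xi Uxi; have := key x' xi hx' (bndU y xi Uxi).
  by have := shift_le_Bop y K0 gw' Uxi; lra.
apply: Bop_le.
  by have := inner x 0 (bnd x); rewrite !addr0; apply; exact: Rop_le_Bop.
by move=> xi Uxi; apply: inner; [exact: bndU|exact: (shift_le_Bop x K0 gw)].
Qed.

(** The iterates of the operator drift by constants, which the free level [m]
    absorbs; anchoring it on [U] lets the option to shift restore the lower bound
    at every step. *)
Definition envelope (L k : R) (w : E -> R) : Prop :=
  exists m, [/\ forall x, m - Chat * (1 + omega x) <= w x,
    forall xi, U xi -> w xi <= m & forall x, w x <= m + L * omega x + k].

(** The lower bound comes from the option to shift into [U].  The upper one
    comes from the drift far out and, in a bounded region, from the local bound,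
    which controls the utility by the size of [w] on [U] alone. *)
Lemma envelope_invariant : exists L k, [/\ 0 < L, 0 <= k &
  forall K w, 0 < K -> growth K w -> envelope L k w -> envelope L k (Bop w)].
Proof.
have [xi0 Uxi0] := U_nonempty.
have b1' : 0 < 1 - b1 by rewrite subr_gt0.
(* The operator maps slope [L] to slope [C + L * b1]; this choice leaves a gain
   of one unit, which pays for the constants where [omega] is large. *)
have [L L0 LE] : exists2 L, 0 < L & C + L * b1 = L - 1.
  exists ((C + 1) / (1 - b1)); first by rewrite divr_gt0// addr_gt0.
  by field; rewrite gt_eqF.
have [m1 m10 up] := Rop_upper L0.
have [l1 l10 lo] := Rop_lower Chat_gt0.
(* One step lowers the level on [U] by at most [D]. *)
pose D := (C + Chat * b1) * omega xi0 + Chat + l1.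
have [kappa loc] := Rop_local (m1 + D).
pose k := Num.max 0 (D + kappa).
have k1 : D + kappa <= k by rewrite /k le_max lexx orbT.
have k0 : 0 <= k by rewrite /k le_max lexx.
exists L, k; split=> // K w K0 gw [m [wlo wU wup]].
have [B hB] := compact_upper_bound (Rop_continuous K0 gw).
pose S := [set Rop w xi | xi in U]; pose m' := sup S.
have S0 : S !=set0 by exists (Rop w xi0); exists xi0.
have ubS : has_ubound S by exists B => _ [xi Uxi <-]; exact: hB.
have Rm' xi : U xi -> Rop w xi <= m' by move=> Uxi; apply: ub_le_sup => //; exists xi.
have m'D : m - D <= m'.
  apply: le_trans (Rm' _ Uxi0).
  have lo' y : - (Chat * omega y + (Chat - m)) <= w y by have := wlo y; lra.
  by apply: le_trans (lo K w (Chat - m) xi0 K0 gw lo'); rewrite /D; lra.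
exists m'; split.
- move=> x; have : m' <= Bop w x + Chat * (1 + omega x).
    apply: ge_sup => // _ [xi Uxi <-].
    by have := shift_le_Bop x K0 gw Uxi; have := c_lower x Uxi; lra.
  by lra.
- move=> xi Uxi; apply: Bop_le; first exact: Rm'.
  by move=> xi' Uxi'; have := Rm' _ Uxi'; have := c_le0 xi Uxi'; lra.
- move=> x; have Lo : 0 <= L * omega x by rewrite mulr_ge0// ltW.
  apply: Bop_le; last first.
    by move=> xi' Uxi'; have := Rm' _ Uxi'; have := c_le0 x Uxi'; lra.
  have [xR|xR] := leP (omega x) (m1 + D); last first.
    have wup' y : w y <= L * omega y + (k + m) by have := wup y; lra.
    by have := up K w (k + m) x K0 gw wup'; rewrite LE; lra.
  have gm := growth_addc (- m) gw.
  have K'0 : 0 < K + `|- m| by rewrite ltr_wpDr.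
  have wm xi : U xi -> w xi - m <= 0 by move=> /wU; lra.
  by have := loc _ _ x K'0 gm wm xR; rewrite (Rop_addc x K0 gw K'0 gm); lra.
Qed.

Lemma envelope_addc L k w a : envelope L k w -> envelope L k (fun y => w y + a).
Proof.
move=> [m [h1 h2 h3]]; exists (m + a); split.
- by move=> x; have := h1 x; lra.
- by move=> xi /h2; lra.
- by move=> x; have := h3 x; lra.
Qed.

Lemma envelope_growth L k x0 w : 0 < L -> 0 <= k -> continuous w -> w x0 = 0 ->
  envelope L k w -> growth (L + k + Chat * (2 + omega x0) + L * omega x0) w.
Proof.
move=> L0 k0 cw w0 [m [h1 _ h3]]; split => // x.
have a1 := h1 x; have a2 := h3 x; have b1' := h1 x0; have b2 := h3 x0.
rewrite w0 in b1' b2.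
have o0 := omega_ge0 x0; have o := omega_ge0 x.
have p1 : 0 <= L * omega x0 by rewrite mulr_ge0// ltW.
have p2 : 0 <= Chat * omega x0 by rewrite mulr_ge0// ltW.
have p3 : 0 <= (k + Chat * (1 + omega x0) + L * omega x0) * omega x.
  rewrite mulr_ge0//; have : 0 <= Chat * (1 + omega x0) by rewrite mulr_ge0 ?addr_ge0// ltW.
  by lra.
have p4 : 0 <= (L + k + Chat * (1 + omega x0) + L * omega x0) * omega x.
  rewrite mulr_ge0//; have : 0 <= Chat * (1 + omega x0) by rewrite mulr_ge0 ?addr_ge0// ltW.
  by have := ltW L0; lra.
have p5 : 0 <= Chat * omega x by rewrite mulr_ge0// ltW.
have p6 : 0 <= L * omega x by rewrite mulr_ge0// ltW.
have L0' := ltW L0; have C0' := ltW Chat_gt0.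
by rewrite ler_norml; apply/andP; split; nra.
Qed.

Lemma span_le_growth K beta : 0 < K -> 0 < beta -> exists2 s, 0 <= s &
  forall w w', growth K w -> growth K w' -> span_le beta s (fun y => w' y - w y).
Proof.
move=> K0 beta0; exists (2 * K * (1 + beta^-1)).
  by rewrite !mulr_ge0 ?addr_ge0 ?invr_ge0// ltW.
move=> w w' [_ hw] [_ hw'] x y.
have h1 := hw x; have h2 := hw' x; have h3 := hw y; have h4 := hw' y.
move: h1 h2 h3 h4; rewrite !ler_norml => /andP[? ?] /andP[? ?] /andP[? ?] /andP[? ?].
have -> : 2 * K * (1 + beta^-1) * (2 + beta * omega x + beta * omega y) =
    2 * K * (2 + omega x + omega y) + 2 * K * (2 / beta + beta * omega x + beta * omega y).
  by field; rewrite gt_eqF.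
have : 0 <= 2 * K * (2 / beta + beta * omega x + beta * omega y).
  have b_x := mulr_ge0 (ltW beta0) (omega_ge0 x).
  have b_y := mulr_ge0 (ltW beta0) (omega_ge0 y).
  have b_i : 0 <= 2 / beta by rewrite divr_ge0// ltW.
  by apply: mulr_ge0; [rewrite mulr_ge0// ltW|lra].
lra.
Qed.

Lemma span_leN beta s phi : span_le beta s phi -> span_le beta s (fun y => - phi y).
Proof. by move=> h x y; have := h y x; lra. Qed.

(** The difference of two solutions is reproduced by the operator up to a
    constant, so its span is contracted to zero. *)
Lemma bellman_unique K w w' lambda lambda' : 0 < K -> growth K w -> growth K w' ->
  (forall x, Bop w x = w x + lambda) -> (forall x, Bop w' x = w' x + lambda') ->
  lambda' = lambda /\ exists k, forall x, w' x = w x + k.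
Proof.
move=> K0 gw gw' hw hw'.
have [beta [eta [beta0 eta01 hc]]] := Bop_contract K0.
have /andP[eta0 eta1] := eta01.
have [s0 s00 span0] := span_le_growth K0 beta0.
have hs n : span_le beta (eta ^+ n * s0) (fun y => w' y - w y).
  elim: n => [|n ih]; first by rewrite mul1r; exact: span0.
  have := hc w w' _ gw gw' (mulr_ge0 (exprn_ge0 n (ltW eta0)) s00) ih.
  by rewrite exprS -mulrA => h x y; have := h x y; rewrite !hw !hw'; lra.
have phi_le x y : w' x - w x <= w' y - w y.
  have dd : 0 <= s0 * (2 + beta * omega x + beta * omega y).
    by rewrite mulr_ge0// !addr_ge0 ?mulr_ge0// ltW.
  apply: (le_pow eta01 dd) => n.
  by have := hs n x y; lra.
have phi_eq x y : w' x - w x = w' y - w y by apply/eqP; rewrite eq_le !phi_le.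
have w'E x : w' x = w x + (w' 0 - w 0) by have := phi_eq x 0; lra.
split; last by exists (w' 0 - w 0).
have : w' 0 + lambda' = w 0 + lambda + (w' 0 - w 0).
  rewrite -hw' -hw -(Bop_addc _ _ K0 gw); congr (Bop _ _).
  by apply/funext => y; rewrite w'E.
by lra.
Qed.

Lemma growth0 K : 0 < K -> growth K (fun=> 0).
Proof.
move=> K0; split; first by move=> x; exact: cst_continuous.
by move=> x; rewrite normr0 mulr_ge0 ?addr_ge0// ltW.
Qed.

(** Normalised iterates of the operator converge geometrically in the weighted
    span seminorm, and the limit is a fixed point modulo constants. *)
Lemma bellman_exists : exists K w lambda,
  [/\ 0 < K, growth K w & forall x, Bop w x = w x + lambda].
Proof.
have [L [k [L0 k0 inv]]] := envelope_invariant.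
pose x0 : E := 0; pose Kv := L + k + Chat * (2 + omega x0) + L * omega x0.
have o0 := omega_ge0 x0.
have Kv0 : 0 < Kv.
  have : 0 <= Chat * (2 + omega x0) by rewrite mulr_ge0 ?addr_ge0// ltW.
  by have : 0 <= L * omega x0 by [rewrite mulr_ge0// ltW]; rewrite /Kv; lra.
pose step (w : E -> R) (y : E) := Bop w y + - Bop w x0.
pose v n := iter n step (fun=> 0).
have vgood n : [/\ growth Kv (v n), envelope L k (v n) & v n x0 = 0].
  elim: n => [|n [gn en zn]].
    split=> //; first exact: growth0.
    exists 0; split=> // x; last by rewrite add0r addr_ge0 ?mulr_ge0// ltW.
    by rewrite sub0r oppr_le0 mulr_ge0 ?addr_ge0// ltW.
  have e1 : envelope L k (v n.+1) by apply: envelope_addc; exact: inv gn en.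
  have z1 : v n.+1 x0 = 0 by rewrite /v/= /step subrr.
  have c1 : continuous (v n.+1).
    have [K' _ gB] := Bop_growth Kv0 gn.
    by have [] := growth_addc (- Bop (v n) x0) gB.
  by split=> //; exact: envelope_growth.
have gv n : growth Kv (v n) by have [] := vgood n.
have v0 n : v n x0 = 0 by have [] := vgood n.
have [beta [eta [beta0 eta01 hc]]] := Bop_contract Kv0.
have /andP[eta0 eta1] := eta01.
have e1 : 0 < 1 - eta by rewrite subr_gt0.
have [s0 s00 span0] := span_le_growth Kv0 beta0.
have pw0 n : 0 <= eta ^+ n by rewrite exprn_ge0// ltW.
have hs n : span_le beta (eta ^+ n * s0) (fun y => v n.+1 y - v n y).
  elim: n => [|n ih]; first by rewrite mul1r; exact: span0.
  have := hc (v n) (v n.+1) _ (gv n) (gv n.+1) (mulr_ge0 (pw0 n) s00) ih.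
  by rewrite exprS -mulrA => h x y; have := h x y; rewrite [v n.+2]/v [v n.+1]/v/= /step; lra.
pose A x := s0 * (2 + beta * omega x + beta * omega x0).
have A0 x : 0 <= A x by rewrite mulr_ge0// !addr_ge0 ?mulr_ge0// ltW.
have vstep x n : `|v n.+1 x - v n x| <= A x * eta ^+ n.
  have h1 := hs n x x0; have h2 := hs n x0 x; rewrite !v0 in h1 h2.
  by rewrite ler_norml /A; apply/andP; split; lra.
have /choice[w hw] x : exists l, forall n, `|v n x - l| <= A x * eta ^+ n / (1 - eta).
  by apply: geometric_limit => //; exact: vstep.
have gw : growth Kv w.
  split=> x; last first.
    have D0 : 0 <= A x / (1 - eta) by rewrite divr_ge0// ltW.
    apply: (le_pow eta01 D0) => n.
    have := hw x n; rewrite distrC => h.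
    rewrite -[w x](subrK (v n x)) addrC; apply: (le_trans (ler_normD _ _)).
    by apply: lerD; [case: (gv n)|rewrite mulrA [_ * A x]mulrC].
  apply: continuous_approx => e ep.
  pose B := s0 * (2 + beta * (omega x + 1) + beta * omega x0) / (1 - eta).
  have B0 : 0 < B + 1.
    rewrite ltr_wpDl// divr_ge0 ?(ltW e1)// mulr_ge0// !addr_ge0 ?mulr_ge0 ?addr_ge0//;
      exact: ltW.
  have [n hn] := pow_small eta01 (divr_gt0 ep B0).
  exists (v n); first by have [cv _] := gv n; exact: cv.
  have ch : {for x, continuous (fun y => (omega x + 1) + -1 * omega y)}.
    by apply: continuous_affine.
  have h0 : 0 < omega x + 1 + -1 * omega x by lra.
  have near_om := near_gt ch h0.
  apply: filterS near_om => y hy; rewrite distrC; apply: (le_trans (hw y n)).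
  have AB : A y / (1 - eta) <= B.
    rewrite /B ler_pM2r ?invr_gt0// /A ler_wpM2l//.
    have : beta * omega y <= beta * (omega x + 1) by rewrite ler_pM2l//; lra.
    by lra.
  rewrite mulrAC mulrC; apply: (@le_trans _ _ (eta ^+ n * (B + 1))).
    by rewrite ler_wpM2l// (le_trans AB)// lerDl.
  by rewrite -ler_pdivlMr// ltW.
(* [eta ^+ n * Sc] bounds the span of the remainder [w - v n]: the tail of the
   geometric series, recentred from [x0] to two arbitrary points. *)
pose Sc := s0 * (2 + beta * omega x0) / (1 - eta).
have Sc0 : 0 <= Sc.
  by rewrite divr_ge0 ?(ltW e1)// mulr_ge0// addr_ge0// mulr_ge0// ltW.
have wspan n : span_le beta (eta ^+ n * Sc) (fun y => w y - v n y).
  move=> x y; have := hw x n; have := hw y n; rewrite !ler_norml => /andP[? ?] /andP[? ?].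
  have -> : eta ^+ n * Sc * (2 + beta * omega x + beta * omega y) =
      A x * eta ^+ n / (1 - eta) + A y * eta ^+ n / (1 - eta) +
      eta ^+ n * s0 / (1 - eta) * (beta * omega x + beta * omega y +
        beta * omega x0 * (beta * omega x + beta * omega y)).
    by rewrite /Sc /A; field; rewrite gt_eqF.
  have b_x := mulr_ge0 (ltW beta0) (omega_ge0 x).
  have b_y := mulr_ge0 (ltW beta0) (omega_ge0 y).
  have b_0 := mulr_ge0 (ltW beta0) (omega_ge0 x0).
  have : 0 <= eta ^+ n * s0 / (1 - eta) * (beta * omega x + beta * omega y +
        beta * omega x0 * (beta * omega x + beta * omega y)).
    apply: mulr_ge0; first by rewrite divr_ge0 ?mulr_ge0// ltW.
    have b_b := addr_ge0 b_x b_y; by rewrite addr_ge0// mulr_ge0.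
  lra.
have diff_le x y : Bop w x - w x <= Bop w y - w y.
  have b_x := mulr_ge0 (ltW beta0) (omega_ge0 x).
  have b_y := mulr_ge0 (ltW beta0) (omega_ge0 y).
  have dd : 0 <= 2 * eta * Sc * (2 + beta * omega x + beta * omega y).
    apply: mulr_ge0; last by lra.
    by apply: mulr_ge0 => //; rewrite mulr_ge0// ltW.
  apply: (le_pow eta01 dd) => n.
  have h1 := hc (v n) w _ (gv n) gw (mulr_ge0 (pw0 n) Sc0) (wspan n) x y.
  have h2 := span_leN (wspan n.+1) x y.
  rewrite [v n.+1]/v/= /step -/(v n) in h2; rewrite exprS in h2.
  lra.
exists Kv, w, (Bop w x0 - w x0); split=> // x.
have : Bop w x - w x = Bop w x0 - w x0 by apply/eqP; rewrite eq_le !diff_le.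
by lra.
Qed.

End Bellman.

(** * The Bellman equation *)

Section Translation.
Context {R : realType} {d : nat}.
Local Notation E := 'rV[R]_d.

Lemma wnorm_bound (omega g : E -> R) : (forall x, 0 <= omega x) ->
  (wnorm omega g < +oo)%E -> exists2 K, 0 < K & forall x, `|g x| <= K * (1 + omega x).
Proof.
move=> o0 h; have o1 x : 0 < 1 + omega x by rewrite ltr_wpDr.
have up x : ((`|g x| / (1 + omega x))%:E <= wnorm omega g)%E.
  by apply: ereal_sup_ubound; exists x.
move: h up; case: (wnorm omega g) => [r _ up|//|_ up]; last by have := up 0.
have r0 : 0 <= r.
  by have := up 0; rewrite lee_fin; apply: le_trans; rewrite divr_ge0// ltW.
exists (r + 1); first by rewrite ltr_wpDl.
move=> x; have := up x; rewrite lee_fin ler_pdivrMr// => /le_trans; apply.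
by rewrite ler_wpM2r ?lerDl// ltW.
Qed.

Lemma growth_weighted (omega w : E -> R) K : (forall x, 0 <= omega x) ->
  growth omega K w -> weighted_continuous omega w.
Proof.
move=> o0 [cw wK]; split=> //; apply: (@le_lt_trans _ _ K%:E); last by rewrite ltry.
apply: ge_ereal_sup => _ [x _ <-]; rewrite lee_fin ler_pdivrMr ?ltr_wpDr//.
Qed.

Lemma weighted_growth (omega w : E -> R) : (forall x, 0 <= omega x) ->
  weighted_continuous omega w -> exists2 K, 0 < K & growth omega K w.
Proof. by move=> o0 [cw /(wnorm_bound o0)[K K0 hK]]; exists K. Qed.

Lemma growth_le (omega w : E -> R) K K' : (forall x, 0 <= omega x) -> K <= K' ->
  growth omega K w -> growth omega K' w.
Proof.
move=> o0 KK' [cw wK]; split=> // x; apply: (le_trans (wK x)).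
by rewrite ler_wpM2r// addr_ge0.
Qed.

(** Continuity on the compact [U] makes the pointwise infimum a true lower
    bound, so that its weighted norm controls every cost. *)
Lemma cost_lower (omega : E -> R) (U : set E) (c : E -> E -> R) :
  (forall x, 0 <= omega x) -> compact U -> U !=set0 ->
  {within [set p : E * E | U p.2], continuous (fun p : E * E => c p.1 p.2)} ->
  (wnorm omega (fun x => inf [set c x xi | xi in U]) < +oo)%E ->
  exists2 K, 0 < K & forall x xi, U xi -> - (K * (1 + omega x)) <= c x xi.
Proof.
move=> o0 cU U0 cc /(wnorm_bound o0)[K K0 hK]; exists K => // x xi Uxi.
have cx : {within U, continuous (c x)}.
  apply/subspace_continuousP => y Uy; apply/cvgrPdist_le => e e0.
  have /subspace_continuousP /(_ (x, y) Uy) /cvgrPdist_le /(_ _ e0) := cc.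
  move=> [[A B] /= [nA nB] hAB]; apply: filterS nB => z Bz Uz.
  exact: (hAB (x, z) (conj (nbhs_singleton nA) Bz) Uz).
have [z Uz hz] := compact_EVT_min U0 cU cx.
have : inf [set c x xi | xi in U] <= c x xi.
  apply: ge_inf; last by exists xi.
  by exists (c x z) => _ [y Uy <-]; apply: hz; rewrite inE.
by have := hK x; rewrite ler_norml => /andP[h _]; lra.
Qed.

Lemma bellman_equationP (disp : measure_display) (Omega : measurableType disp)
    (P : E -> probability Omega R) (X : R -> Omega -> E) (U : set E)
    (delta gamma : R) (f : E -> R) (c : E -> E -> R) (w Rw : E -> R) (lambda : R) :
  (forall x, entropic_utility (P x) gamma
     (fun a => time_integral X delta f a + w (X delta a)) = (Rw x)%:E) ->
  (forall x, has_sup [set Rw xi + c x xi | xi in U]) ->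
  bellman_equation P X U delta gamma f c w lambda <->
  forall x, Num.max (Rw x) (sup [set Rw xi + c x xi | xi in U]) = w x + lambda.
Proof.
move=> hR hS.
have key x : maxe (Rw x)%:E (ereal_sup [set ((Rw xi)%:E + (c x xi)%:E)%E | xi in U]) =
    (Num.max (Rw x) (sup [set Rw xi + c x xi | xi in U]))%:E.
  have -> : [set ((Rw xi)%:E + (c x xi)%:E)%E | xi in U] =
      [set y%:E | y in [set Rw xi + c x xi | xi in U]].
    apply/seteqP; split => [_ [xi Uxi <-]|_ [_ [xi Uxi <-] <-]].
      by exists (Rw xi + c x xi) => //; exists xi.
    by exists xi.
  by have [h0 hub] := hS x; rewrite ereal_sup_EFin// -EFin_max.
have shape x : ereal_sup [set (entropic_utility (P xi) gamma
      (fun a => (time_integral X delta f a + w (X delta a))%R) + (c x xi)%:E)%E | xi in U] =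
    ereal_sup [set ((Rw xi)%:E + (c x xi)%:E)%E | xi in U].
  by congr ereal_sup; apply: eq_imagel => xi _; rewrite hR.
rewrite /bellman_equation; split => h x.
  by have := h x; rewrite hR shape key => -[].
by rewrite hR shape key h.
Qed.

End Translation.

Theorem proposition3p4 (R : realType) (d : nat) (disp : measure_display)
  (Omega : measurableType disp)
  (P : 'rV[R]_d -> probability Omega R)
  (F : R -> set (set Omega))
  (X : R -> Omega -> 'rV[R]_d)
  (U : set 'rV[R]_d) (delta : R)
  (omega f : 'rV[R]_d -> R) (c : 'rV[R]_d -> 'rV[R]_d -> R)
  (gamma : R)
  (filtF : filtration F)
  (usualF : usual_conditions P F)
  (markovX : feller_markov P F X)
  (compactU : compact U)
  (delta_gt0 : 0 < delta)
  (omega_continuous : continuous omega)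
  (omega_ge0 : forall x, 0 <= omega x)
  (A1 : weighted_continuous omega f)
  (A2 : {within [set p : 'rV[R]_d * 'rV[R]_d | U p.2],
           continuous (fun p : 'rV[R]_d * 'rV[R]_d => c p.1 p.2)} /\
        (exists2 c0 : R, c0 < 0 & forall x xi, U xi -> c x xi <= c0) /\
        (wnorm omega (fun x => inf [set c x xi | xi in U]) < +oo)%E)
  (A3 : exists (b1 : R) (M1 M2 : R -> R), 0 < b1 < 1 /\
        forall (g : R) (x : 'rV[R]_d),
          (entropic_utility (P x) g (time_integral X delta omega)
             <= (omega x + M1 g)%:E)%E /\
          (entropic_utility (P x) g (fun w => omega (X delta w))
             <= (b1 * omega x + M2 g)%:E)%E)
  (A4 : forall r : R, 0 < r ->
        exists2 a : R, 0 < a &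
        exists2 nu : probability (borel_space R d) R, (0 < nu U)%E &
          forall A : set (borel_space R d), measurable A ->
            (a%:E * nu A <=
               ereal_inf [set P x (X delta @^-1` A)
                         | x in [set x | (omega x <= r)%R]])%E)
  (gamma_lt0 : gamma < 0) :
  exists (w : 'rV[R]_d -> R) (lambda : R),
    [/\ weighted_continuous omega w,
        bellman_equation P X U delta gamma f c w lambda &
        forall (w' : 'rV[R]_d -> R) (lambda' : R),
          weighted_continuous omega w' ->
          bellman_equation P X U delta gamma f c w' lambda' ->
          lambda' = lambda /\ exists k : R, forall x, w' x = w x + k].
Proof.
have [b1 [M1 [M2 [/andP[b1_gt0 b1_lt1] moments]]]] := A3.
have momJ g x := (moments g x).1; have momW g x := (moments g x).2.
have [C C_gt0 [f_cont f_growth]] := weighted_growth omega_ge0 A1.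
have [c_cont [[c0 c0_lt0 c_le] c_norm]] := A2.
have c_le0 x xi : U xi -> c x xi <= 0 by move=> /(c_le x) /le_trans; apply; exact: ltW.
have U_nonempty : U !=set0.
  have [a _ [nu nuU _]] := A4 1 ltr01; apply/set0P/eqP => U0.
  by move: nuU; rewrite U0 measure0 ltxx.
have [Chat Chat_gt0 c_lower] := cost_lower omega_ge0 compactU U_nonempty c_cont c_norm.
have U_borel : measurable (U : set (borel_space R d)).
  by apply: closed_borel; apply: compact_closed compactU; exact: norm_hausdorff.
have minorised r : 0 < r -> exists2 a : R, 0 < a &
    exists2 nu : probability (borel_space R d) R, (0 < nu U)%E &
    forall B : set (borel_space R d), measurable B -> forall x, omega x <= r ->
      a * fine (nu B) <= mean (P x) (\1_(X delta @^-1` B) : Omega -> R).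
  move=> /A4[a a0 [nu nuU hnu]]; exists a => //; exists nu => // B mB x xr.
  have mXB := preimage_measurable filtF markovX (ltW delta_gt0) mB.
  have nuf : nu B \is a fin_num by exact: fin_num_measure.
  have Pf : P x (X delta @^-1` B) \is a fin_num by exact: fin_num_measure.
  rewrite mean_indic// -lee_fin EFinM fineK// fineK//.
  by apply: (le_trans (hnu B mB)); apply: ereal_inf_lbound; exists x.
pose Rw := Rop P X delta f gamma.
pose tm := tilted P X delta f gamma.
have R_entropic K w x : 0 < K -> growth omega K w -> entropic_utility (P x) gamma
    (fun a => time_integral X delta f a + w (X delta a)) = (Rw w x)%:E.
  exact: (Rop_entropic filtF markovX delta_gt0 omega_continuous omega_ge0
    f_cont C_gt0 f_growth gamma_lt0 momJ momW).
have R_continuous K w : 0 < K -> growth omega K w -> continuous (Rw w).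
  exact: (Rop_continuous filtF markovX delta_gt0 omega_continuous omega_ge0
    f_cont C_gt0 f_growth gamma_lt0 b1_gt0 momJ momW).
have R_addc K K' w x k : 0 < K -> growth omega K w ->
    0 < K' -> growth omega K' (fun y => w y + k) -> Rw (fun y => w y + k) x = Rw w x + k.
  exact: (Rop_addc filtF markovX delta_gt0 omega_continuous omega_ge0
    f_cont C_gt0 f_growth gamma_lt0 momJ momW).
have R_upper := Rop_upper filtF markovX delta_gt0 omega_continuous omega_ge0
  f_cont C_gt0 f_growth gamma_lt0 momJ momW.
have R_lower := Rop_lower filtF markovX delta_gt0 omega_continuous omega_ge0
  f_cont C_gt0 f_growth gamma_lt0 momJ momW.
have R_local := Rop_local filtF markovX delta_gt0 omega_continuous omega_ge0
  f_cont C_gt0 f_growth gamma_lt0 momJ momW U_borel minorised.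
have R_sub K w w' x : 0 < K -> growth omega K w -> growth omega K w' ->
    Rw w' x - Rw w x <= tm w x (fun y => w' y - w y).
  exact: (Rop_sub_le filtF markovX delta_gt0 omega_continuous omega_ge0
    f_cont C_gt0 f_growth gamma_lt0 momJ momW).
have t_comb K w x K' phi (B : set (borel_space R d)) c0' c1 c2 :
    0 < K -> growth omega K w -> observable omega K' phi -> measurable B ->
    (forall y, phi y <= c0' + c1 * \1_B y + c2 * omega y) ->
    tm w x phi <= c0' + c1 * tm w x \1_B + c2 * tm w x omega.
  exact: (tilted_le_comb filtF markovX delta_gt0 omega_continuous omega_ge0
    f_cont C_gt0 f_growth gamma_lt0 momJ momW).
have t_setC K w x (B : set (borel_space R d)) : 0 < K -> growth omega K w ->
    measurable B -> tm w x \1_B <= 1 - tm w x \1_(~` B).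
  exact: (tilted_indic_setC filtF markovX delta_gt0 omega_continuous omega_ge0
    f_cont C_gt0 f_growth gamma_lt0 momJ momW).
have t_ge0 K w x (B : set (borel_space R d)) : 0 < K -> growth omega K w ->
    0 <= tm w x \1_B.
  exact: (tilted_indic_ge0 filtF markovX delta_gt0 omega_continuous omega_ge0
    f_cont C_gt0 f_growth gamma_lt0 momJ momW).
have t_drift K (K0 : 0 < K) := tilted_drift filtF markovX delta_gt0 omega_continuous omega_ge0
  f_cont C_gt0 f_growth gamma_lt0 b1_gt0 momJ momW b1_lt1 K0.
have t_overlap K r (K0 : 0 < K) (r0 : 0 < r) :=
  tilted_overlap filtF markovX delta_gt0 omega_continuous omega_ge0
  f_cont C_gt0 f_growth gamma_lt0 b1_gt0 momJ momW minorised K0 r0.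
have R_contract := Rop_contract omega_ge0 R_sub t_comb t_setC t_ge0 t_drift t_overlap.
have R_shift K w x : 0 < K -> growth omega K w -> has_sup [set Rw w xi + c x xi | xi in U].
  by move=> K0 gw; exact: (shift_has_sup compactU U_nonempty c_le0 R_continuous x K0 gw).
have equationE K w lambda : 0 < K -> growth omega K w ->
    bellman_equation P X U delta gamma f c w lambda <->
    forall x, Bop U c Rw w x = w x + lambda.
  move=> K0 gw; apply: bellman_equationP => x; first exact: R_entropic gw.
  exact: R_shift gw.
have [K [w [lambda [K0 gw fixw]]]] := bellman_exists omega_continuous omega_ge0 compactU
  U_nonempty c_cont c_le0 Chat_gt0 c_lower C_gt0 b1_gt0 b1_lt1 R_continuous R_addc
  R_upper R_lower R_local R_contract.
exists w, lambda; split.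
- exact: growth_weighted gw.
- exact/(equationE K).
move=> w' lambda' /(weighted_growth omega_ge0)[K' K'0 gw'] eq'.
have KK0 : 0 < Num.max K K' by rewrite lt_max K0.
have gw2 : growth omega (Num.max K K') w.
  by apply: growth_le gw => //; rewrite le_max lexx.
have gw'2 : growth omega (Num.max K K') w'.
  by apply: growth_le gw' => //; rewrite le_max lexx orbT.
have fixw' x : Bop U c Rw w' x = w' x + lambda' by exact: (equationE K' _ _ K'0 gw').1.
exact: (bellman_unique omega_continuous omega_ge0 compactU U_nonempty c_le0 R_continuous
  R_addc R_contract KK0 gw2 gw'2 fixw fixw').
Qed.
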